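(* Let $T>0$, $\eta>0$, let $q_0\in L^\infty(\mathbb{R};\mathbb{R}_{\ge0})$ have finite total variation, and let $V\in C^2(\mathbb{R})$ with $V'\le0$. Let $q_\eta$ be the weak solution on $(0,T)\times\mathbb{R}$ of $$\partial_tq+\partial_x\big(q\,\mathcal{W}_\eta[V(q)]\big)=0,\quad q(0,\cdot)=q_0,\qquad \mathcal{W}_\eta[V(q)](t,x)=\tfrac1\eta\int_x^\infty e^{\frac{x-y}{\eta}}V(q(t,y))\,dy .$$ Assume that $$V'(x)x-V(x)+V\Big(\operatorname*{ess\,inf}_{y\in\mathbb{R}}q_0(y)\Big)\le0\qquad\forall x\in\Big(\operatorname*{ess\,inf}_{y\in\mathbb{R}}q_0(y),\|q_0\|_{L^\infty(\mathbb{R})}\Big).$$ Then for all $t\in[0,T]$ $$\big|\mathcal{W}_\eta[V(q_\eta)](t,\cdot)\big|_{TV(\mathbb{R})}\le\big|\mathcal{W}_\eta[V(q_\eta)](0,\cdot)\big|_{TV(\mathbb{R})}\le\|V'\|_{L^\infty((0,\|q_0\|_{L^\infty(\mathbb{R})}))}\,|q_0|_{TV(\mathbb{R})} .$$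
   Context: $\Omega_T:=(0,T)\times\mathbb{R}$. $TV(\mathbb{R})$ denotes the set of functions of finite total variation and $|\cdot|_{TV(\mathbb{R})}$ the total variation seminorm. Weak solution: a function $q\in C([0,T];L^1_{\mathrm{loc}}(\mathbb{R}))\cap L^\infty((0,T);L^\infty(\mathbb{R})\cap TV(\mathbb{R}))$ such that $W:=\mathcal{W}_\eta[V(q)]\in C([0,T];L^1_{\mathrm{loc}}(\mathbb{R}))$ and, for all $\phi\in C^1_c((-42,T)\times\mathbb{R})$, $$\iint_{\Omega_T}q\,(\partial_t\phi+W\,\partial_x\phi)\,dx\,dt+\int_{\mathbb{R}}q_0(x)\phi(0,x)\,dx=0 .$$ Under the stated assumptions there is a unique weak solution on every finite time horizon. *)

(* Defs.v *)
From HB Require Import structures.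
From mathcomp Require Import all_boot all_order all_algebra.
From mathcomp Require Import all_classical all_reals all_analysis.
Set Implicit Arguments.
Unset Strict Implicit.
Unset Printing Implicit Defensive.
Import Order.TTheory GRing.Theory Num.Theory.
Import numFieldNormedType.Exports.
Local Open Scope classical_set_scope.
Local Open Scope ring_scope.

Definition of_class_C {R : realType} (k : nat) (f : R -> R) : Prop :=
  (forall j, (j < k)%N -> forall x, derivable (derive1n j f) x 1) /\
  continuous (derive1n k f).

Definition of_class_C1_2 {R : realType} (phi : R * R -> R) : Prop :=
  [/\ forall z, derivable phi z (1, 0), forall z, derivable phi z (0, 1),
      continuous (fun z => 'D_(1, 0) phi z) &
      continuous (fun z => 'D_(0, 1) phi z)].

(* An element of C^1_c(D) is identified with its extension by zero to the
   whole space, hence the support has to be a compact subset of D. *)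
Definition compactly_supported_in {R : realType} {U : topologicalType}
    (D : set U) (f : U -> R) : Prop :=
  let supp := closure [set x | f x != 0] in compact supp /\ supp `<=` D.

(* Total variation seminorm of (the a.e. class of) a locally integrable
   function; unlike the pointwise [total_variation] of the library, it does not
   depend on the representative. *)
Definition TV_seminorm {R : realType} (f : R -> R) : \bar R :=
  ereal_sup [set (\int[lebesgue_measure]_x (f x * derive1 phi x))%:E
    | phi in [set phi : R -> R | [/\ of_class_C 1 phi,
        compactly_supported_in setT phi & forall x, `|phi x| <= 1]]].

Definition Linfty_norm {R : realType} (f : R -> R) : \bar R :=
  Lnorm lebesgue_measure +oo%E (EFin \o f).

(* The L^oo(D) norm is the L^oo(R) norm of the extension by zero from D. *)
Definition Linfty_norm_on {R : realType} (D : set R) (f : R -> R) : \bar R :=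
  Linfty_norm (f \_ D).

(* Space-time functions are curried, time first. *)

Definition continuous_L1loc {R : realType} (T : R) (f : R -> R -> R) : Prop :=
  (forall t : R, t \in `[0, T] -> locally_integrable setT (f t)) /\
  (forall K : set R, compact K -> forall t : R, t \in `[0, T] ->
    (\int[lebesgue_measure]_(x in K) `|f s x - f t x|%:E)%E
      @[s --> within `[0, T] (nbhs t)] --> 0%E).

Definition bounded_Linfty_TV {R : realType} (T : R) (f : R -> R -> R) : Prop :=
  exists M : R, {ae lebesgue_measure, forall t, t \in `]0, T[ ->
    (Linfty_norm (f t) <= M%:E)%E /\ (TV_seminorm (f t) <= M%:E)%E}.

Definition nonlocal {R : realType} (eta : R) (V : R -> R) (q : R -> R -> R)
    (t x : R) : R :=
  eta^-1 * \int[lebesgue_measure]_(y in `[x, +oo[)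
             (expR ((x - y) / eta) * V (q t y)).

(* The first condition selects a jointly measurable representative of q, so
   that the space-time integral makes sense; every element of
   C([0,T]; L^1_loc) has one. *)
Definition weak_solution {R : realType} (T eta : R) (V q0 : R -> R)
    (q : R -> R -> R) : Prop :=
  let W := nonlocal eta V q in
  [/\ measurable_fun (`[0, T] `*` setT) (fun z : R * R => q z.1 z.2),
      continuous_L1loc T q, bounded_Linfty_TV T q, continuous_L1loc T W &
      forall phi : R * R -> R, of_class_C1_2 phi ->
        compactly_supported_in (`]-42%:R, T[ `*` setT) phi ->
        \int[(lebesgue_measure \x lebesgue_measure)%E]_(z in `]0, T[ `*` setT)
          (q z.1 z.2 * ('D_(1, 0) phi z + W z.1 z.2 * 'D_(0, 1) phi z))
        + \int[lebesgue_measure]_x (q0 x * phi (0, x)) = 0].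

(* Main.v *)
(* With b = 1/eta and K the exponential density of rate b, W = W_eta[V(q)] is
   the average of V(q) to the right against K, so W_x = b (W - V(q)).  Hence
   w := W_x solves
     w_t + W w_x = - w^2 + b (A w - K * (A w)),   A := W - V(q) + V'(q) q.
   By the maximum principle q stays above m := ess inf q0, so W <= V(m) and the
   structural condition gives A <= 0.  Multiplying by sgn w and integrating,
   the transport term cancels w^2 and the terms in A have a sign because K has
   mass one; the L^1 norm of w, which is the total variation of W, does not
   increase.  To justify this, q is mollified in space; since q is of bounded
   variation and W is Lipschitz, the commutator is O(eps) in L^1.  Sign and line
   are replaced by u / sqrt (u^2 + delta^2) and an integrable weight psi.  At
   time 0, V o q0 has variation at most ||V'|| |q0|_TV and averaging does not
   increase it. *)
Require Import Defs.
From HB Require Import structures.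
From mathcomp Require Import all_boot all_order all_algebra.
From mathcomp Require Import all_classical all_reals all_analysis.
From mathcomp Require Import ess_sup_inf measurable_realfun.
From mathcomp Require Import ring lra.
Import Order.TTheory GRing.Theory Num.Theory.
Import numFieldNormedType.Exports.
Local Open Scope classical_set_scope.
Local Open Scope ring_scope.
Set Implicit Arguments.
Unset Strict Implicit.

(** * Integrals and correlations on the real line *)

(** The obstacle is regularity: q is only L^1_loc continuous in time and of bounded variation in
    space. Even after mollification in space the weak formulation yields only identities integrated
    in time. So no time derivative of the solution is formed: each evolution is a one-step Euler
    inequality with error quadratic in the step, and [gronwall] refines the step to zero. Hence the
    Euler constant may blow up with the mollification parameter e; only the residual, O(e) in L^1,
    has to be controlled. The spatial counterpart is [c11], a quadratic Taylor remainder, stable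
    under averages, products and composition. The parameters are removed in the order e, delta, a.
    The weight psi is 1 / (2 cosh (a x)): its upper bound 1/2 is used at time 0, its lower bound on
    the support of a test function at time t, and the two factors cancel as a tends to 0. The lower
    and upper bounds on q come from the same one-step inequality, applied to the squared excess over
    a constant. *)

Ltac mtac := repeat (first
  [ assumption
  | exact: measurable_cst
  | exact: measurable_id
  | exact: measurable_fst
  | exact: measurable_snd
  | apply: measurable_funD
  | apply: measurable_funB
  | apply: measurable_funM
  | apply: measurable_funX
  | apply: measurable_funN
  | apply: (measurableT_comp (@normr_measurable _ _))
  | apply: (measurableT_comp (@measurable_expR _)) ]).

Section lebesgue_integral.
Variable R : realType.
Implicit Types (f g k : R -> R).
Notation mu := (@lebesgue_measure R).

Definition integ f := mu.-integrable setT (EFin \o f).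
Definition integralR f := (\int[mu]_x f x)%R.
Local Notation I := integralR.
Definition meas f := measurable_fun [set: R] f.

Lemma meas_shift f (z : R) : meas f -> meas (fun x => f (x + z)).
Proof.
move=> mf; apply: (measurableT_comp mf).
by mtac.
Qed.

Lemma measurable_add_fun (z : R) : measurable_fun [set: R] (fun x : R => x + z).
Proof. by mtac. Qed.

(** The pushforward under the shift gives half-open intervals their length, and Lebesgue measure is
    the only measure doing so. *)
Lemma lebesgue_measure_shift (z : R) (A : set R) : measurable A ->
  mu ((fun x => x + z) @^-1` A) = mu A.
Proof.
move=> mA.
have mphi := measurable_add_fun z.
rewrite -[LHS]/(pushforward mu (fun x : R => x + z) A).
apply/esym.
have U := (@lebesgue_measure_unique R (@measure_function_pushforward__canonical__measure_function_Measure _ _ (measurableTypeR R) (measurableTypeR R) R mu (fun x : R => x + z) mphi)).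
rewrite -(U _ A mA) => //.
move=> X [[a b] _ <-] /=.
rewrite /pushforward.
have -> : (fun x : R => x + z) @^-1` `]a, b] = `]a - z, b - z]%classic.
  by apply/seteqP; split => x /=; rewrite !in_itv /= ltrBlDr lerBrDr.
rewrite !lebesgue_measure_itv /= !lte_fin ltrD2r.
case: ifP => // _; rewrite -!EFinD; congr (_%:E); ring.
Qed.

Lemma ge0_integral_shift (f : R -> \bar R) (z : R) : measurable_fun setT f ->
  (forall x, 0 <= f x)%E ->
  (\int[mu]_x f (x + z)%R = \int[mu]_x f x)%E.
Proof.
move=> mf f0.
have mphi := measurable_add_fun z.
have := @ge0_integral_pushforward _ _ (measurableTypeR R) (measurableTypeR R) R _ mphi mu setT f measurableT mf (fun x _ => f0 x).
rewrite preimage_setT => <-.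
apply: eq_measure_integral => A mA _.
exact: lebesgue_measure_shift.
Qed.

(** Same uniqueness argument; the reflection exchanges the closed and the open end of an interval,
    which does not affect its length. *)
Lemma lebesgue_measure_opp (A : set R) : measurable A ->
  mu ((fun x => - x) @^-1` A) = mu A.
Proof.
move=> mA.
have mphi : measurable_fun [set: R] (fun x : R => - x) by mtac.
rewrite -[LHS]/(pushforward mu (fun x : R => - x) A).
apply/esym.
have U := (@lebesgue_measure_unique R (@measure_function_pushforward__canonical__measure_function_Measure _ _ (measurableTypeR R) (measurableTypeR R) R mu (fun x : R => - x) mphi)).
rewrite -(U _ A mA) => //.
move=> X [[a b] _ <-] /=.
rewrite /pushforward.
have -> : (fun x : R => - x) @^-1` `]a, b] = `[- b, - a[%classic.
  by apply/seteqP; split => x /=; rewrite !in_itv /= lerNl ltrNr andbC.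
rewrite !lebesgue_measure_itv /= !lte_fin ltrN2.
case: ifP => // _; rewrite -!EFinD; congr (_%:E); ring.
Qed.

Lemma ge0_integral_opp (f : R -> \bar R) : measurable_fun setT f ->
  (forall x, 0 <= f x)%E ->
  (\int[mu]_x f (- x)%R = \int[mu]_x f x)%E.
Proof.
move=> mf f0.
have mphi : measurable_fun [set: R] (fun x : R => - x) by mtac.
have := @ge0_integral_pushforward _ _ (measurableTypeR R) (measurableTypeR R) R _ mphi mu setT f measurableT mf (fun x _ => f0 x).
rewrite preimage_setT => <-.
apply: eq_measure_integral => A mA _.
exact: lebesgue_measure_opp.
Qed.

(** Measurability and an explicit L^1 bound travel together, so that constants propagate through
    sums, products and averages by rules and no norm has to be computed. *)
Definition nle f (C : R) := meas f /\ (\int[mu]_x `|f x|%:E <= C%:E)%E.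

Lemma integ_meas f : integ f -> meas f.
Proof. by move=> /integrableP[/measurable_EFinP]. Qed.

Lemma measE f : meas f -> measurable_fun setT (EFin \o f).
Proof. by move=> /measurable_EFinP. Qed.

Lemma measNE f : meas f -> measurable_fun setT (fun x => `|f x|%:E).
Proof. by move=> mf; apply/measurable_EFinP; mtac. Qed.

Lemma nle_integ f C : nle f C -> integ f.
Proof.
move=> [mf fC]; apply/integrableP; split; first exact: measE.
by apply: le_lt_trans fC _; rewrite ltry.
Qed.

Lemma nle_ge0 f C : nle f C -> 0 <= C.
Proof.
move=> [mf fC]; rewrite -lee_fin; apply: le_trans fC.
by apply: integral_ge0 => x _; rewrite lee_fin.
Qed.

Lemma integ_nle f : integ f -> nle f (I (fun x => `|f x|)).
Proof.
move=> iF; split; first exact: integ_meas.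
rewrite /integralR /Rintegral fineK//.
by have /integrable_fin_num := integrable_norm iF; apply.
Qed.

Lemma nle_normI f C : nle f C -> `|I f| <= C.
Proof.
move=> nf; have iF := nle_integ nf.
rewrite -lee_fin EFin_normr_Rintegral//.
apply: le_trans nf.2; apply: le_abse_integral => //.
exact: measE nf.1.
Qed.

Lemma nle_I f C : nle f C -> I f <= C.
Proof. by move=> /nle_normI; apply: le_trans; exact: ler_norm. Qed.

Lemma nle_le f g C : meas f -> (forall x, `|f x| <= `|g x|) -> nle g C -> nle f C.
Proof.
move=> mf fg [mg gC]; split => //; apply: le_trans gC.
by apply: ge0_le_integral => //; [exact: measNE|exact: measNE|move=> x _; rewrite lee_fin].
Qed.

Lemma nle_aele f g C : meas f -> {ae mu, forall x, `|f x| <= `|g x|} ->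
  nle g C -> nle f C.
Proof.
move=> mf fg [mg gC]; split => //; apply: le_trans gC.
apply: ae_ge0_le_integral => //; [exact: measNE|exact: measNE|].
by apply: (@filterS _ _ (ae_filter_ringOfSetsType mu) _ _ _ fg) => x fgx _; rewrite lee_fin.
Qed.

Lemma nleC f C C' : C <= C' -> nle f C -> nle f C'.
Proof. by move=> CC' [mf fC]; split => //; apply: le_trans fC _; rewrite lee_fin. Qed.

Lemma nleD f g C C' : nle f C -> nle g C' -> nle (fun x => f x + g x) (C + C').
Proof.
move=> [mf fC] [mg gC]; split; first by rewrite /meas; mtac.
rewrite EFinD; apply: le_trans (leeD fC gC).
rewrite -ge0_integralD//; [|exact: measNE|exact: measNE].
apply: ge0_le_integral => //.
- by apply: measNE; rewrite /meas; mtac.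
- by apply: emeasurable_funD; exact: measNE.
- by move=> x _; rewrite -EFinD lee_fin ler_normD.
Qed.

Lemma nleZ f C c : nle f C -> nle (fun x => c * f x) (`|c| * C).
Proof.
move=> [mf fC]; split; first by rewrite /meas; mtac.
under eq_integral do rewrite normrM EFinM.
rewrite ge0_integralZl//; [|exact: measNE].
by rewrite EFinM; apply: lee_wpmul2l.
Qed.

Lemma nleN f C : nle f C -> nle (fun x => - f x) C.
Proof.
move=> nf; apply: (nle_le (g := f)) => //; last by move=> x; rewrite normrN.
by have := nf.1; rewrite /meas => mf; mtac.
Qed.

Lemma nleB f g C C' : nle f C -> nle g C' -> nle (fun x => f x - g x) (C + C').
Proof. by move=> nf ng; exact: nleD nf (nleN ng). Qed.

Lemma nleM f g B C : meas f -> (forall x, `|f x| <= B) -> nle g C ->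
  nle (fun x => f x * g x) (B * C).
Proof.
move=> mf fB ng; have mg := ng.1.
have B0 : 0 <= B by apply: le_trans (fB 0).
have := nleZ B ng; rewrite ger0_norm//; apply: nle_le => [|x].
  by rewrite /meas in mf mg *; mtac.
by rewrite !normrM ler_wpM2r// (le_trans (fB x))// ger0_norm.
Qed.

Lemma nle_shift f C z : nle f C -> nle (fun x => f (x + z)) C.
Proof.
move=> [mf fC]; split; first exact: meas_shift.
rewrite (ge0_integral_shift (f := fun x => `|f x|%:E) z)//; exact: measNE.
Qed.

Lemma integ_shift f z : integ f -> integ (fun x => f (x + z)).
Proof. by move=> /integ_nle/(nle_shift z)/nle_integ. Qed.

Lemma integ_le f g : meas f -> (forall x, `|f x| <= `|g x|) -> integ g -> integ f.
Proof. by move=> mf fg /integ_nle ng; apply: nle_integ; exact: nle_le ng. Qed.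

Lemma integD f g : integ f -> integ g -> integ (fun x => f x + g x).
Proof. by move=> /integ_nle nf /integ_nle ng; apply: nle_integ; exact: nleD nf ng. Qed.

Lemma integB f g : integ f -> integ g -> integ (fun x => f x - g x).
Proof. by move=> /integ_nle nf /integ_nle ng; apply: nle_integ; exact: nleB nf ng. Qed.

Lemma integZ f c : integ f -> integ (fun x => c * f x).
Proof. by move=> /integ_nle nf; apply: nle_integ; exact: nleZ nf. Qed.

Lemma integM f g B : meas f -> (forall x, `|f x| <= B) -> integ g -> integ (fun x => f x * g x).
Proof. by move=> mf fB /integ_nle nf; apply: nle_integ; exact: nleM nf. Qed.

Lemma ID f g : integ f -> integ g -> I (fun x => f x + g x) = I f + I g.
Proof. by move=> ? ?; exact: RintegralD. Qed.

Lemma IB f g : integ f -> integ g -> I (fun x => f x - g x) = I f - I g.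
Proof. by move=> ? ?; exact: RintegralB. Qed.

Lemma IZ f c : integ f -> I (fun x => c * f x) = c * I f.
Proof. by move=> ?; exact: RintegralZl. Qed.

Lemma I_le f g : integ f -> integ g -> (forall x, f x <= g x) -> I f <= I g.
Proof. by move=> ? ? fg; apply: le_Rintegral. Qed.

Lemma I_ge0 f : (forall x, 0 <= f x) -> 0 <= I f.
Proof. by move=> f0; apply: Rintegral_ge0. Qed.

Lemma eqI f g : f =1 g -> I f = I g.
Proof. by move=> /funext ->. Qed.

(** The positive and negative parts are shifted separately, which reduces the claim to nonnegative
    functions. *)
Lemma I_shift f z : meas f -> I (fun x => f (x + z)) = I f.
Proof.
move=> mf; rewrite /integralR /Rintegral; congr fine.
rewrite integralE [RHS]integralE; congr (_ - _)%E.
- rewrite -(ge0_integral_shift (f := (EFin \o f)^\+%E) z); last 2 first.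
  + by apply: measurable_funepos; exact: measE.
  + by move=> x; exact: funepos_ge0.
  by rewrite funepos.unlock.
- rewrite -(ge0_integral_shift (f := (EFin \o f)^\-%E) z); last 2 first.
  + by apply: measurable_funeneg; exact: measE.
  + by move=> x; exact: funeneg_ge0.
  by rewrite funeneg.unlock.
Qed.

Lemma I_opp f : meas f -> I (fun x => f (- x)) = I f.
Proof.
move=> mf; rewrite /integralR /Rintegral; congr fine.
rewrite integralE [RHS]integralE; congr (_ - _)%E.
- rewrite -(ge0_integral_opp (f := (EFin \o f)^\+%E)); last 2 first.
  + by apply: measurable_funepos; exact: measE.
  + by move=> x; exact: funepos_ge0.
  by rewrite funepos.unlock.
- rewrite -(ge0_integral_opp (f := (EFin \o f)^\-%E)); last 2 first.
  + by apply: measurable_funeneg; exact: measE.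
  + by move=> x; exact: funeneg_ge0.
  by rewrite funeneg.unlock.
Qed.

End lebesgue_integral.

(** * Correlations with an integrable kernel, and Fubini in usable form *)

Section correlation.
Variable R : realType.
Implicit Types (f g k : R -> R).
Notation mu := (@lebesgue_measure R).
Notation I := (@integralR R).

Lemma meas_param d (T1 : measurableType d) (G : T1 * R -> R) : measurable_fun setT G ->
  measurable_fun setT (fun x => I (fun z => G (x, z))).
Proof.
move=> mG.
have mE : measurable_fun setT (EFin \o G) by apply/measurable_EFinP.
apply: (measurableT_comp (fine_measurable measurableT)).
apply: (eq_measurable_fun (fun x => (\int[mu]_y ((EFin \o G)^\+%E (x, y)) - \int[mu]_y ((EFin \o G)^\-%E (x,y)))%E)).
  by move=> x _; rewrite /= /I /Rintegral [in RHS]integralE funepos.unlock funeneg.unlock.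
apply: emeasurable_funB.
- apply: (measurable_fun_fubini_tonelli_F (m2 := mu) ((EFin \o G)^\+%E)) => [|p]; [exact: measurable_funepos|exact: funepos_ge0].
- apply: (measurable_fun_fubini_tonelli_F (m2 := mu) ((EFin \o G)^\-%E)) => [|p]; [exact: measurable_funeneg|exact: funeneg_ge0].
Qed.

(** Minkowski's integral inequality in L^1, by Tonelli. It is the standard tool below for functions
    of x defined by an integral over z: bound the section in x for each z, then integrate the
    bounds. *)
Lemma minkowski_nle (G : R * R -> R) (c F : R -> R) C : measurable_fun setT G -> meas F ->
  (forall x, (`|F x|%:E <= \int[mu]_z `|G (x, z)|%:E)%E) ->
  (forall z, (\int[mu]_x `|G (x, z)|%:E <= `|c z|%:E)%E) ->
  nle c C -> nle F C.
Proof.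
move=> mG mF FG Gc [mc cC]; split => //.
have mGE : measurable_fun setT (fun xz => `|G xz|%:E).
  by apply/measurable_EFinP; mtac.
apply: (@le_trans _ _ (\int[mu]_x \int[mu]_z `|G (x, z)|%:E)%E).
  apply: ge0_le_integral => //.
  - exact: measNE.
  - exact: (measurable_fun_fubini_tonelli_F (m2 := mu) (fun xz => `|G xz|%:E)).
rewrite (fubini_tonelli (m1 := mu) (m2 := mu) (fun xz => `|G xz|%:E))//.
apply: le_trans cC; apply: ge0_le_integral => //.
- by move=> x _; apply: integral_ge0.
- exact: (measurable_fun_fubini_tonelli_G (m1 := mu) (fun xz => `|G xz|%:E)).
- exact: measNE.
Qed.

Lemma I_swap (G : R * R -> R) C : measurable_fun setT G ->
  (forall x, integ (fun z => G (x, z))) -> (forall z, integ (fun x => G (x, z))) ->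
  (\int[mu]_x \int[mu]_z `|G (x, z)|%:E <= C%:E)%E ->
  I (fun x => I (fun z => G (x, z))) = I (fun z => I (fun x => G (x, z))).
Proof.
move=> mG iz ix CG.
have mE : measurable_fun setT (EFin \o G) by apply/measurable_EFinP.
have iG : (mu \x mu)%E.-integrable setT (EFin \o G).
  apply/integrable12ltyP => //=; apply: le_lt_trans CG _; exact: ltry.
have := Fubini iG.
rewrite /fubini_F /fubini_G /= => e.
rewrite /I /Rintegral; congr fine.
transitivity (\int[mu]_x \int[mu]_y (G (x, y))%:E)%E.
  apply: eq_integral => x _; rewrite fineK//.
  by have /integrable_fin_num := iz x; apply.
rewrite e; apply: eq_integral => x _; rewrite fineK//.
by have /integrable_fin_num := ix x; apply.
Qed.

(** Fubini under the hypothesis that is easy to check for correlations: for each z the section in x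
    is bounded in L^1 by an integrable function of z. *)
Lemma I_swap2 (G : R * R -> R) (c : R -> R) C : measurable_fun setT G ->
  (forall x, integ (fun z => G (x, z))) ->
  (forall z, nle (fun x => G (x, z)) `|c z|) -> nle c C ->
  I (fun x => I (fun z => G (x, z))) = I (fun z => I (fun x => G (x, z))).
Proof.
move=> mG iz Gc [mc cC].
apply: (@I_swap _ C) => // [z|]; first exact: nle_integ (Gc z).
have mGE : measurable_fun setT (fun xz => `|G xz|%:E).
  by apply/measurable_EFinP; mtac.
rewrite (fubini_tonelli (m1 := mu) (m2 := mu) (fun xz => `|G xz|%:E))//.
apply: le_trans cC; apply: ge0_le_integral => //.
- by move=> x _; apply: integral_ge0.
- exact: (measurable_fun_fubini_tonelli_G (m1 := mu) (fun xz => `|G xz|%:E)).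
- exact: measNE.
- by move=> z _; have [] := Gc z.
Qed.

Definition bm f B := meas f /\ forall x, `|f x| <= B.

(* A correlation: with the exponential density as [k] it is the average to the
   right defining W. *)
Definition conv k f (x : R) := I (fun z => k z * f (x + z)).

(* For bounded [f] this is equivalent to total variation at most [C], see
   [TV_tvle] and [tvle_TV]. *)
Definition tvle f C := meas f /\ forall z, nle (fun x => f (x + z) - f x) (C * `|z|).

Lemma meas_shiftl f x : meas f -> meas (fun z => f (x + z)).
Proof. by move=> /(meas_shift x); rewrite /meas; under eq_fun do rewrite addrC. Qed.

Lemma conv_integ k f C B x : nle k C -> bm f B -> integ (fun z => k z * f (x + z)).
Proof.
move=> nk [mf fB]; have := nle_integ nk => ik.
have := @integM _ (fun z => f (x + z)) k B (meas_shiftl x mf) (fun z => fB _) ik.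
by under eq_fun do rewrite mulrC.
Qed.

Lemma conv_bound k f C B x : nle k C -> bm f B -> `|conv k f x| <= B * C.
Proof.
move=> nk [mf fB]; apply: nle_normI.
have := @nleM _ (fun z => f (x + z)) k B _ (meas_shiftl x mf) (fun z => fB _) nk.
by under eq_fun do rewrite mulrC.
Qed.

Lemma meas_conv2 k (g : R * R -> R) : meas k -> measurable_fun setT g ->
  measurable_fun setT (fun tx : R * R => I (fun z => k z * g (tx.1, tx.2 + z))).
Proof.
move=> mk mg; apply: (meas_param (G := fun p : (R * R) * R => k p.2 * g (p.1.1, p.1.2 + p.2))).
apply: measurable_funM; first by apply: (measurableT_comp mk); mtac.
apply: (measurableT_comp mg); apply/measurable_fun_pair => /=.
  by apply: measurableT_comp; mtac.
by apply: measurable_funD; [apply: measurableT_comp; mtac|mtac].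
Qed.

Lemma meas_conv k f : meas k -> meas f -> meas (conv k f).
Proof.
move=> mk mf; apply: (meas_param (G := fun p : R * R => k p.2 * f (p.1 + p.2))).
apply: measurable_funM; first by apply: (measurableT_comp mk); mtac.
by apply: (measurableT_comp mf); mtac.
Qed.

Lemma bm_conv k f C B : nle k C -> bm f B -> bm (conv k f) (B * C).
Proof.
move=> nk bf; split; first by apply: meas_conv; [exact: nk.1|exact: bf.1].
by move=> x; exact: conv_bound nk bf.
Qed.

Lemma I_normE f : integ f -> (`|I f|%:E <= \int[mu]_x `|f x|%:E)%E.
Proof.
move=> iF; rewrite EFin_normr_Rintegral//; apply: le_abse_integral => //.
exact: measE (integ_meas iF).
Qed.

Lemma conv_nle k f C D B : nle k C -> bm f B -> nle f D -> nle (conv k f) (D * C).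
Proof.
move=> nk bf nf; have mk := nk.1; have mf := nf.1.
apply: (@minkowski_nle (fun p => k p.2 * f (p.1 + p.2)) (fun z => D * k z)).
- apply: measurable_funM; first by apply: (measurableT_comp mk); mtac.
  by apply: (measurableT_comp mf); mtac.
- exact: meas_conv.
- by move=> x; apply: I_normE; exact: conv_integ nk bf.
- move=> z /=; have := nle_shift z nf => /(nleZ (k z))[_].
  by move=> /le_trans; apply; rewrite lee_fin normrM mulrC ler_wpM2r// ler_norm.
- by have := nleZ D nk; rewrite ger0_norm//; exact: nle_ge0 nf.
Qed.

Lemma convB k f g C B B' x : nle k C -> bm f B -> bm g B' ->
  conv k (fun y => f y - g y) x = conv k f x - conv k g x.
Proof.
move=> nk bf bg; rewrite /conv -IB; [|exact: conv_integ nk bf|exact: conv_integ nk bg].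
by apply: eqI => z; rewrite mulrBr.
Qed.

Lemma bmB f g B B' : bm f B -> bm g B' -> bm (fun x => f x - g x) (B + B').
Proof.
move=> [mf fB] [mg gB]; split; first by rewrite /meas in mf mg *; mtac.
by move=> x; apply: le_trans (ler_normB _ _) _; apply: lerD.
Qed.

Lemma bmM f g B B' : bm f B -> bm g B' -> bm (fun x => f x * g x) (B * B').
Proof.
move=> [mf fB] [mg gB]; split; first by rewrite /meas in mf mg *; mtac.
by move=> x; rewrite normrM; apply: ler_pM.
Qed.

Lemma bm_cst c : bm (fun=> c) `|c|.
Proof. by split => //; exact: measurable_cst. Qed.

Lemma bm_shift f B y : bm f B -> bm (fun x => f (x + y)) B.
Proof. by move=> [mf fB]; split; first exact: meas_shift. Qed.

Lemma conv_cst k c C x : nle k C -> conv k (fun=> c) x = I k * c.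
Proof.
move=> nk; rewrite /conv mulrC -IZ; last exact: nle_integ nk.
by apply: eqI => z; rewrite mulrC.
Qed.

Lemma conv_le k f g C B B' x : (forall z, 0 <= k z) -> nle k C -> bm f B -> bm g B' ->
  (forall y, f y <= g y) -> conv k f x <= conv k g x.
Proof.
move=> k0 nk bf bg fg; apply: I_le; [exact: conv_integ nk bf|exact: conv_integ nk bg|].
by move=> z; rewrite ler_wpM2l.
Qed.

Lemma conv_shift k f x y : conv k f (x + y) = conv k (fun x => f (x + y)) x.
Proof. by apply: eqI => z; rewrite addrAC. Qed.

Lemma conv_sub k f C B x : nle k C -> I k = 1 -> bm f B ->
  conv k f x - f x = I (fun z => k z * (f (x + z) - f x)).
Proof.
move=> nk k1 bf; rewrite -[X in _ - X]mul1r -k1 -(conv_cst (f x) x nk).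
rewrite -(convB _ nk bf (bm_cst (f x))); exact: eqI.
Qed.

(** As [k] has mass one, the difference averages f(x + z) - f(x), whose L^1 norm in x is at most T
    |z|; integrating in z leaves the first moment of [k]. For a mollifier of width e this is
    O(e). *)
Lemma conv_nle_dist k f C B D T : nle k C -> I k = 1 -> nle (fun z => k z * z) D ->
  bm f B -> tvle f T -> nle (fun x => conv k f x - f x) (T * D).
Proof.
move=> nk k1 nD bf [_ tv]; have mk := nk.1; have mf := bf.1.
have T0 : 0 <= T by have /nle_ge0 := tv 1; rewrite normr1 mulr1.
apply: (@minkowski_nle (fun p => k p.2 * (f (p.1 + p.2) - f p.1)) (fun z => T * (k z * z))).
- apply: measurable_funM; first by apply: (measurableT_comp mk); mtac.
  by apply: measurable_funB; [apply: (measurableT_comp mf)|apply: (measurableT_comp mf)]; mtac.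
- by have := meas_conv mk mf; rewrite /meas in mf * => mc; mtac.
- move=> x; rewrite (conv_sub x nk k1 bf); apply: I_normE.
  have bB := bmB (bm_shift 0 bf) (bm_cst (f x)).
  have := conv_integ x nk bB; apply: eq_integrable => // z _ /=.
  by rewrite addr0.
- move=> z /=; have := nleZ (k z) (tv z) => -[_] /le_trans; apply.
  by rewrite lee_fin !normrM mulrCA ger0_norm.
- by have := nleZ T nD; rewrite ger0_norm.
Qed.

Lemma tvle_conv k f C B T : nle k C -> bm f B -> tvle f T -> tvle (conv k f) (T * C).
Proof.
move=> nk bf [mf tv]; split; first exact: meas_conv nk.1 mf.
move=> y.
have -> : (fun x => conv k f (x + y) - conv k f x) = conv k (fun x => f (x + y) - f x).
  by apply/funext => x; rewrite conv_shift -(convB _ nk (bm_shift y bf) bf).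
rewrite mulrAC.
exact: conv_nle nk (bmB (bm_shift y bf) bf) (tv y).
Qed.

Lemma conv_comm k l f C D B x : nle k C -> nle l D -> bm f B ->
  conv k (conv l f) x = conv l (conv k f) x.
Proof.
move=> nk nl bf; have mk := nk.1; have ml := nl.1; have mf := bf.1.
have B0 : 0 <= B by apply: le_trans (bf.2 0).
have iG : forall z, integ (fun y => k z * (l y * f (x + z + y))).
  by move=> z; apply: integZ; exact: conv_integ nl bf.
have iG' : forall y, integ (fun z => k z * (l y * f (x + z + y))).
  move=> y; have := integZ (l y) (conv_integ x nk (bm_shift y bf)).
  by apply: eq_integrable => // z _ /=; rewrite mulrCA.
transitivity (I (fun z => I (fun y => k z * (l y * f (x + z + y))))).
  by apply: eqI => z; rewrite IZ//; exact: conv_integ nl bf.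
rewrite (@I_swap (fun p => k p.1 * (l p.2 * f (x + p.1 + p.2))) (C * (B * D)))//; [|shelve|].
- apply: eqI => y; rewrite /conv /= -IZ; last exact: conv_integ nk bf.
  by apply: eqI => z; rewrite mulrCA; congr (_ * (_ * f _)); ring.
- apply: (@le_trans _ _ (\int[mu]_z (`|(B * D) * k z|)%:E)%E); last first.
    have := nleZ (B * D) nk => -[_] /le_trans; apply.
    by rewrite lee_fin ger0_norm ?mulr_ge0// ?(nle_ge0 nl)// mulrC.
  apply: ge0_le_integral => //.
  + by move=> z _; apply: integral_ge0.
  + apply: (measurable_fun_fubini_tonelli_F (m2 := mu) (fun p => `|k p.1 * (l p.2 * f (x + p.1 + p.2))|%:E)) => //.
    apply/measurable_EFinP; apply: (measurableT_comp (@normr_measurable _ _)).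
    apply: measurable_funM; first by apply: (measurableT_comp mk); mtac.
    apply: measurable_funM; first by apply: (measurableT_comp ml); mtac.
    by apply: (measurableT_comp mf); mtac.
  + by apply: measNE; rewrite /meas; mtac.
  + move=> z _ /=; have := nleZ (k z) (nleM (meas_shiftl (x + z) mf) (fun y => bf.2 _) nl) => -[_].
    under eq_integral do rewrite [f _ * l _]mulrC.
    move=> /le_trans; apply; rewrite lee_fin normrM mulrC ler_wpM2r// ler_norm//.
Unshelve.
apply: measurable_funM; first by apply: (measurableT_comp mk); mtac.
apply: measurable_funM; first by apply: (measurableT_comp ml); mtac.
by apply: (measurableT_comp mf); mtac.
Qed.

End correlation.

(** * Derivatives from quadratic remainders, and the fundamental theorem of calculus *)

Section calculus.
Variable R : realType.
Implicit Types (f g k df dg : R -> R) (a b x y z c : R).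
Notation mu := (@lebesgue_measure R).
Notation I := (@integralR R).

Lemma quad_is_derive f (x d C : R) :
  (forall h, `|h| <= 1 -> `|f (x + h) - f x - d * h| <= C * h ^+ 2) ->
  is_derive x 1 f d.
Proof.
move=> H.
have C0 : 0 <= C by have := H 1; rewrite normr1 expr1n !mulr1 => /(_ (lexx _)); apply: le_trans.
have lim : h^-1 *: ((f \o shift x) (h *: (1 : R)) - f x) @[h --> 0^'] --> d.
  apply/cvgrPdist_lt => e e0; near=> h.
  have h0 : h != 0 by near: h; exact: nbhs_dnbhs_neq.
  have h1 : `|h| <= 1 by near: h; apply: dnbhs0_le.
  have h2 : (C + 1) * `|h| < e.
    rewrite mulrC -ltr_pdivlMr; last by rewrite ltr_pwDr.
    by near: h; apply: dnbhs0_lt; rewrite divr_gt0// ltr_pwDr.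
  rewrite /= [h *: _]mulr1 [h + x]addrC [_ *: _]mulrC.
  have -> : d - (f (x + h) - f x) / h = - ((f (x + h) - f x - d * h) / h) by field.
  rewrite normrN normrM normfV.
  apply: le_lt_trans h2; rewrite ler_pdivrMr ?normr_gt0//.
  apply: le_trans (H _ h1) _; rewrite -mulrA -expr2 real_normK ?num_real//.
  by rewrite ler_wpM2r ?sqr_ge0// lerDl.
split; first by apply/cvg_ex; exists d.
exact/cvg_lim.
Unshelve. all: by end_near. Qed.

Lemma is_derive_continuous f (x d : R) : is_derive x 1 f d -> {for x, continuous f}.
Proof.
by move=> [df _]; apply: differentiable_continuous; apply/derivable1_diffP.
Qed.

Lemma continuous_meas f : continuous f -> meas f.
Proof. exact: continuous_measurable_fun. Qed.

Lemma lip_continuous f C : (forall x h, `|f (x + h) - f x| <= C * `|h|) -> continuous f.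
Proof.
move=> H x.
have C0 : 0 <= C by have := H 0 1; rewrite normr1 mulr1; apply: le_trans.
apply/cvgrPdist_lt => e e0; near=> y.
have h2 : (C + 1) * `|y - x| < e.
  rewrite mulrC -ltr_pdivlMr; last by rewrite ltr_pwDr.
  rewrite distrC; near: y; apply: (@cvgr_dist_lt _ _ _ (nbhs x) _ id x) => //.
  by rewrite divr_gt0// ltr_pwDr.
rewrite distrC; apply: le_lt_trans h2.
have := H x (y - x); rewrite subrKC => /le_trans; apply.
by rewrite ler_wpM2r// lerDl.
Unshelve. all: by end_near. Qed.

(** Stated over the whole line with an indicator, so that the rules for [integ], [nle] and [conv]
    apply to it directly. *)
Lemma FTCab f df a b : a <= b -> (forall x, is_derive x 1 f (df x)) -> continuous df ->
  I (fun x => df x * \1_`[a, b]%classic x) = f b - f a.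
Proof.
move=> ab fdf cdf.
have <- : \int[mu]_(x in `[a, b]%classic) df x = I (fun x => df x * \1_`[a, b]%classic x).
  rewrite Rintegral_mkcond; apply: eqI => x.
  by rewrite patchE indicE; case: ifP => _; rewrite ?mulr1 ?mulr0.
move: ab; rewrite le_eqVlt => /predU1P[->|ab].
  by rewrite set_itv1 Rintegral_set1 subrr.
rewrite /Rintegral (@continuous_FTC2 _ df f a b)//.
- exact: continuous_subspaceT.
- have cf x := is_derive_continuous (fdf x).
  split.
  + by move=> x _; case: (fdf x).
  + by apply: cvg_at_right_filter; exact: cf.
  + by apply: cvg_at_left_filter; exact: cf.
- by move=> x _; rewrite derive1E; case: (fdf x).
Qed.

Lemma indicM_le f (A : set R) x : `|f x * \1_A x| <= `|f x|.
Proof. by rewrite normrM indicE; case: (_ \in _); rewrite ?normr1 ?normr0 ?mulr1 ?mulr0. Qed.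

Lemma I_cvg (f_ : nat -> R -> R) f g : (forall n, meas (f_ n)) -> meas f ->
  {ae mu, forall x, f_ n x @[n --> \oo] --> f x} -> integ g ->
  (forall n x, `|f_ n x| <= g x) ->
  I (f_ n) @[n --> \oo] --> I f.
Proof.
move=> mf_ mf ff ig fg.
have ffE : {ae mu, forall x, setT x -> ((f_ n x)%:E @[n --> \oo] --> (f x)%:E)}.
  apply: (@filterS _ _ (ae_filter_ringOfSetsType mu) _ _ _ ff) => x h _.
  apply: cvg_EFin; first by near=> n.
  exact: h.
have fgE : {ae mu, forall x, forall n, setT x -> (`|(f_ n x)%:E| <= (EFin \o g) x)%E}.
  by apply: aeW => x n _; rewrite lee_fin.
have [iF _] := @dominated_convergence _ (measurableTypeR R) R mu setT measurableT
  (fun n => EFin \o f_ n) (EFin \o f) (EFin \o g) (fun n => measE (mf_ n)) (measE mf) ffE ig fgE.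
rewrite /I /Rintegral => h; apply: fine_cvg; rewrite fineK//.
by have /integrable_fin_num := iF; apply.
Unshelve. all: by end_near. Qed.

Lemma meas_indic (A : set R) : measurable A -> meas (\1_A : R -> R).
Proof. by move=> mA; exact: measurable_indic. Qed.

Lemma cvg_indic_itvN x : (\1_(`[- n%:R, n%:R]%classic : set R) x : R) @[n --> \oo] --> (1 : R).
Proof.
apply: cvg_near_cst; near=> n; rewrite indicE mem_set//= in_itv/= -ler_norml.
by near: n; exact: nbhs_infty_ger.
Unshelve. all: by end_near. Qed.

End calculus.

Section limits_of_integrals.
Variable R : realType.
Implicit Types (f g k df dg : R -> R) (a b x y z c : R).
Notation mu := (@lebesgue_measure R).
Notation I := (@integralR R).

Lemma cvg_uniq (u : R^nat) a b : u @ \oo --> a -> u @ \oo --> b -> a = b.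
Proof. by move=> ua ub; rewrite -(cvg_lim (@Rhausdorff R) ua) (cvg_lim (@Rhausdorff R) ub). Qed.

(** Fatou: L^1 bounds that are uniform along an approximation pass to its almost everywhere limit.
    This removes truncations, difference quotients and mollifications. *)
Lemma fatou_nle (f_ : nat -> R -> R) f C : (forall n, nle (f_ n) C) -> meas f ->
  {ae mu, forall x, f_ n x @[n --> \oo] --> f x} -> nle f C.
Proof.
move=> nf mf ff; split => //.
pose g n x := `|f_ n x|%:E.
have g0 n x : (0 <= g n x)%E by rewrite lee_fin.
have mg n : measurable_fun setT (g n) by apply: measNE; case: (nf n).
have mG : measurable_fun setT (fun x => limn_einf (g^~ x)).
  (* Measurability of the lower limit is deduced from that of the upper limit of the opposite
     functions. *)
  have -> : (fun x => limn_einf (g^~ x)) = (fun x => - limn_esup ((fun n x => - g n x) ^~ x))%E.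
    by apply/funext => x; rewrite -limn_einfN; congr limn_einf; apply/funext => n; rewrite /comp oppeK.
  apply: (measurableT_comp (@oppe_measurable _ _)).
  apply: measurable_fun_limn_esup => n.
  exact: (measurableT_comp (@oppe_measurable _ _)).
have -> : (\int[mu]_x `|f x|%:E = \int[mu]_x limn_einf (g^~ x))%E.
  apply: ge0_ae_eq_integral => //.
  - exact: measNE.
  - move=> x _; rewrite limn_einf_lim; apply: lime_ge; first exact: is_cvg_einfs.
    by near=> n; apply: le_ereal_inf_tmp => _ [m _ <-].
  - apply: (@filterS _ _ (ae_filter_ringOfSetsType mu) _ _ _ ff) => x h _.
    have /cvg_limn_einf_sup[-> //] : g^~ x @ \oo --> `|f x|%:E.
    apply: cvg_EFin; first by near=> n.
    exact: (cvg_norm h).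
apply: le_trans (@fatou _ (measurableTypeR R) R mu setT measurableT g mg (fun n x _ => g0 n x)) _.
rewrite limn_einf_lim; apply: lime_le; first exact: is_cvg_einfs.
near=> n; apply: (@le_trans _ _ (\int[mu]_x g n x)%E); last by case: (nf n).
by apply: ereal_inf_lbound; exists n => //=.
Unshelve. all: by end_near. Qed.

Lemma integ_norm g : integ g -> integ (fun x => `|g x|).
Proof.
move=> ig; apply: (integ_le _ _ ig) => [|x]; last by rewrite normr_id.
by have := integ_meas ig; rewrite /meas => mg; mtac.
Qed.

Lemma I_trunc_cvg g : integ g ->
  I (fun x => g x * \1_`[- n%:R, n%:R]%classic x) @[n --> \oo] --> I g.
Proof.
move=> ig; have mg := integ_meas ig.
apply: (@I_cvg _ _ _ (fun x => `|g x|)) => //.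
- by move=> n; have := @meas_indic R `[- n%:R, n%:R]%classic (measurable_itv _); rewrite /meas in mg * => mi; mtac.
- apply: aeW => x; rewrite -[X in _ --> X]mulr1.
  by apply: cvgM; [exact: cvg_cst|exact: cvg_indic_itvN].
- exact: integ_norm.
- by move=> n x; exact: indicM_le.
Qed.

Lemma I_derive_line f df : (forall x, is_derive x 1 f (df x)) -> continuous df ->
  integ df -> f n%:R @[n --> \oo] --> (0 : R) -> f (- n%:R) @[n --> \oo] --> (0 : R) ->
  I df = 0.
Proof.
move=> fdf cdf idf f1 f2.
have h := I_trunc_cvg idf.
have {}h : f n%:R - f (- n%:R) @[n --> \oo] --> I df.
  apply: cvg_trans h; apply: near_eq_cvg; near=> n.
  by rewrite (FTCab _ fdf cdf)// ge0_cp ?oppr_le0.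
have h2 : f n%:R - f (- n%:R) @[n --> \oo] --> (0 - 0 : R) by exact: cvgB.
rewrite subrr in h2.
exact: (cvg_uniq h h2).
Unshelve. all: by end_near. Qed.

Lemma I_derive_halfline f df : (forall x, is_derive x 1 f (df x)) -> continuous df ->
  integ (fun x => df x * \1_`[0, +oo[%classic x) -> f n%:R @[n --> \oo] --> (0 : R) ->
  I (fun x => df x * \1_`[0, +oo[%classic x) = - f 0.
Proof.
move=> fdf cdf idf f1.
have h := I_trunc_cvg idf.
have {}h : f n%:R - f 0 @[n --> \oo] --> I (fun x => df x * \1_`[0, +oo[%classic x).
  apply: cvg_trans h; apply: near_eq_cvg; near=> n.
  rewrite -(FTCab _ fdf cdf)//; apply: eqI => x.
  rewrite -mulrA; congr (_ * _).
  rewrite -[LHS]/((\1_(`[0%R, +oo[%classic : set R) \* \1_(`[- n%:R, n%:R]%classic : set R)) x).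
  rewrite -indicI; congr (\1__ _).
  apply/seteqP; split => y /=; rewrite !in_itv/= ?andbT.
    by case=> y0 /andP[_ yn]; rewrite y0 yn.
  by case/andP => y0 yn; rewrite y0 yn andbT; split => //; rewrite (le_trans _ y0)// oppr_le0.
have h2 : f n%:R - f 0 @[n --> \oo] --> 0 - f 0 by apply: cvgB => //; exact: cvg_cst.
by rewrite (cvg_uniq h h2)// sub0r.
Unshelve. all: by end_near. Qed.

(** C^{1,1} regularity with a single constant for size, derivative and Taylor remainder. Being a
    pointwise inequality, it passes through integrals against a kernel without differentiation under
    the integral sign. *)
Definition c11 f df C := [/\ bm f C, bm df C &
  forall x h, `|f (x + h) - f x - df x * h| <= C * h ^+ 2].

Lemma c11_derive f df C x : c11 f df C -> is_derive x 1 f (df x).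
Proof. by case=> _ _ H; apply: (@quad_is_derive _ _ _ _ C) => h _. Qed.

Lemma c11_ge0 f df C : c11 f df C -> 0 <= C.
Proof. by case=> -[_ H] _ _; apply: le_trans (H 0). Qed.

(** Adding the Taylor expansions from x to x + h and back leaves (df(x + h) - df(x)) h. *)
Lemma c11_lipd f df C x h : c11 f df C -> `|df (x + h) - df x| <= 2 * C * `|h|.
Proof.
case=> _ _ H; have [->|h0] := eqVneq h 0; first by rewrite addr0 subrr !normr0 mulr0.
rewrite -(ler_pM2r (_ : 0 < `|h|)) ?normr_gt0// -normrM.
have := H x h; have := H (x + h) (- h); rewrite addrK sqrrN => h1 h2.
have -> : (df (x + h) - df x) * h = (f x - f (x + h) - df (x + h) * - h) + (f (x + h) - f x - df x * h).
  ring.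
apply: le_trans (ler_normD _ _) _; apply: le_trans (lerD h1 h2) _.
rewrite -[h ^+ 2]real_normK ?num_real//; rewrite expr2; lra.
Qed.

(** For |h| <= 1 the expansion gives 2 C |h|; for larger h the sup bound 2 C is already below the
    claim. *)
Lemma c11_lip f df C x h : c11 f df C -> `|f (x + h) - f x| <= 3 * C * `|h|.
Proof.
move=> cf; have C0 := c11_ge0 cf; have [[_ fB] [_ dB] H] := cf.
have [h1|h1] := leP `|h| 1.
  have -> : f (x + h) - f x = (f (x + h) - f x - df x * h) + df x * h by ring.
  apply: le_trans (ler_normD _ _) _.
  apply: (@le_trans _ _ (C * `|h| + C * `|h|)); last first.
    by rewrite -mulrDl ler_wpM2r//; lra.
  apply: lerD; last by rewrite normrM ler_wpM2r.
  apply: le_trans (H _ _) _; rewrite ler_wpM2l//.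
  by rewrite -[h ^+ 2]real_normK ?num_real// expr2 ler_piMl.
apply: le_trans (ler_normB _ _) _; apply: le_trans (lerD (fB _) (fB _)) _.
have : C * 1 <= C * `|h| by rewrite ler_wpM2l// ltW.
by rewrite mulr1; nra.
Qed.

Lemma c11_cont f df C : c11 f df C -> continuous f.
Proof. by move=> cf x; apply: is_derive_continuous (c11_derive x cf). Qed.

Lemma c11_contd f df C : c11 f df C -> continuous df.
Proof. by move=> cf; apply: (@lip_continuous _ _ (2 * C)) => x h; exact: c11_lipd cf. Qed.

Lemma c11_conv k f df C D : nle k D -> c11 f df C ->
  c11 (conv k f) (conv k df) (C * D).
Proof.
move=> nk cf; have [bf bd H] := cf.
split; [exact: bm_conv|exact: bm_conv|move=> x h].
rewrite conv_shift -(convB _ nk (bm_shift h bf) bf) mulrC.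
rewrite -[h * _]/(h * conv k df x).
have -> : h * conv k df x = conv k (fun y => h * df y) x.
  rewrite /conv -IZ; last exact: conv_integ nk bd.
  by apply: eqI => z; rewrite mulrCA.
have bh : bm (fun y => h * df y) (`|h| * C) := bmM (bm_cst h) bd.
rewrite -(convB _ nk (bmB (bm_shift h bf) bf) bh).
rewrite mulrAC.
apply: conv_bound nk _; split.
  exact: (bmB (bmB (bm_shift h bf) bf) bh).1.
by move=> y; rewrite [h * _]mulrC.
Qed.

Lemma c11_le f df C C' : C <= C' -> c11 f df C -> c11 f df C'.
Proof.
move=> CC' [[mf fB] [md dB] H]; split; [split=> // x|split=> // x|move=> x h].
- exact: le_trans (fB _) CC'.
- exact: le_trans (dB _) CC'.
- by apply: le_trans (H _ _) _; rewrite ler_wpM2r// sqr_ge0.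
Qed.

End limits_of_integrals.

(** * A quadratic spline mollifier *)

Section spline_mollifier.
Variable R : realType.
Implicit Types (f g k df dg dk : R -> R) (a b x y z c e : R).
Notation mu := (@lebesgue_measure R).
Notation I := (@integralR R).

Lemma nle_supp f B a b : a <= b -> meas f -> (forall x, `|f x| <= B) ->
  (forall x, x \notin `[a, b] -> f x = 0) -> nle f ((b - a) * B).
Proof.
move=> ab mf fB f0; split => //.
have B0 : 0 <= B by apply: le_trans (fB 0).
apply: (@le_trans _ _ (\int[mu]_x (B * \1_`[a, b]%classic x)%:E)%E).
  apply: ge0_le_integral => //.
  - exact: measNE.
  - by apply/measurable_EFinP; have := @meas_indic R `[a, b]%classic (measurable_itv _);
      rewrite /meas => mi; mtac.
  - move=> x _; rewrite lee_fin indicE.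
    have [xab|xab] := boolP (x \in `[a, b]); first by rewrite mem_set// mulr1.
    by rewrite f0// normr0 mulr_ge0.
have muE : mu `[a, b]%classic = (b - a)%:E.
  rewrite lebesgue_measure_itv /= lte_fin; case: ltP => // ba.
  by have -> : a = b by [apply/eqP; rewrite eq_le ab ba]; rewrite subrr.
have iI : (\int[mu]_x (\1_`[a, b]%classic x)%:E)%E = (b - a)%:E.
  by rewrite integral_indic// setIT; exact: muE.
under eq_integral do rewrite EFinM.
rewrite integralZl//; last first.
  apply/integrableP; split; first by apply/measurable_EFinP; exact: meas_indic.
  by under eq_integral do rewrite gee0_abs ?lee_fin//; rewrite iI ltry.
by rewrite iI -EFinM mulrC.
Qed.

Lemma I_ext0 f a b : (forall x, x \notin `[a, b] -> f x = 0) ->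
  I f = I (fun x => f x * \1_`[a, b]%classic x).
Proof.
move=> f0; apply: eqI => x; rewrite indicE.
have [xab|xab] := boolP (x \in `[a, b]); first by rewrite mem_set// mulr1.
by rewrite f0// mul0r.
Qed.

Definition pospart (u : R) : R := Num.max 0 u.

Lemma pospart_ge0 u : 0 <= pospart u. Proof. by rewrite /pospart le_max lexx. Qed.

Lemma ppP u : (0 <= u /\ pospart u = u) \/ (u <= 0 /\ pospart u = 0).
Proof.
rewrite /pospart; have [u0|u0] := leP 0 u; [left|right] => //.
by split => //; exact: ltW.
Qed.

(** The squared positive part is C^{1,1} but not C^2. Both the mollifier and the functional of the
    maximum principle are built from it. *)
Lemma pp2_quad u h : `|pospart (u + h) ^+ 2 - pospart u ^+ 2 - 2 * pospart u * h| <= h ^+ 2.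
Proof. by rewrite ler_norml; have [[? ->]|[? ->]] := ppP u; have [[? ->]|[? ->]] := ppP (u + h); apply/andP; split; nra. Qed.

Lemma pospart_lip u h : `|pospart (u + h) - pospart u| <= `|h|.
Proof.
have : - `|h| <= h <= `|h| by rewrite -ler_norml.
by move=> /andP[? ?]; rewrite ler_norml; have [[? ->]|[? ->]] := ppP u; have [[? ->]|[? ->]] := ppP (u + h); apply/andP; split; lra.
Qed.

Lemma pospart_cont : continuous pospart.
Proof. by apply: (@lip_continuous _ _ 1) => x h; rewrite mul1r; exact: pospart_lip. Qed.

Lemma meas_pospart d (T : measurableType d) (g : T -> R) : measurable_fun setT g ->
  measurable_fun setT (fun x : T => pospart (g x)).
Proof. by move=> mg; apply: (measurableT_comp (continuous_meas pospart_cont)). Qed.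

(* The quadratic B-spline of mass one with knots [- 3 e, - e, e, 3 e], a third
   difference of [pospart z ^+ 2]; it is C^{1,1} and piecewise explicit. *)
Definition rho e z := (pospart (z + 3 * e) ^+ 2 - 3 * pospart (z + e) ^+ 2 + 3 * pospart (z - e) ^+ 2
  - pospart (z - 3 * e) ^+ 2) / (16 * e ^+ 3).
Definition drho e z := (pospart (z + 3 * e) - 3 * pospart (z + e) + 3 * pospart (z - e)
  - pospart (z - 3 * e)) / (8 * e ^+ 3).

(** To the left all positive parts vanish; to the right each is an affine function, and a third
    difference annihilates quadratic polynomials. *)
Lemma rho_supp e z : 0 < e -> z \notin `[- (3 * e), 3 * e] -> rho e z = 0 /\ drho e z = 0.
Proof.
move=> e0; rewrite in_itv/= negb_and -!ltNge => H; rewrite /rho /drho.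
suff [-> ->] : pospart (z + 3 * e) ^+ 2 - 3 * pospart (z + e) ^+ 2 + 3 * pospart (z - e) ^+ 2
    - pospart (z - 3 * e) ^+ 2 = 0 /\ pospart (z + 3 * e) - 3 * pospart (z + e) + 3 * pospart (z - e)
    - pospart (z - 3 * e) = 0 by rewrite !mul0r.
case/orP: H => H.
  by have [[? ->]|[? ->]] := ppP (z + 3 * e); have [[? ->]|[? ->]] := ppP (z + e);
   have [[? ->]|[? ->]] := ppP (z - e); have [[? ->]|[? ->]] := ppP (z - 3 * e); split; nra.
have [[? ->]|[? ->]] := ppP (z + 3 * e); have [[? ->]|[? ->]] := ppP (z + e);
   have [[? ->]|[? ->]] := ppP (z - e); have [[? ->]|[? ->]] := ppP (z - 3 * e);
  solve [split; ring | exfalso; lra].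
Qed.

Lemma rho_ge0 e z : 0 < e -> 0 <= rho e z.
Proof.
move=> e0; rewrite /rho divr_ge0 ?mulr_ge0 ?exprn_ge0 ?(ltW e0)//.
by have [[? ->]|[? ->]] := ppP (z + 3 * e); have [[? ->]|[? ->]] := ppP (z + e);
   have [[? ->]|[? ->]] := ppP (z - e); have [[? ->]|[? ->]] := ppP (z - 3 * e); nra.
Qed.

Lemma rho_le e z : 0 < e -> `|rho e z| <= e^-1.
Proof.
move=> e0; rewrite ger0_norm ?rho_ge0// /rho ler_pdivrMr ?mulr_gt0 ?exprn_gt0//.
have -> : e^-1 * (16 * e ^+ 3) = 16 * e ^+ 2 by field; rewrite gt_eqF.
by have [[? ->]|[? ->]] := ppP (z + 3 * e); have [[? ->]|[? ->]] := ppP (z + e);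
   have [[? ->]|[? ->]] := ppP (z - e); have [[? ->]|[? ->]] := ppP (z - 3 * e); nra.
Qed.

Lemma drho_le e z : 0 < e -> `|drho e z| <= e^-1 ^+ 2.
Proof.
move=> e0; rewrite /drho normrM normfV [`|8 * _|]ger0_norm ?mulr_ge0 ?exprn_ge0 ?(ltW e0)//.
rewrite ler_pdivrMr ?mulr_gt0 ?exprn_gt0//.
have -> : e^-1 ^+ 2 * (8 * e ^+ 3) = 8 * e by field; rewrite gt_eqF.
rewrite ler_norml.
by have [[? ->]|[? ->]] := ppP (z + 3 * e); have [[? ->]|[? ->]] := ppP (z + e);
   have [[? ->]|[? ->]] := ppP (z - e); have [[? ->]|[? ->]] := ppP (z - 3 * e); apply/andP; split; lra.
Qed.

(** [pp2_quad] at each knot, with weights 1 + 3 + 3 + 1 = 8 against the 16 in the denominator. *)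
Lemma rho_quad e z h : 0 < e -> `|rho e (z + h) - rho e z - drho e z * h| <= (e^-1) ^+ 3 * h ^+ 2.
Proof.
move=> e0; rewrite /rho /drho.
have d : 0 < 16 * e ^+ 3 by rewrite mulr_gt0 ?exprn_gt0.
set X := (X in `|X| <= _).
have -> : X = (
  (pospart (z + 3 * e + h) ^+ 2 - pospart (z + 3 * e) ^+ 2 - 2 * pospart (z + 3 * e) * h)
  - 3 * (pospart (z + e + h) ^+ 2 - pospart (z + e) ^+ 2 - 2 * pospart (z + e) * h)
  + 3 * (pospart (z - e + h) ^+ 2 - pospart (z - e) ^+ 2 - 2 * pospart (z - e) * h)
  - (pospart (z - 3 * e + h) ^+ 2 - pospart (z - 3 * e) ^+ 2 - 2 * pospart (z - 3 * e) * h)) / (16 * e ^+ 3).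
  rewrite {}/X !(addrAC z _ h); field; rewrite gt_eqF//.
rewrite normrM normfV [`|16 * _|]gtr0_norm// ler_pdivrMr//.
have -> : e^-1 ^+ 3 * h ^+ 2 * (16 * e ^+ 3) = 16 * h ^+ 2 by field; rewrite gt_eqF.
have Q u : - h ^+ 2 <= pospart (u + h) ^+ 2 - pospart u ^+ 2 - 2 * pospart u * h <= h ^+ 2.
  by rewrite -ler_norml pp2_quad.
have /andP[? ?] := Q (z + 3 * e); have /andP[? ?] := Q (z + e).
have /andP[? ?] := Q (z - e); have /andP[? ?] := Q (z - 3 * e).
rewrite ler_norml.
have ? := sqr_ge0 h; apply/andP; split; lra.
Qed.

Lemma meas_rho e : meas (rho e).
Proof.
rewrite /rho /meas; apply: measurable_funM; last exact: measurable_cst.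
by repeat (first [apply: meas_pospart | progress mtac]).
Qed.

Lemma meas_drho e : meas (drho e).
Proof.
rewrite /drho /meas; apply: measurable_funM; last exact: measurable_cst.
by repeat (first [apply: meas_pospart | progress mtac]).
Qed.

Lemma rho_c11 e : 0 < e -> exists C, c11 (rho e) (drho e) C.
Proof.
move=> e0; exists (e^-1 + e^-1 ^+ 2 + e^-1 ^+ 3).
have i0 : 0 <= e^-1 by rewrite invr_ge0 ltW.
split; [split; first exact: meas_rho|split; first exact: meas_drho|] => x.
- by apply: le_trans (rho_le x e0) _; rewrite -addrA lerDl addr_ge0 ?exprn_ge0.
- by apply: le_trans (drho_le x e0) _; rewrite addrAC lerDr addr_ge0 ?exprn_ge0.
- by move=> h; apply: le_trans (rho_quad x h e0) _; rewrite ler_wpM2r ?sqr_ge0// lerDr addr_ge0 ?exprn_ge0.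
Qed.

(** An antiderivative of [rho e], rising from 0 to 1: each summand is a cubed positive part. It
    yields the mass of [rho e] and later serves as a cut-off in time. *)
Definition smooth_step e z := ((z + 3 * e) * pospart (z + 3 * e) ^+ 2 - 3 * ((z + e) * pospart (z + e) ^+ 2)
  + 3 * ((z - e) * pospart (z - e) ^+ 2) - (z - 3 * e) * pospart (z - 3 * e) ^+ 2) / (48 * e ^+ 3).

Lemma is_derive_smooth_step e x : 0 < e -> is_derive x 1 (smooth_step e) (rho e x).
Proof.
move=> e0.
have dpp (u c : R) : is_derive u 1 (fun z => pospart (z + c) ^+ 2) (2 * pospart (u + c)).
  apply: (@quad_is_derive _ _ _ _ 1) => h _.
  by have := pp2_quad (u + c) h; rewrite [u + c + h]addrAC mul1r.
have d3 (u c : R) : is_derive u 1 (fun z => (z + c) * pospart (z + c) ^+ 2) (3 * pospart (u + c) ^+ 2).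
  have -> : 3 * pospart (u + c) ^+ 2 = (u + c) *: (2 * pospart (u + c)) + pospart (u + c) ^+ 2 *: (1 + 0).
    rewrite /GRing.scale/=; have [[? ->]|[? ->]] := ppP (u + c); ring.
  exact: is_deriveM.
rewrite /smooth_step /rho.
have -> : (pospart (x + 3 * e) ^+ 2 - 3 * pospart (x + e) ^+ 2 + 3 * pospart (x - e) ^+ 2
  - pospart (x - 3 * e) ^+ 2) / (16 * e ^+ 3) = (48 * e ^+ 3)^-1 *: (3 * pospart (x + 3 * e) ^+ 2 - 3 *: (3 * pospart (x + e) ^+ 2)
   + 3 *: (3 * pospart (x - e) ^+ 2) - 3 * pospart (x - 3 * e) ^+ 2).
  by rewrite /GRing.scale/=; field; rewrite gt_eqF.
under [X in is_derive _ _ X]eq_fun do rewrite mulrC.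
by apply: is_deriveZ.
Qed.

Lemma smooth_step_lo e z : 0 < e -> z <= - (3 * e) -> smooth_step e z = 0.
Proof.
move=> e0 z0; rewrite /smooth_step.
have -> : pospart (z + 3 * e) = 0 by rewrite /pospart max_l; lra.
have -> : pospart (z + e) = 0 by rewrite /pospart max_l; lra.
have -> : pospart (z - e) = 0 by rewrite /pospart max_l; lra.
have -> : pospart (z - 3 * e) = 0 by rewrite /pospart max_l; lra.
by rewrite expr0n /= !mulr0 !subr0 addr0 mul0r.
Qed.

Lemma smooth_step_hi e z : 0 < e -> 3 * e <= z -> smooth_step e z = 1.
Proof.
move=> e0 z0; rewrite /smooth_step.
have -> : pospart (z + 3 * e) = z + 3 * e by rewrite /pospart max_r; lra.
have -> : pospart (z + e) = z + e by rewrite /pospart max_r; lra.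
have -> : pospart (z - e) = z - e by rewrite /pospart max_r; lra.
have -> : pospart (z - 3 * e) = z - 3 * e by rewrite /pospart max_r; lra.
by field; rewrite gt_eqF.
Qed.

Lemma I_rho e : 0 < e -> I (rho e) = 1.
Proof.
move=> e0; rewrite (I_ext0 (fun x H => (rho_supp e0 H).1)).
have e3 : - (3 * e) <= 3 * e by lra.
have [C cr] := rho_c11 e0.
by rewrite (FTCab e3 (fun x => is_derive_smooth_step x e0) (c11_cont cr)) smooth_step_hi// smooth_step_lo// subr0.
Qed.

End spline_mollifier.

(** * Moments of the mollifier and regularity of mollified functions *)

Section mollifier_moments.
Variable R : realType.
Implicit Types (f g k df dg dk : R -> R) (a b x y z c e : R).
Notation I := (@integralR R).

Lemma ge0_nle f : (forall x, 0 <= f x) -> integ f -> nle f (I f).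
Proof. by move=> f0 /integ_nle; under [X in nle _ X]eqI do rewrite ger0_norm//. Qed.

Lemma nle_rho e : 0 < e -> nle (rho e) 1.
Proof.
move=> e0; rewrite -(I_rho e0); apply: ge0_nle => [x|]; first exact: rho_ge0.
have e3 : - (3 * e) <= 3 * e by lra.
apply: nle_integ (nle_supp e3 (meas_rho e) (fun x => rho_le x e0) (fun x H => (rho_supp e0 H).1)).
Qed.

Lemma nle_suppM k e B n : 0 < e -> meas k -> (forall x, `|k x| <= B) ->
  (forall x, x \notin `[- (3 * e), 3 * e] -> k x = 0) ->
  nle (fun z => k z * z ^+ n) (6 * e * (B * (3 * e) ^+ n)).
Proof.
move=> e0 mk kB k0; have e3 : - (3 * e) <= 3 * e by lra.
have -> : 6 * e = 3 * e - - (3 * e) by ring.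
apply: nle_supp => //.
- by rewrite /meas in mk *; mtac.
- move=> x; have [xin|xin] := boolP (x \in `[- (3 * e), 3 * e]).
    rewrite normrM ler_pM// normrX; apply: lerXn2r; rewrite ?nnegrE//; first by lra.
    by move: xin; rewrite in_itv/= -ler_norml.
  rewrite k0// mul0r normr0 mulr_ge0//; first exact: le_trans (kB 0).
  by rewrite exprn_ge0//; lra.
- by move=> x xin; rewrite k0// mul0r.
Qed.

Lemma nle_rho1 e : 0 < e -> nle (fun z => rho e z * z) (18 * e).
Proof.
move=> e0; have := nle_suppM 1 e0 (meas_rho e) (fun x => rho_le x e0) (fun x H => (rho_supp e0 H).1).
have -> : 6 * e * (e^-1 * (3 * e) ^+ 1) = 18 * e by field; rewrite gt_eqF.
by under eq_fun do rewrite expr1.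
Qed.

Lemma nle_drho e : 0 < e -> nle (drho e) (6 * e^-1).
Proof.
move=> e0; have := nle_suppM 0 e0 (meas_drho e) (fun x => drho_le x e0) (fun x H => (rho_supp e0 H).2).
have -> : 6 * e * (e^-1 ^+ 2 * (3 * e) ^+ 0) = 6 * e^-1 by field; rewrite gt_eqF.
by under eq_fun do rewrite expr0 mulr1.
Qed.

(** The bound is independent of e: by this scale invariance, differentiating a mollified function of
    bounded variation costs only its variation. *)
Lemma nle_drho1 e : 0 < e -> nle (fun z => drho e z * z) 18.
Proof.
move=> e0; have := nle_suppM 1 e0 (meas_drho e) (fun x => drho_le x e0) (fun x H => (rho_supp e0 H).2).
have -> : 6 * e * (e^-1 ^+ 2 * (3 * e) ^+ 1) = 18 by field; rewrite gt_eqF.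
by under eq_fun do rewrite expr1.
Qed.

Lemma nle_drho2 e : 0 < e -> nle (fun z => drho e z * z ^+ 2) (54 * e).
Proof.
move=> e0; have := nle_suppM 2 e0 (meas_drho e) (fun x => drho_le x e0) (fun x H => (rho_supp e0 H).2).
have -> // : 6 * e * (e^-1 ^+ 2 * (3 * e) ^+ 2) = 54 * e by field; rewrite gt_eqF.
Qed.

Lemma I_drho e : 0 < e -> I (drho e) = 0.
Proof.
move=> e0; have [C cr] := rho_c11 e0.
(* A slightly larger interval is used so that its endpoints lie outside the support, where
   [rho_supp] gives the value 0. *)
have out x : x \notin `[- (4 * e), 4 * e] -> x \notin `[- (3 * e), 3 * e].
  by apply: contra; rewrite !in_itv/= => /andP[? ?]; apply/andP; split; lra.
rewrite (I_ext0 (fun x H => (rho_supp e0 (out x H)).2)).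
have e4 : - (4 * e) <= 4 * e by lra.
rewrite (FTCab e4 (fun x => c11_derive x cr) (c11_contd cr)).
rewrite !(rho_supp e0 _).1 ?subrr// in_itv/= negb_and -!ltNge; apply/orP;
  solve [right; lra | left; lra].
Qed.

(** The increment in x is moved onto the kernel by a substitution, whence the minus sign in the
    derivative. For |h| <= 1 the Taylor remainder of the kernel lives on [[- (r + 1), r + 1]]; for
    larger h sup bounds suffice. The constant depends on [f] only through B, hence is uniform in
    time in the applications. *)
Lemma c11_kernel k dk B C r : 0 <= r -> 0 <= B -> c11 k dk C ->
  (forall x, x \notin `[- r, r] -> k x = 0 /\ dk x = 0) ->
  exists D, forall f, bm f B -> c11 (conv k f) (fun x => - conv dk f x) D.
Proof.
move=> r0 B0 ck k0; have C0 := c11_ge0 ck; have [[mk kC] [mdk dkC] H] := ck.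
have rr : - r <= r by lra.
have nk : nle k ((r - - r) * C) by apply: nle_supp => // x xr; case: (k0 x xr).
have ndk : nle dk ((r - - r) * C) by apply: nle_supp => // x xr; case: (k0 x xr).
pose E := B * ((r - - r) * C); pose F := B * (((r + 1) - - (r + 1)) * C).
have E0 : 0 <= E by rewrite /E !mulr_ge0//; lra.
have F0 : 0 <= F by rewrite /F !mulr_ge0//; lra.
exists (3 * E + F) => f bf; split.
- have [m bb] := bm_conv nk bf; split => // x; apply: le_trans (bb x) _; rewrite -/E; lra.
- have [m bb] := bm_conv ndk bf; split=> [|x]; first by rewrite /meas in m *; mtac.
  by rewrite normrN; apply: le_trans (bb x) _; rewrite -/E; lra.
move=> x h; have [h1|h1] := leP `|h| 1; last first.
  have h2 : `|h| <= h ^+ 2 by rewrite -[h ^+ 2]real_normK ?num_real// expr2 ler_peMl// ltW.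
  have := conv_bound (x + h) nk bf; have := conv_bound x nk bf; have := conv_bound x ndk bf.
  rewrite -/E => e1 e2 e3.
  apply: le_trans (ler_normB _ _) _; apply: le_trans (lerD (ler_normB _ _) (lexx _)) _.
  rewrite mulNr normrN normrM.
  have : `|conv dk f x| * `|h| <= E * h ^+ 2 by apply: ler_pM.
  have : E * 1 <= E * h ^+ 2 by rewrite ler_wpM2l// (le_trans _ h2)// ltW.
  have : 0 <= F * h ^+ 2 by rewrite mulr_ge0// sqr_ge0.
  by rewrite mulrDl -mulrA mulr1 => ? ? ?; lra.
have shiftk : conv k f (x + h) = I (fun z => k (z - h) * f (x + z)).
  rewrite -[RHS](I_shift h); first by apply: eqI => z; rewrite addrK [z + h]addrC addrA.
  have := meas_shift (- h) mk; have := meas_shiftl x bf.1; rewrite /meas => ? ?; mtac.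
have ish : integ (fun z => k (z - h) * f (x + z)).
  have := integ_shift (- h) (conv_integ (x + h) nk bf).
  by apply: eq_integrable => // z _ /=; rewrite -addrA [h + _]addrC subrK.
have ik := conv_integ x nk bf; have idk := conv_integ x ndk bf.
have -> : conv k f (x + h) - conv k f x - - conv dk f x * h =
   I (fun z => f (x + z) * (k (z - h) - k z - dk z * (- h))).
  rewrite shiftk /conv mulNr opprK mulrC -IZ// -IB// -ID//; last 2 first.
  - exact: integB.
  - exact: integZ.
  by apply: eqI => z; ring.
apply: (@le_trans _ _ (B * ((r + 1 - - (r + 1)) * (C * h ^+ 2)))); last first.
  have -> : B * ((r + 1 - - (r + 1)) * (C * h ^+ 2)) = F * h ^+ 2 by rewrite /F; ring.
  by rewrite ler_wpM2r ?sqr_ge0// lerDr mulr_ge0.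
apply: nle_normI; apply: nleM; [exact: meas_shiftl bf.1|by move=> z; exact: bf.2|].
apply: nle_supp.
- lra.
- have := meas_shift (- h) mk; move: mk mdk; rewrite /meas => ? ? ?; mtac.
- by move=> z; rewrite -[h ^+ 2]sqrrN.
- move=> z; rewrite in_itv/= negb_and -!ltNge => zr.
  have /k0[-> ->] : z \notin `[- r, r].
    by rewrite in_itv/= negb_and -!ltNge; apply/orP; case/orP: zr => ?; [left|right]; lra.
  have /k0[-> _] : z - h \notin `[- r, r].
    move: h1; rewrite ler_norml => /andP[? ?].
    by rewrite in_itv/= negb_and -!ltNge; apply/orP; case/orP: zr => ?; [left|right]; lra.
  by rewrite mul0r !subr0.
Qed.

Lemma c11_moll_unif e B : 0 < e -> 0 <= B ->
  exists D, forall f, bm f B -> c11 (conv (rho e) f) (fun x => - conv (drho e) f x) D.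
Proof.
move=> e0 B0; have [C cr] := rho_c11 e0.
apply: (@c11_kernel _ _ _ _ (3 * e) _ B0 cr); first by lra.
by move=> x; exact: rho_supp.
Qed.

Lemma c11_moll e f B : 0 < e -> bm f B ->
  exists D, c11 (conv (rho e) f) (fun x => - conv (drho e) f x) D.
Proof.
move=> e0 bf; have B0 : 0 <= B by apply: le_trans (bf.2 0).
by have [D H] := c11_moll_unif e0 B0; exists D; exact: H.
Qed.

End mollifier_moments.

(** * The exponential kernel *)

Section exponential_kernel.
Variable R : realType.
Implicit Types (f g k df dg dk : R -> R) (a b x y z c e : R).
Notation mu := (@lebesgue_measure R).
Notation I := (@integralR R).
Notation K := (@exponential_pdf R).

Lemma KE b z : K b z = b * expR (- b * z) * \1_`[0, +oo[%classic z.
Proof. by rewrite /exponential_pdf patchE indicE; case: ifP => _; rewrite ?mulr1 ?mulr0. Qed.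

Lemma K_ge0 b z : 0 < b -> 0 <= K b z.
Proof. by move=> b0; rewrite exponential_pdf_ge0// ltW. Qed.

Lemma integ_K b : 0 < b -> integ (K b).
Proof. by move=> b0; have := integrable_exponential_pdf b0. Qed.

Lemma I_K b : 0 < b -> I (K b) = 1.
Proof. by move=> b0; rewrite /I /Rintegral integral_exponential_pdf. Qed.

Lemma nle_K b : 0 < b -> nle (K b) 1.
Proof. by move=> b0; rewrite -(I_K b0); apply: ge0_nle (integ_K b0) => x; exact: K_ge0. Qed.

Lemma cvg_expRNn b : 0 < b -> expR (- b * n%:R) @[n --> \oo] --> (0 : R).
Proof.
move=> b0; under eq_fun do rewrite expRM_natr.
by apply: cvg_expr; rewrite ger0_norm ?expR_ge0// expR_lt1 oppr_lt0.
Qed.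

Lemma is_derive_expRM a x : is_derive x 1 (fun x => expR (a * x)) (a * expR (a * x)).
Proof.
have h : is_derive x 1 (fun x => a * x) a.
  by apply: (@quad_is_derive _ _ _ _ 0) => h _; rewrite (_ : _ - _ = 0) ?normr0 ?mul0r//; ring.
rewrite [X in is_derive _ _ _ X]mulrC.
exact: (@is_derive1_comp _ expR (fun x => a * x) x _ _ (is_derive_expR _) h).
Qed.

(** Averaging against [K b] inverts 1 - b^-1 d/dx, because the integrand is the exact derivative of
    - exp(- b z) g(x + z) on the half line. All closed formulas for W_x rest on this identity. *)
Lemma conv_K_resolvent b g dg C x : 0 < b -> c11 g dg C ->
  conv (K b) (fun y => g y - b^-1 * dg y) x = g x.
Proof.
move=> b0 cg.
pose F z := - (expR (- b * z) * g (x + z)).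
pose dF z := expR (- b * z) * (b * g (x + z) - dg (x + z)).
have dgs z : is_derive z 1 (fun z => g (x + z)) (dg (x + z)).
  have [_ _ H] := cg; apply: (@quad_is_derive _ _ _ _ C) => h _; rewrite addrA; exact: H.
have derF z : is_derive z 1 F (dF z).
  have -> : dF z = - (expR (- b * z) *: dg (x + z) + g (x + z) *: (- b * expR (- b * z))).
    by rewrite /dF /GRing.scale/=; ring.
  have := is_derive_expRM (- b) z => ?.
  by apply: is_deriveN; exact: is_deriveM.
have cgs : continuous (fun z => g (x + z)) by move=> z; exact: is_derive_continuous (dgs z).
have cdg : continuous (fun z => dg (x + z)).
  by apply: (@lip_continuous _ _ (2 * C)) => z h; rewrite addrA; exact: c11_lipd cg.
have cE : continuous (fun z => expR (- b * z)).
  by move=> z; exact: is_derive_continuous (is_derive_expRM (- b) z).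
have cF : continuous dF.
  move=> z; apply: cvgM; first exact: cE.
  by apply: cvgB; [apply: cvgM; [exact: cvg_cst|exact: cgs]|exact: cdg].
have eI z : dF z * \1_`[0, +oo[%classic z = K b z * (g (x + z) - b^-1 * dg (x + z)).
  by rewrite KE /dF; field; rewrite gt_eqF.
have [bg bd _] := cg.
have iF : integ (fun z => dF z * \1_`[0, +oo[%classic z).
  under eq_fun do rewrite eI.
  by apply: (conv_integ x (nle_K b0) (f := fun y => g y - b^-1 * dg y) (bmB bg (bmM (bm_cst b^-1) bd))).
have cC : C * expR (- b * n%:R) @[n --> \oo] --> (0 : R).
  by rewrite -[X in _ --> X](mulr0 C); apply: cvgM; [exact: cvg_cst|exact: cvg_expRNn].
have c0 : F n%:R @[n --> \oo] --> (0 : R).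
  apply: (@squeeze_cvgr _ _ _ _ (fun n => - (C * expR (- b * n%:R))) (fun n => C * expR (- b * n%:R))).
  - near=> n; rewrite -ler_norml /F normrN normrM mulrC.
    by rewrite [`|expR _|]ger0_norm ?expR_ge0// ler_wpM2r ?expR_ge0//; exact: bg.2.
  - by rewrite -[X in _ --> X]oppr0; apply: cvgN.
  - exact: cC.
have := I_derive_halfline derF cF iF c0.
rewrite /F mulr0 expR0 mul1r addr0 opprK => <-.
by apply: eqI => z; rewrite eI.
Unshelve. all: by end_near. Qed.

(** The tilted kernel is b / (b - a) times the exponential density of rate b - a. *)
Lemma nle_K_tilt a b : a < b -> 0 < b -> nle (fun z => K b z * expR (a * z)) (b / (b - a)).
Proof.
move=> ab b0; have ba : 0 < b - a by rewrite subr_gt0.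
have := nleZ (b / (b - a)) (nle_K ba).
rewrite mulr1 ger0_norm ?divr_ge0 ?ltW//.
congr (nle _ _); apply/funext => z; rewrite !KE.
have -> : expR (- (b - a) * z) = expR (- b * z) * expR (a * z) by rewrite -expRD; congr expR; ring.
by field; rewrite gt_eqF.
Qed.

Lemma nonlocalE eta (V : R -> R) (q : R -> R -> R) B t x : 0 < eta ->
  bm (fun y => V (q t y)) B ->
  nonlocal eta V q t x = conv (K eta^-1) (fun y => V (q t y)) x.
Proof.
move=> e0 bVq; have mVq := bVq.1.
have ei0 : 0 < eta^-1 by rewrite invr_gt0.
pose g := (fun y => expR ((x - y) / eta) * V (q t y)) \_ `[x, +oo[.
have iK := conv_integ x (nle_K ei0) bVq.
have gE y : K eta^-1 (y - x) * V (q t (x + (y - x))) = eta^-1 * g y.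
  rewrite KE /g patchE indicE.
  have -> : ((y - x) \in `[0, +oo[%classic) = (y \in `[x, +oo[%classic).
    by apply/idP/idP; rewrite !inE/= !in_itv/= !andbT subr_ge0.
  case: ifP => _; rewrite ?mulr0 ?mul0r// mulr1 [x + _]addrC subrK -mulrA.
  by congr (_ * (expR _ * _)); ring.
have ig : integ g.
  have := integZ eta (integ_shift (- x) iK); apply: eq_integrable => // y _ /=.
  by rewrite gE mulrA mulfV ?mul1r// gt_eqF.
rewrite /conv -(I_shift (- x)); last exact: integ_meas iK.
rewrite /nonlocal Rintegral_mkcond -/g -[RHS]/(I (fun y => K eta^-1 (y - x) * V (q t (x + (y - x))))).
by under [RHS]eqI do rewrite gE; rewrite IZ.
Qed.

(* An integrable weight with [|psi'| <= a psi], so that bounded functions can be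
   integrated over the line at a cost that vanishes as [a] tends to 0. *)
Definition psi a x : R := (expR (a * x) + expR (- a * x))^-1.
Definition dpsi a x : R := - a * (expR (a * x) - expR (- a * x)) * psi a x ^+ 2.

Lemma psi_den_gt0 a x : 0 < expR (a * x) + expR (- a * x) :> R.
Proof. by rewrite addr_gt0 ?expR_gt0. Qed.

Lemma psi_gt0 a x : 0 < psi a x.
Proof. by rewrite invr_gt0 psi_den_gt0. Qed.

Lemma is_derive_psi a x : is_derive x 1 (psi a) (dpsi a x).
Proof.
have h1 := is_derive_expRM a x; have h2 := is_derive_expRM (- a) x.
have := @is_deriveV _ (fun x => expR (a * x) + expR (- a * x)) x _ 1 (lt0r_neq0 (psi_den_gt0 a x)) (is_deriveD h1 h2).
congr (is_derive _ _ _ _).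
rewrite /dpsi /psi /GRing.scale/=; have := psi_den_gt0 a x => h; field.
by rewrite gt_eqF.
Qed.

(** [psi a] is 1 / (2 cosh (a x)), so its logarithmic derivative is - a tanh (a x). *)
Lemma dpsi_le a x : 0 <= a -> `|dpsi a x| <= a * psi a x.
Proof.
move=> a0; rewrite /dpsi expr2 mulrA normrM [`|psi _ _|]gtr0_norm ?psi_gt0//.
rewrite ler_wpM2r ?(ltW (psi_gt0 _ _))// -mulrA normrM normrN (ger0_norm a0).
rewrite ler_piMr// normrM [`|psi _ _|]gtr0_norm ?psi_gt0// ler_pdivrMr ?psi_den_gt0// mul1r.
have := expR_gt0 (a * x); have := expR_gt0 (- a * x).
by rewrite ler_norml => ? ?; apply/andP; split; lra.
Qed.

(** A shift by z enlarges the weight by at most exp(a z), a factor that the exponential kernel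
    absorbs as long as a < b. *)
Lemma psi_shift a x z : 0 <= a -> 0 <= z -> psi a (x - z) <= psi a x * expR (a * z).
Proof.
move=> a0 z0; rewrite /psi -ler_pdivrMr ?expR_gt0// -invfM lef_pV2 ?posrE ?psi_den_gt0//; last first.
  by rewrite mulr_gt0 ?psi_den_gt0 ?expR_gt0.
rewrite mulrDl -!expRD; apply: lerD; rewrite ler_expR; first lra.
have := mulr_ge0 a0 z0; lra.
Qed.

Lemma psi_cont a : continuous (psi a).
Proof. by move=> x; exact: is_derive_continuous (is_derive_psi a x). Qed.

Lemma dpsi_cont a : continuous (dpsi a).
Proof.
have cE c : continuous (fun z => expR (c * z)).
  by move=> z; exact: is_derive_continuous (is_derive_expRM c z).
move=> x; apply: cvgM; last by apply: cvgM; exact: psi_cont.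
by apply: cvgM; [exact: cvg_cst|apply: cvgB; exact: cE].
Qed.

Lemma psi_le_expN a x : psi a x <= expR (- a * x).
Proof.
rewrite /psi -[leRHS]invrK lef_pV2 ?posrE ?psi_den_gt0 ?invr_gt0 ?expR_gt0//.
by rewrite -expRN mulNr opprK lerDl expR_ge0.
Qed.

Lemma psiN a x : psi a (- x) = psi a x.
Proof. by rewrite /psi !mulrN !mulNr opprK addrC. Qed.

Lemma cvg_psin a : 0 < a -> psi a n%:R @[n --> \oo] --> (0 : R).
Proof.
move=> a0; apply: (@squeeze_cvgr _ _ _ _ (fun=> 0) (fun n => expR (- a * n%:R))).
- by near=> n; rewrite psi_le_expN ltW// psi_gt0.
- exact: cvg_cst.
- exact: cvg_expRNn.
Unshelve. all: by end_near. Qed.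

Lemma integ_psi a : 0 < a -> integ (psi a).
Proof.
move=> a0; apply/integrableP; split.
  by apply: measE; apply: continuous_meas; exact: psi_cont.
under eq_integral do rewrite /= gtr0_norm ?psi_gt0//.
(* The weight is even, so it suffices to dominate it by exp(- a x) on the positive half line. *)
rewrite ge0_symfun_integralT//; last 3 first.
- by move=> x; rewrite ltW// psi_gt0.
- exact: psi_cont.
- by move=> x; rewrite /= psiN.
have -> : [set x : R | 0 <= x] = `[0, +oo[%classic.
  by apply/seteqP; split => x /=; rewrite in_itv/= andbT.
apply: lte_mul_pinfty => //.
apply: (@le_lt_trans _ _ (\int[mu]_x `|a^-1 * K a x|%:E)%E); last first.
  by have /integrableP[_] := integZ a^-1 (integ_K a0).
rewrite integral_mkcond; apply: ge0_le_integral => //.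
- by move=> x _; rewrite patchE; case: ifP => // _; rewrite lee_fin ltW// psi_gt0.
- apply/(measurable_restrictT _ _).1 => //.
  by apply: measurable_funTS; apply: measE; apply: continuous_meas; exact: psi_cont.
- exact: measNE (integ_meas (integZ a^-1 (integ_K a0))).
- move=> x _; rewrite patchE KE indicE; case: ifP => _; last by rewrite lee_fin.
  rewrite lee_fin mulr1 mulrA mulVf ?gt_eqF// mul1r ger0_norm ?expR_ge0//.
  exact: psi_le_expN.
Qed.

End exponential_kernel.

(** * Test functions and total variation *)

Section test_functions.
Variable R : realType.
Implicit Types (f g k df dg dk phi : R -> R) (a b x y z c e : R).
Notation I := (@integralR R).

Lemma compact_supp_itv phi r : (forall x, x \notin `[- r, r] -> phi x = 0) ->
  compactly_supported_in setT phi.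
Proof.
move=> H; split => //.
have sub : closure [set x | phi x != 0] `<=` `[- r, r]%classic.
  have /closure_id -> : closed (`[- r, r]%classic : set R) by exact: interval_closed.
  by apply: closureS => x /=; apply: contraNP => /negP xr; rewrite H.
apply: (subclosed_compact _ (@segment_compact _ (- r) r) sub).
exact: closed_closure.
Qed.

Lemma c11_derive1 f df C x : c11 f df C -> derive1 f x = df x.
Proof. by move=> cf; rewrite derive1E; have [] := c11_derive x cf. Qed.

Lemma c11_class f df C : c11 f df C -> of_class_C 1 f.
Proof.
move=> cf; split => [[|//] _ x|]; first by case: (c11_derive x cf).
rewrite /= (_ : derive1 f = df); first exact: c11_contd cf.
by apply/funext => x; exact: c11_derive1 cf.
Qed.

Lemma class_C1_derive phi x : of_class_C 1 phi -> is_derive x 1 phi (derive1 phi x).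
Proof. by case=> /(_ 0%N isT x) d _; split; rewrite ?derive1E. Qed.

Lemma class_C1_cont phi : of_class_C 1 phi -> continuous (derive1 phi).
Proof. by case. Qed.

Lemma test_bounds phi : of_class_C 1 phi -> compactly_supported_in setT phi ->
  exists r B : R, [/\ 0 < r, (forall x, x \notin `[- r, r] -> phi x = 0 /\ derive1 phi x = 0),
    (forall x, `|phi x| <= B) & (forall x, `|derive1 phi x| <= B)].
Proof.
move=> cphi [csupp _].
have [M [Mr HM]] := compact_bounded csupp.
pose r := `|M| + 1.
have r0 : 0 < r by rewrite ltr_wpDl.
have Mlt : M < r by rewrite /r (le_lt_trans (ler_norm _))// ltrDl.
have phi0 x : x \notin `[- r, r] -> phi x = 0.
  move=> xr; apply/eqP; apply: contraNT xr => px.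
  rewrite in_itv/= -ler_norml; apply: (HM r Mlt).
  by apply: subset_closure.
(* One unit of room beyond the support makes [phi] vanish on a neighbourhood of x, so its derivative
   vanishes there as well. *)
have phi1 x : x \notin `[- (r + 1), r + 1] -> phi x = 0 /\ derive1 phi x = 0.
  move=> xr.
  have ph h : `|h| <= 1 -> phi (x + h) = 0.
    move=> h1; apply: phi0; apply: contra xr; rewrite !in_itv/= -!ler_norml => xh.
    have -> : x = x + h - h by ring.
    by apply: le_trans (ler_normB _ _) _; exact: lerD.
  have p0 : phi x = 0 by rewrite -[x]addr0 ph// normr0.
  split => //; rewrite derive1E.
  suff [_ ->] : is_derive x 1 phi 0 by [].
  apply: (@quad_is_derive _ _ _ _ 0) => h h1.
  by rewrite ph// p0 !mul0r !subr0 normr0.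
have bd f : continuous f -> (forall x, x \notin `[- (r + 1), r + 1] -> f x = 0) ->
    exists B, forall x, `|f x| <= B.
  move=> cf f0.
  have r1 : - (r + 1) <= r + 1 by lra.
  have [c _ Hc] := @EVT_max _ (fun x => `|f x|) _ _ r1 (continuous_subspaceT (fun x => cvg_norm (cf x))).
  exists `|f c| => x; have [/Hc//|/f0 ->] := boolP (x \in `[- (r + 1), r + 1]).
  by rewrite normr0.
have [B1 H1] := bd phi (fun x => is_derive_continuous (class_C1_derive x cphi)) (fun x H => (phi1 x H).1).
have [B2 H2] := bd _ (class_C1_cont cphi) (fun x H => (phi1 x H).2).
exists (r + 1), (Num.max B1 B2); split => //; first by rewrite addr_gt0.
- by move=> x; rewrite le_max H1.
- by move=> x; rewrite le_max H2 orbT.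
Qed.

Lemma drho_odd e z : drho e (- z) = - drho e z.
Proof.
(* The linear terms produced by this rule cancel in the third difference. *)
have ppN u : pospart (- u) = pospart u - u.
  by have [[? ->]|[? ->]] := ppP u; have [[? ->]|[? ->]] := ppP (- u); lra.
rewrite /drho.
have -> : - z + 3 * e = - (z - 3 * e) by ring.
have -> : - z + e = - (z - e) by ring.
have -> : - z - e = - (z + e) by ring.
have -> : - z - 3 * e = - (z + 3 * e) by ring.
by rewrite !ppN; ring.
Qed.

(** Correlation with an odd kernel is antisymmetric: exchange the integrals, shift x by z, and
    reflect z. *)
Lemma I_drho_adjoint e f g B D C : 0 < e -> bm f B -> bm g D -> nle g C ->
  I (fun x => f x * conv (drho e) g x) = - I (fun x => g x * conv (drho e) f x).
Proof.
move=> e0 bf bg ng; have nd := nle_drho e0.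
have [mf fB] := bf; have [mg gD] := bg; have mk := meas_drho e.
have B0 : 0 <= B by apply: le_trans (fB 0).
have mG : measurable_fun setT (fun p : R * R => f p.1 * (drho e p.2 * g (p.1 + p.2))).
  apply: measurable_funM; first by apply: (measurableT_comp mf); mtac.
  apply: measurable_funM; first by apply: (measurableT_comp mk); mtac.
  by apply: (measurableT_comp mg); mtac.
have ngs z : nle (fun x => f x * (drho e z * g (x + z))) (B * (`|drho e z| * C)).
  by apply: nleM => //; apply: nleZ; exact: nle_shift.
transitivity (I (fun x => I (fun z => f x * (drho e z * g (x + z))))).
  by apply: eqI => x; rewrite IZ//; exact: conv_integ nd bg.
have nc : nle (fun z => B * C * drho e z) (B * C * (6 * e^-1)).
  have := nleZ (B * C) nd; rewrite ger0_norm//.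
  by rewrite mulr_ge0// (nle_ge0 ng).
have ncz z : B * (`|drho e z| * C) <= `|B * C * drho e z|.
  by rewrite !normrM (ger0_norm B0) (ger0_norm (nle_ge0 ng)); lra.
rewrite (@I_swap2 _ (fun p => f p.1 * (drho e p.2 * g (p.1 + p.2))) _ _ mG _ _ nc)/=; last 2 first.
- by move=> x; apply: integZ; exact: conv_integ nd bg.
- by move=> z; exact: nleC (ncz z) (ngs z).
transitivity (I (fun z => I (fun x => g x * (drho e z * f (x - z))))).
  apply: eqI => z; rewrite -(I_shift (- z)); last exact: (ngs z).1.
  by apply: eqI => x; rewrite subrK; ring.
have mfm : measurable_fun setT (fun p : R * R => f (p.1 - p.2)).
  by apply: (measurableT_comp mf); mtac.
have idm x : integ (fun z => drho e z * f (x - z)).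
  have mfx : meas (fun z => f (x - z)) by apply: (measurableT_comp mf); mtac.
  have := nleM mfx (fun z => fB (x - z)) nd.
  by move=> /nle_integ; apply: eq_integrable => // z _ /=; rewrite mulrC.
rewrite -(@I_swap2 _ (fun p => g p.1 * (drho e p.2 * f (p.1 - p.2))) _ _ _ _ _ nc)/=; last 3 first.
- apply: measurable_funM; first by apply: (measurableT_comp mg); mtac.
  by apply: measurable_funM => //; apply: (measurableT_comp mk); mtac.
- by move=> x; apply: integZ.
- move=> z; apply: nleC (ncz z) _; have := nle_shift (- z) (ngs z).
  by congr (nle _ _); apply/funext => x; rewrite subrK; ring.
rewrite -mulN1r -IZ; last first.
  have bcf := bm_conv nd bf.
  have := nle_integ (nleM bcf.1 bcf.2 ng).
  by apply: eq_integrable => // z _ /=; rewrite mulrC.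
apply: eqI => x; rewrite IZ// mulN1r -mulrN; congr (_ * _).
rewrite -[LHS](I_opp (f := fun z => drho e z * f (x - z))); last exact: integ_meas (idm x).
rewrite -mulN1r /conv -IZ; last exact: conv_integ nd bf.
by apply: eqI => z; rewrite drho_odd opprK; ring.
Qed.

End test_functions.

(** * Total variation of smooth functions and of mollifications *)

Section total_variation_of_mollification.
Variable R : realType.
Implicit Types (f g k df dg dk phi : R -> R) (a b x y z c e : R).
Notation I := (@integralR R).

Lemma Rabs_sg (u : R) : Num.sg u * u = `|u|.
Proof. by rewrite normrEsg. Qed.

Lemma meas_sg f : meas f -> meas (fun x => Num.sg (f x)).
Proof.
move=> mf.
have -> : (fun x => Num.sg (f x)) = (fun x => \1_`]0, +oo[%classic (f x) - \1_`]-oo, 0[%classic (f x)).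
  apply/funext => x; rewrite !indicE.
  have -> : (f x \in `]0, +oo[%classic) = (0 < f x) by apply/idP/idP; rewrite inE/= in_itv/= andbT.
  have -> : (f x \in `]-oo, 0[%classic) = (f x < 0) by apply/idP/idP; rewrite inE/= in_itv/=.
  by case: sgrP => // fx; rewrite ?ltxx ?subr0 ?sub0r// ?(lt_gtF fx) ?fx /= ?subr0 ?sub0r.
by apply: measurable_funB; apply: measurableT_comp => //; apply: meas_indic.
Qed.

Lemma conv_supp e g N x : 0 < e -> (forall y, y \notin `[- N, N] -> g y = 0) ->
  x \notin `[- (N + 3 * e), N + 3 * e] -> conv (rho e) g x = 0 /\ conv (drho e) g x = 0.
Proof.
move=> e0 g0 xN.
have H z : z \in `[- (3 * e), 3 * e] -> g (x + z) = 0.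
  move=> zin; apply: g0; apply: contra xN; move: zin; rewrite !in_itv/=.
  by move=> /andP[? ?] /andP[? ?]; apply/andP; split; lra.
have I0 : I (fun=> 0) = 0 by rewrite /integralR Rintegral_cst// mul0r.
rewrite -[in X in _ = X /\ _]I0 -[in X in _ /\ _ = X]I0.
by split; apply: eqI => z; have [/H ->|/(rho_supp e0)[r0 d0]] := boolP (z \in `[- (3 * e), 3 * e]); rewrite ?mulr0// ?r0 ?d0 mul0r.
Qed.

Lemma TV_seminormP f M phi : (TV_seminorm f <= M%:E)%E -> of_class_C 1 phi ->
  compactly_supported_in setT phi -> (forall x, `|phi x| <= 1) ->
  I (fun x => f x * derive1 phi x) <= M.
Proof.
move=> tv c1 c2 c3; rewrite -lee_fin; apply: le_trans tv.
by apply: ereal_sup_ubound; exists phi.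
Qed.

(** By duality. The sign of [conv (drho e) f], truncated to [-n, n] and mollified, is an admissible
    test function; antisymmetry of [drho] moves the kernel back to f and leaves the L^1 norm over
    [-n, n]. Fatou removes the truncation. *)
Lemma TV_moll f B M e : 0 < e -> bm f B -> (TV_seminorm f <= M%:E)%E ->
  nle (conv (drho e) f) M.
Proof.
move=> e0 bf tv; have bc := bm_conv (nle_drho e0) bf.
set g := conv (drho e) f; have mg : meas g := bc.1.
have mi (n : nat) : meas (\1_`[- n%:R, n%:R]%classic : R -> R) by exact: meas_indic.
apply: (@fatou_nle _ (fun n x => g x * \1_`[- n%:R, n%:R]%classic x)) => //; last first.
  apply: aeW => x; rewrite -[X in _ --> X]mulr1.
  by apply: cvgM; [exact: cvg_cst|exact: cvg_indic_itvN].
move=> n; pose s x := Num.sg (g x) * \1_`[- n%:R, n%:R]%classic x.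
have s1 x : `|s x| <= 1.
  apply: le_trans (indicM_le (fun x => Num.sg (g x)) _ x) _.
  by rewrite normr_sg; case: (_ != 0); rewrite ?ler01.
have ms : meas s by rewrite /s /meas; apply: measurable_funM => //; exact: meas_sg.
have bs : bm s 1 by [].
have s0 x : x \notin `[- n%:R, n%:R] -> s x = 0.
  by move=> xn; rewrite /s indicE memNset ?mulr0//; apply/negP.
have nn : - n%:R <= n%:R :> R by rewrite ge0_cp.
have ns : nle s ((n%:R - - n%:R) * 1) by exact: nle_supp.
have [D cD] := c11_moll e0 bs.
have := TV_seminormP tv (c11_class cD) (compact_supp_itv (fun x H => (conv_supp e0 s0 H).1)).
have s1' x : `|conv (rho e) s x| <= 1.
  by have := conv_bound x (nle_rho e0) bs; rewrite mulr1.
move=> /(_ s1').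
have -> : I (fun x => f x * derive1 (conv (rho e) s) x) = I (fun x => s x * g x).
  transitivity (I (fun x => -1 * (f x * conv (drho e) s x))).
    by apply: eqI => x; rewrite (c11_derive1 _ cD); ring.
  rewrite IZ; last first.
    exact: nle_integ (nleM bf.1 bf.2 (conv_nle (nle_drho e0) bs ns)).
  by rewrite (I_drho_adjoint e0 bf bs ns) mulN1r opprK.
move=> sM.
have gs x : s x * g x = `|g x * \1_`[- n%:R, n%:R]%classic x|.
  rewrite /s mulrAC Rabs_sg normrM indicE; case: (_ \in _); rewrite ?normr1 ?normr0//.
have isg : integ (fun x => s x * g x).
  by have := nle_integ (nleM bc.1 bc.2 ns); apply: eq_integrable => // x _ /=; rewrite mulrC.
apply: nleC sM _; have := ge0_nle (f := fun x => s x * g x) _ isg.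
have p0 x : 0 <= s x * g x by rewrite gs.
move=> /(_ p0) [_ H]; split; first by rewrite /meas in mg *; exact: measurable_funM.
apply: le_trans H; rewrite le_eqVlt; apply/orP; left; apply/eqP.
by apply: eq_integral => x _; rewrite gs normr_id.
Qed.

(** For y >= 0 the increment is the correlation of the derivative with the indicator of [0, y],
    whose mass is y; negative y follow by a shift. *)
Lemma tvle_deriv g dg C M : c11 g dg C -> nle dg M -> tvle g M.
Proof.
move=> cg nd; have [bg bd _] := cg.
split; first exact: bg.1.
have pos y : 0 <= y -> nle (fun x => g (x + y) - g x) (M * y).
  move=> y0.
  have nb : nle (\1_`[0, y]%classic : R -> R) ((y - 0) * 1).
    apply: nle_supp => // [|x|x xy]; first exact: meas_indic.
      by rewrite indicE; case: (_ \in _); rewrite ?normr1 ?normr0.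
    by rewrite indicE memNset//; apply/negP.
  rewrite mulr1 subr0 in nb.
  have -> : (fun x => g (x + y) - g x) = conv (\1_`[0, y]%classic : R -> R) dg.
    apply/funext => x.
    have dgs z : is_derive z 1 (fun z => g (x + z)) (dg (x + z)).
      have [_ _ H] := cg; apply: (@quad_is_derive _ _ _ _ C) => h _; rewrite addrA; exact: H.
    have cdg : continuous (fun z => dg (x + z)).
      by apply: (@lip_continuous _ _ (2 * C)) => z h; rewrite addrA; exact: c11_lipd cg.
    rewrite -[X in _ - g X](addr0 x) -(FTCab y0 dgs cdg); apply: eqI => z.
    by rewrite mulrC.
  exact: conv_nle nb bd nd.
move=> y; have [y0|y0] := leP 0 y; first by rewrite ger0_norm//; exact: pos.
rewrite ltr0_norm//; have := nleN (nle_shift y (pos (- y) _)).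
rewrite oppr_ge0 ltW// => /(_ isT); congr (nle _ _); apply/funext => x.
by rewrite addrK opprB.
Qed.

(** Difference quotients with step 1 / (n + 1) have L^1 norm at most M and converge to the
    derivative; Fatou concludes. *)
Lemma nle_deriv g dg C M : c11 g dg C -> tvle g M -> nle dg M.
Proof.
move=> cg [_ tv]; have [[mg _] [md _] H] := cg.
have C0 := c11_ge0 cg.
pose h (n : nat) : R := n.+1%:R^-1.
have h0 n : 0 < h n by rewrite invr_gt0.
apply: (@fatou_nle _ (fun n x => (h n)^-1 * (g (x + h n) - g x))) => //.
- move=> n; have := nleZ (h n)^-1 (tv (h n)); congr (nle _ _).
  by rewrite !gtr0_norm ?invr_gt0// mulrCA mulVf ?mulr1// gt_eqF.
- apply: aeW => x; apply/cvgrPdist_le => d d0; near=> n.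
  have -> : dg x - (h n)^-1 * (g (x + h n) - g x) = - ((h n)^-1 * (g (x + h n) - g x - dg x * h n)).
    by field; rewrite gt_eqF.
  rewrite normrN normrM gtr0_norm ?invr_gt0// mulrC ler_pdivrMr//.
  apply: le_trans (H _ _) _; rewrite expr2 mulrA ler_wpM2r ?(ltW (h0 n))//.
  apply: (@le_trans _ _ ((C + 1) * h n)); first by rewrite ler_wpM2r ?(ltW (h0 n))//; lra.
  rewrite mulrC -ler_pdivlMr; last by lra.
  apply: ltW; near: n.
  have dC : 0 < d / (C + 1) by rewrite divr_gt0//; lra.
  exact: (near_infty_natSinv_lt (PosNum dC)).
Unshelve. all: by end_near. Qed.

End total_variation_of_mollification.

(** * Equivalence of the seminorm with the bound on increments *)

Section total_variation_seminorm.
Variable R : realType.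
Implicit Types (f g k df dg dk phi : R -> R) (a b x y z c e : R).
Notation mu := (@lebesgue_measure R).
Notation I := (@integralR R).

Lemma bm_locally_integrable f B : bm f B -> locally_integrable setT f.
Proof.
move=> [mf fB]; split => //; first exact: openT.
move=> A _ cA; have mA : measurable A by exact: compact_measurable.
have B0 : 0 <= B by apply: le_trans (fB 0).
apply: (@le_lt_trans _ _ (\int[mu]_(x in A) (cst B%:E x))%E).
  apply: ge0_le_integral => //.
  - by apply: measurable_funTS; exact: measNE.
  - by move=> x _; rewrite lee_fin.
rewrite integral_cst//; apply: lte_mul_pinfty => //; exact: compact_finite_measure.
Qed.

(** [rho e] is at most 1 / e and lives inside the open ball of radius 4 e, which has measure 8 e;
    this is the origin of the factor 8. *)
Lemma moll_davg e f B x : 0 < e -> bm f B ->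
  ((`|conv (rho e) f x - f x|)%:E <= 8%:E * davg f x (4 * e))%E.
Proof.
move=> e0 bf; have [mf fB] := bf; have e4 : 0 < 4 * e by lra.
have bd := bmB (bm_shift 0 bf) (bm_cst (f x)).
have ik : integ (fun z => rho e z * (f (x + z) - f x)).
  have := conv_integ x (nle_rho e0) bd; apply: eq_integrable => // z _ /=.
  by rewrite addr0.
rewrite (conv_sub x (nle_rho e0) (I_rho e0) bf).
apply: le_trans (I_normE ik) _.
pose H (z : R) := (e^-1 * `|f z - f x| * \1_(ball x (4 * e)) z)%:E.
have mb : measurable (ball x (4 * e)) by exact: measurable_ball.
have mH : measurable_fun setT H.
  apply/measurable_EFinP; have := @meas_indic R _ mb; rewrite /meas in mf * => ?.
  by mtac.
have H0 z : (0 <= H z)%E.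
  by rewrite lee_fin !mulr_ge0// ?invr_ge0 ?ltW// indicE; case: (_ \in _).
apply: (@le_trans _ _ (\int[mu]_z H (x + z)%R)%E).
  apply: ge0_le_integral => //.
  - exact: measNE (integ_meas ik).
  - by apply: (measurableT_comp mH); mtac.
  - move=> z _; rewrite lee_fin normrM.
    have [zin|zout] := boolP (z \in `[- (3 * e), 3 * e]); last first.
      by rewrite (rho_supp e0 zout).1 normr0 mul0r -lee_fin; exact: H0.
    rewrite indicE mem_set ?mulr1; first by rewrite ler_wpM2r// rho_le.
    rewrite /ball/= opprD addrA subrr sub0r normrN ltr_norml.
    by move: zin; rewrite in_itv/= => /andP[? ?]; apply/andP; split; lra.
have -> : (\int[mu]_z H (x + z)%R = \int[mu]_z H z)%E.
  by rewrite -(ge0_integral_shift (f := H) x)//; under eq_integral do rewrite addrC.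
rewrite /davg /iavg (lebesgue_measure_ball x (ltW e4)).
rewrite [in X in (_ <= X)%E]integral_mkcond.
have -> : (\int[mu]_z H z = (e^-1)%:E * \int[mu]_z ((fun y => `|((center (f x) \o f) y)%:E|%E) \_ (ball x (4 * e))) z)%E.
  rewrite -ge0_integralZl ?lee_fin ?invr_ge0 ?(ltW e0)//.
  - apply: eq_integral => z _; rewrite patchE /H indicE /=; case: ifP => _; last by rewrite mulr0 mule0.
    by rewrite mulr1 -EFinM.
  - apply/(measurable_restrictT _ _).1 => //; apply: measurable_funTS.
    by apply: (@measNE _ (fun y => f y - f x)); apply: (measurable_funB mf); mtac.
  - by move=> z _; rewrite patchE; case: ifP.
rewrite inver gt_eqF; last by rewrite pmulrn_lgt0.
rewrite muleA -EFinM; set J := (\int[mu]_ _ _)%E.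
by have -> : 8 * (4 * e *+ 2)^-1 = e^-1 by rewrite -mulr_natr; field; rewrite gt_eqF.
Qed.

(** Convergence holds at every Lebesgue point, since the error is at most 8 times the mean
    oscillation over a shrinking ball. *)
Lemma ae_moll f B : bm f B ->
  {ae mu, forall x, conv (rho n.+1%:R^-1) f x @[n --> \oo] --> f x}.
Proof.
move=> bf; have := lebesgue_differentiation (bm_locally_integrable bf).
apply: (@filterS _ _ (ae_filter_ringOfSetsType mu)) => x /fine_cvgP[fin cv].
apply/cvgrPdist_le => d d0.
have d8 : 0 < d / 8 by rewrite divr_gt0.
have N : \forall r \near (0 : R)^'+, davg f x r \is a fin_num /\ `|0 - fine (davg f x r)| <= d / 8.
  by near=> r; split; near: r => //; move/cvgrPdist_le : cv; apply.
have [u /= u0 Hu] := N.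
near=> n.
have n0 : 0 < n.+1%:R^-1 :> R by rewrite invr_gt0.
have [fn le] : davg f x (4 * n.+1%:R^-1) \is a fin_num /\ `|0 - fine (davg f x (4 * n.+1%:R^-1))| <= d / 8.
  apply: Hu; last by rewrite mulr_gt0.
  rewrite /= sub0r normrN gtr0_norm ?mulr_gt0// mulrC -ltr_pdivlMr//.
  near: n; have u4 : 0 < u / 4 by rewrite divr_gt0.
  exact: (near_infty_natSinv_lt (PosNum u4)).
rewrite distrC -lee_fin; apply: le_trans (moll_davg x n0 bf) _.
rewrite -(fineK fn) -EFinM lee_fin mulrC -ler_pdivlMr//.
by move: le; rewrite sub0r normrN; apply: le_trans; exact: ler_norm.
Unshelve. all: by end_near. Qed.

(** The mollified functions are smooth with derivative of L^1 norm at most M, hence satisfy the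
    bound on increments, which passes to the limit. *)
Lemma TV_tvle f B M : bm f B -> (TV_seminorm f <= M%:E)%E -> tvle f M.
Proof.
move=> bf tv; split; first exact: bf.1.
have n0 (n : nat) : 0 < n.+1%:R^-1 :> R by rewrite invr_gt0.
move=> y; apply: (@fatou_nle _ (fun n x => conv (rho n.+1%:R^-1) f (x + y) - conv (rho n.+1%:R^-1) f x)).
- move=> n; have [D cD] := c11_moll (n0 n) bf.
  by have [_ ] := tvle_deriv cD (nleN (TV_moll (n0 n) bf tv)); apply.
- have := bf.1; have := meas_shift y bf.1; rewrite /meas => ? ?; mtac.
- have h1 := ae_moll bf; have h2 := ae_moll (bm_shift y bf).
  apply: (@filterS2 _ _ (ae_filter_ringOfSetsType mu) _ _ _ _ h1 h2) => x c1 c2.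
  apply: cvgB => //; apply: cvg_trans c2; apply: near_eq_cvg; near=> n.
  by rewrite -conv_shift.
Unshelve. all: by end_near. Qed.

Lemma cvg_eventually0 f r : (forall x, x \notin `[- r, r] -> f x = 0) ->
  f n%:R @[n --> \oo] --> (0 : R) /\ f (- n%:R) @[n --> \oo] --> (0 : R).
Proof.
move=> f0; split; apply: cvg_near_cst; near=> n; apply: f0;
  rewrite in_itv/= negb_and -!ltNge; apply/orP; [right|left; rewrite ltrN2];
  by near: n; exact: nbhs_infty_gtr.
Unshelve. all: by end_near. Qed.

Lemma I_by_parts_test g dg C phi : c11 g dg C -> of_class_C 1 phi ->
  compactly_supported_in setT phi ->
  I (fun x => g x * derive1 phi x) = - I (fun x => dg x * phi x).
Proof.
move=> cg cphi sphi; have [r [B [r0 out bp bd]]] := test_bounds cphi sphi.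
have [bg bdg _] := cg.
have cp : continuous phi by move=> x; exact: is_derive_continuous (class_C1_derive x cphi).
have rr : - r <= r by lra.
have np : nle phi ((r - - r) * B) by apply: nle_supp => // [|x xr]; [exact: continuous_meas|have [] := out x xr].
have nd : nle (derive1 phi) ((r - - r) * B).
  by apply: nle_supp => // [|x xr]; [exact: continuous_meas (class_C1_cont cphi)|have [] := out x xr].
have i1 := nle_integ (nleM bg.1 bg.2 nd); have i2 := nle_integ (nleM bdg.1 bdg.2 np).
apply/eqP; rewrite -subr_eq0 opprK -ID//; apply/eqP.
have F0 x : x \notin `[- r, r] -> (g x * phi x) = 0.
  by move=> xr; have [-> _] := out x xr; rewrite mulr0.
have [c1 c2] := cvg_eventually0 F0.
apply: (@I_derive_line _ (fun x => g x * phi x)) => //.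
- move=> x; have d1 := c11_derive x cg; have d2 := class_C1_derive x cphi.
  have -> : g x * phi^`()%classic x + dg x * phi x = g x *: derive1 phi x + phi x *: dg x.
    by rewrite /GRing.scale/=; ring.
  exact: is_deriveM.
- move=> x; apply: cvgD; apply: cvgM.
  + exact: (c11_cont cg). + exact: class_C1_cont cphi _. + exact: (c11_contd cg). + exact: cp.
- exact: integD.
Qed.

(** The mollification can be integrated by parts against [phi] and has derivative of L^1 norm at
    most C; replacing it by f costs O(e). *)
Lemma tvle_TV f B C : bm f B -> tvle f C -> (TV_seminorm f <= C%:E)%E.
Proof.
move=> bf tf; apply: ge_ereal_sup => _ [phi [cphi sphi p1] <-]; rewrite lee_fin.
have [r [D [r0 out bp bd]]] := test_bounds cphi sphi.
have rr : - r <= r by lra.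
have cp : continuous phi by move=> x; exact: is_derive_continuous (class_C1_derive x cphi).
have mp := continuous_meas cp; have md := continuous_meas (class_C1_cont cphi).
have nd : nle (derive1 phi) ((r - - r) * D).
  by apply: nle_supp => // x xr; have [] := out x xr.
have key e : 0 < e -> I (fun x => f x * derive1 phi x) <= C + D * (C * (18 * e)).
  move=> e0; have [E cE] := c11_moll e0 bf; have [bE _ _] := cE.
  have nde := nle_deriv cE; have tc := tvle_conv (nle_rho e0) bf tf; rewrite mulr1 in tc.
  have i1 := nle_integ (nleM bE.1 bE.2 nd); have i2 := nle_integ (nleM bf.1 bf.2 nd).
  have -> : I (fun x => f x * derive1 phi x) =
     I (fun x => conv (rho e) f x * derive1 phi x) - I (fun x => derive1 phi x * (conv (rho e) f x - f x)).
    rewrite [X in _ - X](_ : _ = I (fun x => conv (rho e) f x * derive1 phi x - f x * derive1 phi x)); last by apply: eqI => x; ring.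
    by rewrite IB//; ring.
  apply: lerD.
    rewrite (I_by_parts_test cE cphi sphi); apply: le_trans (ler_norm _) _; rewrite normrN.
    apply: nle_normI; have := nleM mp p1 (nde _ tc); rewrite mul1r.
    by congr (nle _ _); apply/funext => x; rewrite mulrC.
  apply: le_trans (ler_norm _) _; rewrite normrN; apply: nle_normI.
  apply: nleM => //; exact: conv_nle_dist (nle_rho e0) (I_rho e0) (nle_rho1 e0) bf tf.
apply/ler_addgt0Pr => d d0.
have C0 : 0 <= C by have := tf.2 1 => /nle_ge0; rewrite normr1 mulr1.
have D0 : 0 <= D by apply: le_trans (bd 0).
have X0 : 0 < D * (C * 18) + 1 by rewrite ltr_wpDl// !mulr_ge0.
have e0 : 0 < d / (D * (C * 18) + 1) by rewrite divr_gt0.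
apply: le_trans (key _ e0) _; rewrite lerD2l.
set X := D * (C * 18) + 1 in X0 *.
have -> : D * (C * (18 * (d / X))) = (d * (D * (C * 18))) / X by ring.
by rewrite ler_pdivrMr// ler_wpM2l ?(ltW d0)// /X; lra.
Qed.

End total_variation_seminorm.

(** * Smooth approximate solutions *)

Section gronwall_and_composition.
Variable R : realType.
Implicit Types (f g k df dg dk phi : R -> R) (a b x y z c e h : R).

(* Iterate over n Euler steps of size t/n and let n tend to infinity. *)
Lemma gronwall (N : R -> R) T c d C : 0 <= c -> 0 <= d -> 0 <= C ->
  (forall t, 0 <= t <= T -> 0 <= N t) ->
  (forall t h, 0 <= t -> 0 <= h -> t + h <= T -> N (t + h) <= N t + h * (c * N t + d) + C * h ^+ 2) ->
  forall t, 0 <= t <= T -> N t <= expR (c * t) * (N 0 + d * t).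
Proof.
move=> c0 d0 C0 N0 step t /andP[t0 tT].
have T0 : 0 <= T by exact: le_trans tT.
have key (n : nat) : N t <= expR (c * t) * (N 0 + t * (d + C * (t / n.+1%:R))).
  pose h := t / n.+1%:R.
  have h0 : 0 <= h by rewrite divr_ge0.
  have nh : n.+1%:R * h = t by rewrite mulrC divfK// pnatr_eq0.
  have D0 : 0 <= d + C * h by rewrite addr_ge0// mulr_ge0.
  have ind (i : nat) : (i <= n.+1)%N -> N (i%:R * h) <= expR (c * (i%:R * h)) * (N 0 + i%:R * h * (d + C * h)).
    elim: i => [|i IH] iN; first by rewrite !mul0r mulr0 expR0 mul1r addr0.
    have ih0 : 0 <= i%:R * h by rewrite mulr_ge0.
    have ihT : i%:R * h + h <= T.
      apply: le_trans tT; rewrite -nh -[X in _ + X]mul1r -mulrDl natr1.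
      by rewrite ler_wpM2r// ler_nat.
    have {}IH := IH (ltnW iN).
    have e1 : i.+1%:R * h = i%:R * h + h by rewrite -natr1; ring.
    rewrite e1; apply: le_trans (step _ _ ih0 h0 ihT) _.
    have Ni : 0 <= N (i%:R * h) by apply: N0; rewrite ih0/= (le_trans _ ihT)// lerDl.
    have ex : 1 + c * h <= expR (c * h) := expR_ge1Dx _.
    rewrite [c * (_ + h)]mulrDr expRD.
    apply: (@le_trans _ _ (expR (c * h) * N (i%:R * h) + h * (d + C * h))).
      have -> : N (i%:R * h) + h * (c * N (i%:R * h) + d) + C * h ^+ 2 = (1 + c * h) * N (i%:R * h) + h * (d + C * h) by ring.
      by rewrite lerD2r ler_wpM2r.
    apply: (@le_trans _ _ (expR (c * h) * (expR (c * (i%:R * h)) * (N 0 + i%:R * h * (d + C * h))) + expR (c * (i%:R * h)) * expR (c * h) * (h * (d + C * h)))).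
      apply: lerD; first by rewrite ler_wpM2l// expR_ge0.
      rewrite -[leLHS]mul1r ler_wpM2r ?mulr_ge0//.
      by rewrite -expRD; apply: le_trans (expR_ge1Dx _); rewrite lerDl; apply: addr_ge0; apply: mulr_ge0.
    by rewrite le_eqVlt; apply/orP; left; apply/eqP; ring.
  by have := ind n.+1 (leqnn _); rewrite nh.
have E0 := expR_gt0 (c * t).
apply/ler_addgt0Pr => u u0.
pose X := expR (c * t) * (t * (C * t)) + 1.
have X0 : 0 < X by rewrite ltr_wpDl// !mulr_ge0// ltW.
have uX : 0 < u / X by rewrite divr_gt0.
have [n _ Hn] := near_infty_natSinv_lt (PosNum uX).
have {}Hn := Hn n (leqnn n).
apply: le_trans (key n) _.
have -> : expR (c * t) * (N 0 + t * (d + C * (t / n.+1%:R))) =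
  expR (c * t) * (N 0 + d * t) + (X - 1) / n.+1%:R by rewrite /X; ring.
rewrite lerD2l; apply: (@le_trans _ _ (X * n.+1%:R^-1)).
  by rewrite ler_wpM2r ?invr_ge0//; lra.
by rewrite mulrC -ler_pdivlMr// ltW.
Qed.

(** The product of the two increments costs 3 * 3 = 9 and the two Taylor remainders 1 each; 13
    leaves room. *)
Lemma c11_mul f df g dg C D : c11 f df C -> c11 g dg D ->
  c11 (fun x => f x * g x) (fun x => df x * g x + f x * dg x) (13 * (C * D)).
Proof.
move=> cf cg; have C0 := c11_ge0 cf; have D0 := c11_ge0 cg.
have [bf bdf Hf] := cf; have [bg bdg Hg] := cg.
have CD : 0 <= C * D by rewrite mulr_ge0.
have b1 := bmM bf bg; have b2 := bmM bdf bg; have b3 := bmM bf bdg.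
split.
- split; first exact: b1.1. by move=> x; apply: le_trans (b1.2 x) _; lra.
- split; first by apply: measurable_funD; [exact: b2.1|exact: b3.1].
  by move=> x; apply: le_trans (ler_normD _ _) _; apply: le_trans (lerD (b2.2 x) (b3.2 x)) _; lra.
move=> x h.
have -> : f (x + h) * g (x + h) - f x * g x - (df x * g x + f x * dg x) * h =
  (f (x + h) - f x) * (g (x + h) - g x) + (f (x + h) - f x - df x * h) * g x + f x * (g (x + h) - g x - dg x * h) by ring.
have l1 := c11_lip x h cf; have l2 := c11_lip x h cg.
have m1 : `|f (x + h) - f x| * `|g (x + h) - g x| <= (3 * C * `|h|) * (3 * D * `|h|) by exact: ler_pM.
have m2 : `|f (x + h) - f x - df x * h| * `|g x| <= C * h ^+ 2 * D by apply: ler_pM => //; exact: bg.2.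
have m3 : `|f x| * `|g (x + h) - g x - dg x * h| <= C * (D * h ^+ 2) by apply: ler_pM => //; exact: bf.2.
apply: le_trans (ler_normD _ _) _; apply: le_trans (lerD (ler_normD _ _) (lexx _)) _.
rewrite !normrM; have hh : `|h| * `|h| = h ^+ 2 by rewrite -expr2 real_normK ?num_real.
have : (3 * C * `|h|) * (3 * D * `|h|) = 9 * (C * D * h ^+ 2) by rewrite -hh; ring.
have : 0 <= C * D * h ^+ 2 by rewrite mulr_ge0// sqr_ge0.
by lra.
Qed.

Lemma c11_lin f df g dg C D u w : c11 f df C -> c11 g dg D ->
  c11 (fun x => u * f x + w * g x) (fun x => u * df x + w * dg x) (`|u| * C + `|w| * D).
Proof.
move=> [bf bdf Hf] [bg bdg Hg].
have comb f' g' : bm f' C -> bm g' D -> bm (fun x => u * f' x + w * g' x) (`|u| * C + `|w| * D).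
  move=> [m1 b1] [m2 b2]; split; first by rewrite /meas in m1 m2 *; mtac.
  move=> x; apply: le_trans (ler_normD _ _) _.
  by rewrite !normrM lerD// ler_wpM2l.
split; [exact: comb|exact: comb|move=> x h].
have -> : u * f (x + h) + w * g (x + h) - (u * f x + w * g x) - (u * df x + w * dg x) * h
  = u * (f (x + h) - f x - df x * h) + w * (g (x + h) - g x - dg x * h) by ring.
apply: le_trans (ler_normD _ _) _; rewrite !normrM mulrDl -!mulrA.
by apply: lerD; rewrite ler_wpM2l.
Qed.

(** A C^2 function V has these bounds only on bounded sets, so the C^{1,1} inequalities are
    restricted to arguments in [- B, B], where the solution takes its values. *)
Definition loc11 (V dV : R -> R) B L := [/\ (forall u, `|u| <= B -> `|V u| <= L),
  (forall u, `|u| <= B -> `|dV u| <= L),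
  (forall u w, `|u| <= B -> `|w| <= B -> `|V w - V u| <= L * `|w - u|),
  (forall u w, `|u| <= B -> `|w| <= B -> `|dV w - dV u| <= L * `|w - u|) &
  (forall u w, `|u| <= B -> `|w| <= B -> `|V w - V u - dV u * (w - u)| <= L * (w - u) ^+ 2)].

Lemma c11_comp V dV B L p dp C : meas V -> meas dV -> loc11 V dV B L -> (forall x, `|p x| <= B) ->
  c11 p dp C -> c11 (fun x => V (p x)) (fun x => dV (p x) * dp x) (L + L * C + L * (3 * C) ^+ 2).
Proof.
move=> mV mdV [V0 V1 V2 V3 V4] pB cp; have [[mp _] [mdp dpC] H] := cp.
have C0 := c11_ge0 cp.
have L0 : 0 <= L by apply: le_trans (V0 _ (pB 0)).
have LC : 0 <= L * C by rewrite mulr_ge0.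
have L3 : 0 <= L * (3 * C) ^+ 2 by rewrite mulr_ge0// sqr_ge0.
split.
- split; first exact: (measurableT_comp mV mp).
  by move=> x; apply: le_trans (V0 _ (pB x)) _; lra.
- split; first by apply: measurable_funM => //; exact: (measurableT_comp mdV mp).
  move=> x; rewrite normrM; have := ler_pM (normr_ge0 _) (normr_ge0 _) (V1 _ (pB x)) (dpC x).
  by move=> /le_trans; apply; lra.
move=> x h.
have -> : V (p (x + h)) - V (p x) - dV (p x) * dp x * h =
  (V (p (x + h)) - V (p x) - dV (p x) * (p (x + h) - p x)) + dV (p x) * (p (x + h) - p x - dp x * h) by ring.
apply: le_trans (ler_normD _ _) _.
have l := c11_lip x h cp.
have m1 : L * (p (x + h) - p x) ^+ 2 <= L * (3 * C) ^+ 2 * h ^+ 2.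
  rewrite -mulrA ler_wpM2l// -exprMn -real_normK ?num_real// -[leRHS]real_normK ?num_real//.
  by rewrite lerXn2r ?nnegrE// normrM [`|3 * C|]ger0_norm//; lra.
have m2 := V4 _ _ (pB x) (pB (x + h)).
have m3 : `|dV (p x)| * `|p (x + h) - p x - dp x * h| <= L * (C * h ^+ 2).
  by apply: ler_pM => //; exact: V1.
rewrite normrM; have : 0 <= L * h ^+ 2 by rewrite mulr_ge0// sqr_ge0.
by rewrite !mulrDl; lra.
Qed.

End gronwall_and_composition.

(** * One Euler step of a transport equation in a weighted integral *)

Section transport.
Variable R : realType.
Implicit Types (f g k df dg dk phi be dbe z zx P Px S : R -> R) (a b x y c e h u w LP CP Cz CS CB E T C B : R).
Notation I := (@integralR R).

Lemma integ_psiM a f C : 0 < a -> bm f C -> integ (fun x => f x * psi a x).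
Proof. by move=> a0 [mf fC]; exact: integM mf fC (integ_psi a0). Qed.

Lemma bmD f g B B' : bm f B -> bm g B' -> bm (fun x => f x + g x) (B + B').
Proof.
move=> [mf fB] [mg gB]; split; first by rewrite /meas in mf mg *; mtac.
by move=> x; apply: le_trans (ler_normD _ _) _; apply: lerD.
Qed.

Lemma bmN f B : bm f B -> bm (fun x => - f x) B.
Proof.
move=> [mf fB]; split; first by rewrite /meas in mf *; mtac.
by move=> x; rewrite normrN.
Qed.

Lemma I_le_psi a f g C : 0 < a -> bm f C -> bm g C -> (forall x, f x <= g x) ->
  I (fun x => f x * psi a x) <= I (fun x => g x * psi a x).
Proof.
move=> a0 bf bg fg; apply: I_le; [exact: integ_psiM bf|exact: integ_psiM bg|].
by move=> x; rewrite ler_wpM2r// ltW// psi_gt0.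
Qed.

Lemma transport_by_parts a (P Px z zx be dbe : R -> R) CP Cz CB : 0 < a ->
  c11 P Px CP -> c11 z zx Cz -> (forall u, is_derive u 1 be (dbe u)) -> continuous dbe ->
  bm (fun x => be (z x)) CB -> bm (fun x => dbe (z x)) CB ->
  - I (fun x => (dbe (z x) * zx x * P x) * psi a x) =
  I (fun x => be (z x) * Px x * psi a x) + I (fun x => be (z x) * P x * dpsi a x).
Proof.
move=> a0 cP cz dbeE cdbe bb bdb.
have [bP bPx _] := cP; have [bz bzx _] := cz.
have i1 : integ (fun x => dbe (z x) * zx x * P x * psi a x) := integ_psiM a0 (bmM (bmM bdb bzx) bP).
have i2 : integ (fun x => be (z x) * Px x * psi a x) := integ_psiM a0 (bmM bb bPx).
have i3 : integ (fun x => be (z x) * P x * dpsi a x).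
  apply: (@integ_le _ _ (fun x => CB * CP * a * psi a x)).
  - by apply: measurable_funM; [exact: (bmM bb bP).1|exact: continuous_meas (@dpsi_cont R a)].
  - move=> x; rewrite normrM -[CB * CP * a * _]mulrA.
    rewrite [leRHS]normrM; apply: ler_pM => //.
      by apply: le_trans ((bmM bb bP).2 x) _; exact: ler_norm.
    by apply: le_trans (dpsi_le x (ltW a0)) _; exact: ler_norm.
  - exact: integZ (integ_psi a0).
apply/eqP; rewrite eq_sym -subr_eq0 opprK -ID// -ID//; last exact: integD.
apply/eqP.
have cb x : {for x, continuous be} by exact: is_derive_continuous (dbeE x).
have cbz : continuous (fun x => be (z x)).
  by move=> x; apply: (@continuous_comp _ _ _ z be); [exact: (c11_cont cz)|exact: cb].
have cdz : continuous (fun x => dbe (z x)).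
  by move=> x; apply: (@continuous_comp _ _ _ z dbe); [exact: (c11_cont cz)|exact: cdbe].
have cF (u : R) : `|be (z u) * P u * psi a u| <= CB * CP * psi a u.
  by rewrite normrM [`|psi _ _|]gtr0_norm ?psi_gt0// ler_wpM2r ?(bmM bb bP).2// ltW// psi_gt0.
have lim0 : CB * CP * psi a n%:R @[n --> \oo] --> (0 : R).
  rewrite -[X in _ --> X](mulr0 (CB * CP)); apply: cvgM; first exact: cvg_cst.
  exact: cvg_psin.
have limN : - (CB * CP * psi a n%:R) @[n --> \oo] --> (0 : R).
  by rewrite -[X in _ --> X]oppr0; apply: cvgN.
apply: (@I_derive_line _ (fun x => be (z x) * P x * psi a x)).
- move=> x; have d1 := c11_derive x cP; have d2 := c11_derive x cz.
  have d3 := is_derive_psi a x; have d4 := is_derive1_comp (dbeE (z x)) d2.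
  have d5 := is_deriveM d4 d1.
  have -> : be (z x) * Px x * psi a x + be (z x) * P x * dpsi a x + dbe (z x) * zx x * P x * psi a x
    = (be (z x) * P x) *: dpsi a x + psi a x *: ((be \o z) x *: Px x + P x *: (dbe (z x) * zx x)).
    by rewrite /GRing.scale/=; ring.
  exact: is_deriveM.
- have cPx := c11_contd cP; have czx := c11_contd cz; have cPc := c11_cont cP.
  have cpsi := @psi_cont R a; have cdpsi := @dpsi_cont R a.
  move=> x; apply: cvgD; first apply: cvgD.
  + by apply: cvgM; [apply: cvgM; [exact: cbz|exact: cPx]|exact: cpsi].
  + by apply: cvgM; [apply: cvgM; [exact: cbz|exact: cPc]|exact: cdpsi].
  + by apply: cvgM; [apply: cvgM; [apply: cvgM; [exact: cdz|exact: czx]|exact: cPc]|exact: cpsi].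
- by apply: integD => //; exact: integD.
- apply: (@squeeze_cvgr _ _ _ _ (fun n => - (CB * CP * psi a n%:R)) (fun n => CB * CP * psi a n%:R)) => //.
  by near=> n; rewrite -ler_norml.
- apply: (@squeeze_cvgr _ _ _ _ (fun n => - (CB * CP * psi a n%:R)) (fun n => CB * CP * psi a n%:R)) => //.
  by near=> n; rewrite -ler_norml -[psi a n%:R]psiN.
Unshelve. all: by end_near. Qed.

(** One step of z_t + P z_x = S for the weighted integral of be(z). Taylor's inequality for [be]
    handles the step; integration by parts turns the transport term into be(z) P_x plus a term in
    psi', absorbed by [a * LP]. It is used with the squared positive part for the maximum principle
    and with the smoothed modulus for the decay. *)
Lemma transport_step a (P Px z zx z1 S be dbe : R -> R) LP CP Cz CS CB E h T : 0 < a ->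
  c11 P Px CP -> (forall x, `|P x| <= LP) -> c11 z zx Cz -> bm S CS -> meas z1 ->
  (forall u, is_derive u 1 be (dbe u)) -> continuous dbe -> (forall u, 0 <= be u) ->
  (forall x, be (z x) <= CB) -> (forall x, `|dbe (z x)| <= CB) ->
  (forall u w, be w <= be u + dbe u * (w - u) + CB * (w - u) ^+ 2) ->
  0 <= h <= T -> 0 <= E ->
  (forall x, `|z1 x - z x - h * (- (P x * zx x) + S x)| <= E * h ^+ 2) ->
  I (fun x => be (z1 x) * psi a x) <= I (fun x => be (z x) * psi a x) +
    h * (a * LP * I (fun x => be (z x) * psi a x) +
         I (fun x => (be (z x) * Px x + dbe (z x) * S x) * psi a x)) +
    (CB * E + CB * (CP * Cz + CS + E * T) ^+ 2) * I (psi a) * h ^+ 2.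
Proof.
move=> a0 cP PL cz bS mz1 dbeE cdbe be0 beB dbeB bq /andP[h0 hT] E0 st.
have [bP bPx _] := cP; have [bz bzx _] := cz.
have mbe : meas be by apply: continuous_meas => u; exact: is_derive_continuous (dbeE u).
have mdbe := continuous_meas cdbe.
have bb : bm (fun x => be (z x)) CB.
  split; first exact: (measurableT_comp mbe bz.1).
  by move=> x; rewrite ger0_norm.
have bdb : bm (fun x => dbe (z x)) CB by split => //; exact: (measurableT_comp mdbe bz.1).
have CB0 : 0 <= CB by apply: le_trans (be0 _) (beB 0).
have CP0 := c11_ge0 cP; have Cz0 := c11_ge0 cz.
have CS0 : 0 <= CS by apply: le_trans (bS.2 0).
set Q := CB * E + CB * (CP * Cz + CS + E * T) ^+ 2.
have Q0 : 0 <= Q by apply: addr_ge0; apply: mulr_ge0 => //; exact: sqr_ge0.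
pose D x := - (P x * zx x) + S x.
have bD : bm D (CP * Cz + CS) := bmD (bmN (bmM bP bzx)) bS.
have pw x : be (z1 x) <= be (z x) + h * (dbe (z x) * D x) + Q * h ^+ 2.
  apply: le_trans (bq (z x) (z1 x)) _.
  pose ro := z1 x - z x - h * D x.
  have roE : `|ro| <= E * h ^+ 2 by exact: st.
  have -> : z1 x - z x = h * D x + ro by rewrite /ro; ring.
  have e1 : `|dbe (z x) * ro| <= CB * (E * h ^+ 2) by rewrite normrM ler_pM.
  (* One of the two factors h in the Euler error is bounded by T, so that the whole increment is
     O(h). *)
  have e2 : `|h * D x + ro| <= h * (CP * Cz + CS + E * T).
    apply: le_trans (ler_normD _ _) _; rewrite [h * (_ + E * T)]mulrDr; apply: lerD.
      by rewrite normrM ger0_norm// ler_wpM2l// bD.2.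
    apply: le_trans roE _; rewrite expr2 mulrCA ler_wpM2l// ler_wpM2l//.
  have e3 : (h * D x + ro) ^+ 2 <= (h * (CP * Cz + CS + E * T)) ^+ 2.
    rewrite -[leLHS]real_normK ?num_real// lerXn2r ?nnegrE//.
    exact: le_trans e2.
  have e4 : CB * (h * D x + ro) ^+ 2 <= CB * (h * (CP * Cz + CS + E * T)) ^+ 2 by rewrite ler_wpM2l.
  have e5 := le_trans (ler_norm _) e1.
  rewrite exprMn in e4; rewrite /Q mulrDr; lra.
have bR : bm (fun x => be (z x) + h * (dbe (z x) * D x) + Q * h ^+ 2)
   (CB + `|h| * (CB * (CP * Cz + CS)) + `|Q * h ^+ 2|).
  apply: bmD; last exact: bm_cst.
  by apply: bmD => //; apply: (bmM (bm_cst h)); exact: bmM.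
have bz1 : bm (fun x => be (z1 x)) (CB + `|h| * (CB * (CP * Cz + CS)) + `|Q * h ^+ 2|).
  split; first exact: (measurableT_comp mbe mz1).
  move=> x; rewrite ger0_norm//; apply: le_trans (pw x) _.
  by apply: le_trans (ler_norm _) _; exact: bR.2.
apply: le_trans (I_le_psi a0 bz1 bR pw) _.
have j1 := integ_psiM a0 bb.
have j2 : integ (fun x => dbe (z x) * D x * psi a x) := integ_psiM a0 (bmM bdb bD).
have j3 := integ_psi a0.
have -> : I (fun x => (be (z x) + h * (dbe (z x) * D x) + Q * h ^+ 2) * psi a x) =
  I (fun x => be (z x) * psi a x) + h * I (fun x => dbe (z x) * D x * psi a x) + Q * h ^+ 2 * I (psi a).
  rewrite -IZ// -[Q * h ^+ 2 * _]IZ// -ID//; last exact: integZ.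
  rewrite -ID//; [|by apply: integD => //; exact: integZ|exact: integZ].
  by apply: eqI => x; ring.
have -> : Q * I (psi a) * h ^+ 2 = Q * h ^+ 2 * I (psi a) by ring.
rewrite lerD2r lerD2l ler_wpM2l//.
have k1 : integ (fun x => dbe (z x) * zx x * P x * psi a x) := integ_psiM a0 (bmM (bmM bdb bzx) bP).
have k2 : integ (fun x => dbe (z x) * S x * psi a x) := integ_psiM a0 (bmM bdb bS).
have k3 : integ (fun x => be (z x) * Px x * psi a x) := integ_psiM a0 (bmM bb bPx).
have -> : I (fun x => dbe (z x) * D x * psi a x) =
  - I (fun x => dbe (z x) * zx x * P x * psi a x) + I (fun x => dbe (z x) * S x * psi a x).
  rewrite addrC -IB//; by apply: eqI => x; rewrite /D; ring.
rewrite (transport_by_parts a0 cP cz dbeE cdbe bb bdb) [X in X + _ <= _]addrC -addrA; apply: lerD.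
  rewrite -IZ//; apply: I_le.
  - apply: (@integ_le _ _ (fun x => CB * CP * a * psi a x)).
    + by apply: measurable_funM; [exact: (bmM bb bP).1|exact: continuous_meas (@dpsi_cont R a)].
    + move=> x; rewrite normrM -[CB * CP * a * _]mulrA.
      rewrite [leRHS]normrM; apply: ler_pM => //.
        by apply: le_trans ((bmM bb bP).2 x) _; exact: ler_norm.
      by apply: le_trans (dpsi_le x (ltW a0)) _; exact: ler_norm.
    + exact: integZ (integ_psi a0).
  - exact: integZ.
  move=> x; apply: le_trans (ler_norm _) _; rewrite (normrM _ (dpsi a x)) (normrM (be _)).
  have -> : a * LP * (be (z x) * psi a x) = be (z x) * LP * (a * psi a x) by ring.
  rewrite [`|be _|]ger0_norm//; apply: ler_pM => //.
  - by rewrite mulr_ge0.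
  - by rewrite ler_wpM2l.
  - exact: dpsi_le x (ltW a0).
rewrite -ID// le_eqVlt; apply/orP; left; apply/eqP; apply: eqI => x; ring.
Qed.

End transport.

Section kernel_adjoint.
Variable R : realType.
Implicit Types (f g : R -> R) (a b x y c e h u w t B L E M d T : R).
Notation I := (@integralR R).
Notation K := (@exponential_pdf R).

(** Exchanging the integrals and shifting x by z moves the weight to x - z, at the price exp(a z);
    the tilted kernel then has mass b / (b - a). The factor tends to 1 with a, which keeps the sign
    structure of the unweighted problem. *)
Lemma convK_adjoint_psi a b f C : 0 < a -> a < b -> bm f C -> (forall x, 0 <= f x) ->
  I (fun x => conv (K b) f x * psi a x) <= b / (b - a) * I (fun x => f x * psi a x).
Proof.
move=> a0 ab bf f0; have b0 : 0 < b by exact: lt_trans ab.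
have nK := nle_K b0; have [mf fC] := bf; have mK := nK.1.
have mpsi : meas (psi a) := continuous_meas (@psi_cont R a).
have C0 : 0 <= C by apply: le_trans (fC 0).
have npsi : nle (psi a) (I (psi a)) by apply: ge0_nle (integ_psi a0) => x; rewrite ltW// psi_gt0.
have ngz z : nle (fun x => psi a x * (K b z * f (x + z))) (`|K b z| * (C * I (psi a))).
  have := nleZ (K b z) (nleM (meas_shift z mf) (fun x => fC (x + z)) npsi).
  by congr (nle _ _); apply/funext => x; ring.
have Ip0 := nle_ge0 npsi.
have nc : nle (fun z => C * I (psi a) * K b z) (C * I (psi a) * 1).
  have := nleZ (C * I (psi a)) nK; rewrite ger0_norm//; exact: mulr_ge0.
have iK x : integ (fun z => K b z * f (x + z)) := conv_integ x nK bf.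
have -> : I (fun x => conv (K b) f x * psi a x) = I (fun x => I (fun z => psi a x * (K b z * f (x + z)))).
  by apply: eqI => x; rewrite IZ// mulrC.
rewrite (@I_swap2 _ (fun p => psi a p.1 * (K b p.2 * f (p.1 + p.2))) _ _ _ _ _ nc)/=; last 3 first.
- apply: measurable_funM; first by apply: (measurableT_comp mpsi); mtac.
  apply: measurable_funM; first by apply: (measurableT_comp mK); mtac.
  by apply: (measurableT_comp mf); mtac.
- by move=> x; exact: integZ.
- move=> z; apply: nleC (ngz z).
  by rewrite normrM [`|C * _|]ger0_norm ?mulr_ge0// mulrC.
have nT := nle_K_tilt ab b0.
have ifp : integ (fun x => f x * psi a x) := integ_psiM a0 bf.
have Ifp0 : 0 <= I (fun x => f x * psi a x).
  by apply: I_ge0 => x; rewrite mulr_ge0// ltW// psi_gt0.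
have ET : I (fun z => K b z * expR (a * z)) <= b / (b - a) := nle_I nT.
apply: le_trans (ler_wpM2r Ifp0 ET); rewrite mulrC -IZ ?(nle_integ nT)//.
apply: I_le.
- apply: (@integ_le _ _ (fun z => C * I (psi a) * K b z)); last exact: nle_integ nc.
    apply: (meas_param (G := fun p : R * R => psi a p.2 * (K b p.1 * f (p.2 + p.1)))).
    apply: measurable_funM; first by apply: (measurableT_comp mpsi); mtac.
    apply: measurable_funM; first by apply: (measurableT_comp mK); mtac.
    by apply: (measurableT_comp mf); mtac.
  move=> z; apply: le_trans (nle_normI (ngz z)) _.
  by rewrite normrM [`|C * _|]ger0_norm ?mulr_ge0// mulrC.
- by apply: integZ; exact: nle_integ nT.
(* [psi_shift] controls only shifts with z >= 0; for negative z the kernel vanishes. *)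
move=> z; have [z0|z0] := leP 0 z; last first.
  have -> : K b z = 0 by rewrite lt0_exponential_pdf.
  by rewrite mul0r mulr0 (_ : (fun _ => _) = (fun=> 0)) /integralR ?Rintegral_cst ?mul0r//; apply/funext => x; rewrite mul0r mulr0.
have iz : integ (fun x => K b z * expR (a * z) * (f x * psi a x)) := integZ _ ifp.
rewrite mulrC -IZ// -(I_shift (- z)); last exact: (ngz z).1.
apply: I_le => //; first exact: integ_shift (nle_integ (ngz z)).
move=> x; rewrite subrK mulrC -!mulrA ler_wpM2l ?K_ge0// [leRHS]mulrCA ler_wpM2l//.
by rewrite mulrC psi_shift// ltW.
Qed.

(** Jensen's inequality: the average of (f - m)^2 is nonnegative, m being the average of f. *)
Lemma convK_sqr b f C x : 0 < b -> bm f C -> conv (K b) f x ^+ 2 <= conv (K b) (fun y => f y ^+ 2) x.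
Proof.
move=> b0 bf; have nK := nle_K b0.
have kc c : conv (K b) (fun y => c * f y) x = c * conv (K b) f x.
  rewrite /conv -IZ; last exact: conv_integ nK bf.
  by apply: eqI => z; rewrite mulrCA.
set m := conv (K b) f x.
have b2 : bm (fun y => f y ^+ 2) (C * C) by have := bmM bf bf; under eq_fun do rewrite -expr2.
have b1 := bmM (bm_cst (2 * m)) bf.
have H : 0 <= conv (K b) (fun y => f y ^+ 2 - 2 * m * f y - - m ^+ 2) x.
  rewrite -[leLHS](mulr0 (I (K b))) -(conv_cst 0 x nK).
  apply: (conv_le x (fun z => K_ge0 z b0) nK (bm_cst 0) (bmB (bmB b2 b1) (bm_cst (- m ^+ 2)))) => y.
  by rewrite (_ : _ - _ - _ = (f y - m) ^+ 2) ?sqr_ge0//; ring.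
move: H; rewrite (convB x nK (bmB b2 b1) (bm_cst (- m ^+ 2))) (convB x nK b2 b1) (conv_cst _ x nK) (I_K b0).
rewrite kc -/m; lra.
Qed.

End kernel_adjoint.

(** * Weighted L^2 maximum principle for approximate solutions *)

Section maximum_principle.
Variable R : realType.
Implicit Types (f g : R -> R) (a b x y c e h u w t B L E M d T : R).
Notation I := (@integralR R).
Notation K := (@exponential_pdf R).

Lemma convZ k f C B c x : nle k C -> bm f B -> conv k (fun y => c * f y) x = c * conv k f x.
Proof.
move=> nk bf; rewrite /conv -IZ; last exact: conv_integ nk bf.
by apply: eqI => z; rewrite mulrCA.
Qed.

Lemma convD k f g C B B' x : nle k C -> bm f B -> bm g B' ->
  conv k (fun y => f y + g y) x = conv k f x + conv k g x.
Proof.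
move=> nk bf bg; rewrite /conv -ID; [|exact: conv_integ nk bf|exact: conv_integ nk bg].
by apply: eqI => z; rewrite mulrDr.
Qed.

Definition Pot b (V : R -> R) (p : R -> R -> R) t x := conv (K b) (fun y => V (p t y)) x.
Definition dPot b (V : R -> R) (p : R -> R -> R) t x := b * (Pot b V p t x - V (p t x)).

(* [p] solves p_t + (p P)_x = r, with P = [Pot b V p], [px] = p_x and
   [dPot b V p] = P_x, stated through Euler steps so that no time derivative is
   needed; [d] is the L^1 size of the residual. *)
Definition approx_sol T b (V : R -> R) B E M d (p px r : R -> R -> R) :=
  (forall t, 0 <= t <= T -> [/\ c11 (p t) (px t) E, (forall x, `|p t x| <= B),
     nle (px t) M, bm (r t) E & nle (r t) d]) /\
  (forall t h x, 0 <= t -> 0 <= h -> t + h <= T ->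
    `|p (t + h) x - p t x - h * (- (Pot b V p t x * px t x) - dPot b V p t x * p t x + r t x)| <= E * h ^+ 2).

Section approximate_solution.
Variables (T b : R) (V dV : R -> R) (B L E M d : R) (p px r : R -> R -> R).
Hypotheses (T0 : 0 <= T) (b0 : 0 < b) (mV : meas V) (mdV : meas dV) (lV : loc11 V dV B L)
  (sol : approx_sol T b V B E M d p px r).

Local Notation P := (Pot b V p).
Local Notation Pd := (dPot b V p).
Local Notation v := (fun t x => V (p t x)).
Local Notation Ev := (L + L * E + L * (3 * E) ^+ 2).

Lemma sol_c11 t : 0 <= t <= T -> c11 (p t) (px t) E.
Proof. by move=> tT; have [H _] := sol; have [] := H t tT. Qed.

Lemma sol_bound t x : 0 <= t <= T -> `|p t x| <= B.
Proof. by move=> tT; have [H _] := sol; have [] := H t tT. Qed.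

Lemma B_ge0 : 0 <= B.
Proof. by have := @sol_bound 0 0; rewrite lexx T0 => /(_ isT); apply: le_trans. Qed.

Lemma L_ge0 : 0 <= L.
Proof. by have [V0 _ _ _ _] := lV; apply: le_trans (V0 0 _); rewrite ?normr0 ?B_ge0. Qed.

Lemma v_c11 t : 0 <= t <= T -> c11 (v t) (fun x => dV (p t x) * px t x) Ev.
Proof. by move=> tT; apply: c11_comp lV _ (sol_c11 tT) => // x; exact: sol_bound. Qed.

Lemma v_bm t : 0 <= t <= T -> bm (v t) L.
Proof.
move=> tT; have [[mv _] _ _] := v_c11 tT; split => // x.
by have [V0 _ _ _ _] := lV; apply: V0; exact: sol_bound.
Qed.

Lemma P_bm t : 0 <= t <= T -> bm (P t) L.
Proof. by move=> tT; have := bm_conv (nle_K b0) (v_bm tT); rewrite mulr1. Qed.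

(** The derivative of P is the average of V(p)_x, which the resolvent identity turns into b (P -
    V(p)). *)
Lemma P_c11 t : 0 <= t <= T -> c11 (P t) (Pd t) Ev.
Proof.
move=> tT; have cv := v_c11 tT; have := c11_conv (nle_K b0) cv; rewrite mulr1.
have [bv bvx _] := cv; have nK := nle_K b0.
congr (c11 _ _ _); apply/funext => x.
have := conv_K_resolvent x b0 cv.
rewrite (convB x nK bv (bmM (bm_cst b^-1) bvx)) (convZ b^-1 x nK bvx).
rewrite /dPot -/(Pot b V p t x) => <-.
by field; rewrite gt_eqF.
Qed.

Lemma Pd_bm t : 0 <= t <= T -> bm (Pd t) (2 * b * L).
Proof.
move=> tT; have := bmM (bm_cst b) (bmB (P_bm tT) (v_bm tT)).
by rewrite gtr0_norm//; congr bm; ring.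
Qed.

Section max_principle.
Variables (sg c : R).
Hypotheses (sg1 : sg = 1 \/ sg = -1) (cB : 0 <= c <= B)
  (Vmono : forall u w, `|u| <= B -> `|w| <= B -> u <= w -> V w <= V u).

Let nsg : `|sg| = 1. Proof. by case: sg1 => ->; rewrite ?normrN normr1. Qed.
Let cB' : `|c| <= B. Proof. by case/andP: cB => c0 ?; rewrite ger0_norm. Qed.

(** Compare with V(c). At x, which lies beyond c, monotonicity of V gives the local term a sign. In
    the average, points beyond c contribute at most L times their excess and all others have a sign.
    The parameter [sg] treats upper and lower barriers at once. *)
Lemma dPot_one_sided t x : 0 <= t <= T -> 0 < sg * (p t x - c) ->
  - (sg * Pd t x) <= b * L * conv (K b) (fun y => pospart (sg * (p t y - c))) x.
Proof.
move=> tT pos; have nK := nle_K b0; have bv := v_bm tT; have [mp _ _] := sol_c11 tT.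
have pB y := sol_bound y tT.
have [_ _ VL _ _] := lV.
have Vs y : 0 <= sg * (p t y - c) -> sg * (V (p t y) - V c) <= 0.
  by case: sg1 => ->; rewrite ?mul1r ?mulN1r ?oppr_ge0 ?oppr_le0 ?subr_ge0 ?subr_le0 => ?; exact: Vmono.
have Vn y : sg * (p t y - c) <= 0 -> sg * (V c - V (p t y)) <= 0.
  by case: sg1 => ->; rewrite ?mul1r ?mulN1r ?oppr_ge0 ?oppr_le0 ?subr_ge0 ?subr_le0 => ?; exact: Vmono.
have bq : bm (fun y => pospart (sg * (p t y - c))) (2 * B).
  split.
    apply: meas_pospart; apply: measurable_funM; first exact: measurable_cst.
    by apply: measurable_funB; [exact: mp.1|exact: measurable_cst].
  move=> y; rewrite ger0_norm ?pospart_ge0//.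
  have h : `|sg * (p t y - c)| <= 2 * B.
    by rewrite normrM nsg mul1r; apply: le_trans (ler_normB _ _) _; have := pB y; have := cB'; lra.
  have [[? ->]|[? ->]] := ppP (sg * (p t y - c)); first exact: le_trans (ler_norm _) h.
  by rewrite mulr_ge0// B_ge0.
have bdiff : bm (fun y => sg * (V c - V (p t y))) (1 * (`|V c| + L)).
  by rewrite -nsg; exact: bmM (bm_cst sg) (bmB (bm_cst (V c)) bv).
have bL := bmM (bm_cst L) bq.
have KL : conv (K b) (fun y => sg * (V c - V (p t y))) x <= L * conv (K b) (fun y => pospart (sg * (p t y - c))) x.
  rewrite -(convZ L x nK bq); apply: (conv_le x (fun z => K_ge0 z b0) nK bdiff bL) => y.
  have [[h ->]|[h ->]] := ppP (sg * (p t y - c)).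
    apply: le_trans (ler_norm _) _; rewrite normrM nsg mul1r.
    apply: le_trans (VL _ _ (pB y) cB') _; rewrite ler_wpM2l ?L_ge0//.
    by rewrite distrC -[leLHS]mul1r -nsg -normrM ger0_norm.
  by rewrite mulr0; exact: Vn.
have -> : - (sg * Pd t x) = b * (sg * (V (p t x) - V c)) + b * (sg * (V c - P t x)).
  by rewrite /dPot; ring.
have KE : conv (K b) (fun y => sg * (V c - V (p t y))) x = sg * (V c - P t x).
  rewrite (convZ sg x nK (bmB (bm_cst (V c)) bv)) (convB x nK (bm_cst (V c)) bv).
  by rewrite (conv_cst _ x nK) (I_K b0) mul1r.
rewrite -[b * L * _]mulrA -[leRHS]add0r; apply: lerD.
  by rewrite pmulr_rle0//; apply: Vs; exact: ltW.
by rewrite ler_wpM2l ?(ltW b0)// -KE.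
Qed.

(** Apart from the residual, every source term is bounded by the squared excess and its average, so
    the Gronwall inequality closes without a constant term. The weight rate b / 2 makes the factor b
    / (b - a) equal to 2. *)
Lemma max_principle t : 0 <= t <= T ->
  I (fun x => pospart (sg * (p t x - c)) ^+ 2 * psi (b / 2) x) <=
  expR ((b / 2 * L + (2 * b * L + 3 * (B * b * L))) * t) *
  (I (fun x => pospart (sg * (p 0 x - c)) ^+ 2 * psi (b / 2) x) + 4 * B * d * t).
Proof.
pose a := b / 2; have a0 : 0 < a by rewrite divr_gt0.
have ab : a < b by move: b0; rewrite /a => ?; rewrite ltr_pdivrMr//; lra.
have bl : 0 <= b * L by rewrite mulr_ge0 ?L_ge0// ltW.
have Bbl : 0 <= B * b * L by rewrite -mulrA mulr_ge0// B_ge0.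
pose k := a * L + (2 * b * L + 3 * (B * b * L)).
have aL : 0 <= a * L by rewrite mulr_ge0 ?L_ge0// ltW.
have k0 : 0 <= k by rewrite /k; lra.
have tT0 : 0 <= (0 : R) <= T by rewrite lexx.
have d0 : 0 <= d by have [H _] := sol; have [_ _ _ _ /nle_ge0] := H 0 tT0.
have E0 : 0 <= E := c11_ge0 (sol_c11 tT0).
(* The excess is at most 2 B, so the three summands dominate its square, the slope of the square and
   the quadratic Taylor constant 1. *)
pose CB := 4 * B ^+ 2 + 4 * B + 1.
pose Cz := `|sg| * E + `|- sg| * `|c|.
pose CS := 2 * b * L * B + E.
pose C := (CB * E + CB * (Ev * Cz + CS + E * T) ^+ 2) * I (psi a).
have B0 := B_ge0.
have CB0 : 0 <= CB by rewrite /CB; have := sqr_ge0 B; lra.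
have Ip0 : 0 <= I (psi a) by apply: I_ge0 => x; rewrite ltW// psi_gt0.
have C0 : 0 <= C by rewrite /C; apply: mulr_ge0 => //; apply: addr_ge0; apply: mulr_ge0 => //; exact: sqr_ge0.
move=> tT; apply: (@gronwall _ (fun t => I (fun x => pospart (sg * (p t x - c)) ^+ 2 * psi a x)) T k (4 * B * d) C) => //.
- by rewrite mulr_ge0// mulr_ge0.
- by move=> s _; apply: I_ge0 => x; rewrite mulr_ge0 ?sqr_ge0// ltW// psi_gt0.
move=> {t tT} t h t0 h0 thT.
have tT : 0 <= t <= T by rewrite t0/= (le_trans _ thT)// lerDl.
have thT' : 0 <= t + h <= T by rewrite thT addr_ge0.
have hT : 0 <= h <= T by rewrite h0/= (le_trans _ thT)// lerDr.
have nK := nle_K b0.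
have [Hs step] := sol; have [cp pB npx br nr] := Hs t tT; have bPd := Pd_bm tT.
have [bp _ _] := cp.
have c11c : c11 (fun=> c) (fun=> 0) `|c|.
  split; [exact: bm_cst| |].
  - by split; [exact: measurable_cst|move=> x; rewrite normr0].
  - by move=> x h'; rewrite subrr mul0r subrr normr0 mulr_ge0// sqr_ge0.
pose z x := sg * p t x + (- sg) * c; pose zx x := sg * px t x + (- sg) * 0.
have zE s x : sg * (p s x - c) = sg * p s x + (- sg) * c by ring.
have cz : c11 z zx Cz := c11_lin sg (- sg) cp c11c.
pose S x := - (sg * (Pd t x * p t x)) + sg * r t x.
have bS : bm S CS.
  have b1 := bmN (bmM (bm_cst sg) (bmM bPd (conj bp.1 pB))).
  have := bmD b1 (bmM (bm_cst sg) br); rewrite nsg.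
  by congr bm; rewrite /CS; ring.
have zB x : `|z x| <= 2 * B.
  rewrite /z -zE normrM nsg mul1r; apply: le_trans (ler_normB _ _) _.
  by have := pB x; have := cB'; lra.
have ppB x : pospart (z x) <= 2 * B.
  by have [[? ->]|[? ->]] := ppP (z x); [exact: le_trans (ler_norm _) (zB x)|rewrite mulr_ge0].
pose z1 x := sg * p (t + h) x + (- sg) * c.
have cp1 := sol_c11 thT'.
have mz1 : meas z1 by have [b1 _ _] := c11_lin sg (- sg) cp1 c11c; exact: b1.1.
have mz := c11_lin sg (- sg) cp c11c.
have cppz : bm (fun x => pospart (z x)) (2 * B).
  split; first by apply: meas_pospart; have [[]] := cz.
  by move=> x; rewrite ger0_norm ?pospart_ge0.
have st x : `|z1 x - z x - h * (- (P t x * zx x) + S x)| <= E * h ^+ 2.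
  have -> : z1 x - z x - h * (- (P t x * zx x) + S x) =
    sg * (p (t + h) x - p t x - h * (- (P t x * px t x) - Pd t x * p t x + r t x)).
    by rewrite /z1 /z /zx /S; ring.
  by rewrite normrM nsg mul1r; exact: step.
have dpp u : is_derive u 1 (fun u => pospart u ^+ 2) (2 * pospart u).
  by apply: (@quad_is_derive _ _ _ _ 1) => h' _; rewrite mul1r; exact: pp2_quad.
have cdpp : continuous (fun u => 2 * pospart u : R).
  by move=> u; apply: cvgM; [exact: cvg_cst|exact: pospart_cont].
have := @transport_step _ a (P t) (Pd t) z zx z1 S (fun u => pospart u ^+ 2) (fun u => 2 * pospart u) L Ev Cz CS CB E h T
  a0 (P_c11 tT) (fun x => (P_bm tT).2 x) cz bS mz1 dpp cdpp (fun u => sqr_ge0 _) _ _ _ hT E0 st.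
have h1 x : pospart (z x) ^+ 2 <= CB.
  have : pospart (z x) ^+ 2 <= (2 * B) ^+ 2 by rewrite lerXn2r ?nnegrE ?pospart_ge0// mulr_ge0.
  by rewrite /CB exprMn; have := sqr_ge0 B; lra.
have h2 x : `|2 * pospart (z x)| <= CB.
  by rewrite ger0_norm ?mulr_ge0 ?pospart_ge0//; have := ppB x; have := sqr_ge0 B; rewrite /CB; lra.
have h3 u w : pospart w ^+ 2 <= pospart u ^+ 2 + 2 * pospart u * (w - u) + CB * (w - u) ^+ 2.
  have := pp2_quad u (w - u); rewrite subrKC => /(le_trans (ler_norm _)).
  have : 1 * (w - u) ^+ 2 <= CB * (w - u) ^+ 2.
    by rewrite ler_wpM2r ?sqr_ge0// /CB; have := sqr_ge0 B; lra.
  by rewrite mul1r; lra.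
move=> /(_ h1 h2 h3).
rewrite -/C.
have -> : (fun x => pospart (sg * (p (t + h) x - c)) ^+ 2 * psi a x) = (fun x => pospart (z1 x) ^+ 2 * psi a x).
  by apply/funext => x; rewrite zE.
have -> : (fun x => pospart (sg * (p t x - c)) ^+ 2 * psi a x) = (fun x => pospart (z x) ^+ 2 * psi a x).
  by apply/funext => x; rewrite zE.
set N := I (fun x => pospart (z x) ^+ 2 * psi a x).
move=> H; apply: le_trans H _; rewrite lerD2r lerD2l ler_wpM2l//.
rewrite /k mulrDl -addrA lerD2l.
pose Kp x := conv (K b) (fun y => pospart (z y)) x.
have bpp2 : bm (fun x => pospart (z x) ^+ 2) (2 * B * (2 * B)) by have := bmM cppz cppz; under eq_fun do rewrite -expr2.
pose K2 x := conv (K b) (fun y => pospart (z y) ^+ 2) x.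
have bK2 : bm K2 (2 * B * (2 * B)) by have := bm_conv nK bpp2; rewrite mulr1.
have pw x : pospart (z x) ^+ 2 * Pd t x + 2 * pospart (z x) * S x <=
   (2 * b * L + B * b * L) * pospart (z x) ^+ 2 + B * b * L * K2 x + 4 * B * `|r t x|.
  (* Writing [sg * p] as [z + sg * c] splits the source: the part with z is already quadratic in the
     excess, the part with c is only linear and needs the one-sided bound on [Pd]. *)
  have e1 : pospart (z x) ^+ 2 * Pd t x + 2 * pospart (z x) * S x =
     - (pospart (z x) ^+ 2 * Pd t x) + 2 * c * (pospart (z x) * - (sg * Pd t x)) + 2 * (sg * (pospart (z x) * r t x)).
    have pz : pospart (z x) * z x = pospart (z x) ^+ 2 by have [[? ->]|[? ->]] := ppP (z x); rewrite ?mul0r expr2 ?mulr0.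
    have sp : sg * p t x = z x + sg * c by rewrite /z; ring.
    have -> : S x = - (Pd t x * (sg * p t x)) + sg * r t x by rewrite /S; ring.
    rewrite sp; rewrite -pz; ring.
  rewrite e1; apply: lerD; last first.
    apply: le_trans (ler_norm _) _; rewrite !normrM nsg mul1r [`|2|]ger0_norm// mulrA.
    by rewrite ler_wpM2r// [`|pospart _|]ger0_norm ?pospart_ge0//; have := ppB x; lra.
  rewrite [(_ + B * b * L) * _]mulrDl -[leRHS]addrA; apply: lerD.
    rewrite -mulrN mulrC ler_wpM2r ?sqr_ge0//.
    by apply: le_trans (ler_norm _) _; rewrite normrN; exact: bPd.2.
  have [zp|zp] := ltP 0 (z x); last first.
    have -> : pospart (z x) = 0 by rewrite /pospart max_l.
    rewrite mul0r mulr0 expr0n /= mulr0 add0r mulr_ge0//.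
    by have := @convK_sqr _ b (fun y => pospart (z y)) _ x b0 cppz; apply: le_trans; exact: sqr_ge0.
  have dz := dPot_one_sided tT (x := x); rewrite zE in dz; have {}dz := dz zp.
  have eK : conv (K b) (fun y => pospart (sg * (p t y - c))) x = Kp x.
    by rewrite /Kp; congr conv; apply/funext => y; rewrite zE.
  rewrite eK in dz.
  have q1 : pospart (z x) * - (sg * Pd t x) <= pospart (z x) * (b * L * Kp x) by rewrite ler_wpM2l ?pospart_ge0.
  (* The product of the excess with its average is made quadratic by Young's and Jensen's
     inequalities. *)
  have q2 : 2 * (pospart (z x) * Kp x) <= pospart (z x) ^+ 2 + K2 x.
    have := @convK_sqr _ b (fun y => pospart (z y)) _ x b0 cppz; rewrite -/(K2 x) -/(Kp x).
    by have := sqr_ge0 (pospart (z x) - Kp x); rewrite sqrrB; lra.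
  have s0 : 0 <= pospart (z x) ^+ 2 + K2 x.
    apply: addr_ge0; first exact: sqr_ge0.
    by have := @convK_sqr _ b (fun y => pospart (z y)) _ x b0 cppz; apply: le_trans; exact: sqr_ge0.
  case/andP: cB => c0 cB1.
  have q3 : 2 * (pospart (z x) * - (sg * Pd t x)) <= b * L * (pospart (z x) ^+ 2 + K2 x).
    by have := ler_wpM2l bl q2; lra.
  have := ler_wpM2l c0 q3; have := ler_wpM2r (mulr_ge0 bl s0) cB1; lra.
have bw : bm (fun x => pospart (z x) ^+ 2 * Pd t x + 2 * pospart (z x) * S x) (2 * B * (2 * B) * (2 * b * L) + `|2| * (2 * B) * CS).
  by apply: bmD; apply: bmM => //; apply: bmM => //; exact: bm_cst.
have br' : bm (fun x => `|r t x|) E.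
  split; first by have := br.1; rewrite /meas => ?; mtac.
  by move=> x; rewrite normr_id; exact: br.2.
have i1 := integ_psiM a0 bpp2; have i2 := integ_psiM a0 bK2; have i3 := integ_psiM a0 br'.
apply: (@le_trans _ _ (I (fun x => (2 * b * L + B * b * L) * (pospart (z x) ^+ 2 * psi a x)
    + B * b * L * (K2 x * psi a x) + 4 * B * (`|r t x| * psi a x)))).
  apply: I_le; first exact: integ_psiM a0 bw.
    by apply: integD; [apply: integD|]; apply: integZ.
  move=> x; have := ler_wpM2r (ltW (psi_gt0 a x)) (pw x).
  by move=> /le_trans; apply; rewrite le_eqVlt; apply/orP; left; apply/eqP; ring.
rewrite !ID ?IZ//; [|exact: integZ|exact: integZ|by apply: integD; apply: integZ|exact: integZ].
rewrite -/N.
have adj : I (fun x => K2 x * psi a x) <= 2 * N.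
  apply: le_trans (convK_adjoint_psi a0 ab bpp2 (fun x => sqr_ge0 _)) _.
  have -> : b - a = b / 2 by rewrite /a; field.
  have -> : b / (b / 2) = 2 by field; rewrite gt_eqF.
  exact: lexx.
have ri : I (fun x => `|r t x| * psi a x) <= d.
  apply: nle_I; apply: (nle_le _ _ nr); first exact: integ_meas i3.
  move=> x; rewrite normrM normr_id ler_piMr// gtr0_norm ?psi_gt0//.
  rewrite invf_le1 ?psi_den_gt0//; have := expR_ge1Dx (a * x); have := expR_ge1Dx (- a * x).
  by lra.
have := ler_wpM2l Bbl adj.
have B4 : 0 <= 4 * B by lra.
have := ler_wpM2l B4 ri; lra.
Qed.

End max_principle.
End approximate_solution.
End maximum_principle.

(** * Almost decay of the weighted L^1 norm of the derivative of P *)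

Section approximate_decay.
Variable R : realType.
Implicit Types (f g : R -> R) (a b x y c e h u w t B L E M d T de : R).
Notation I := (@integralR R).
Notation K := (@exponential_pdf R).

Definition smooth_abs de u : R := Num.sqrt (u ^+ 2 + de ^+ 2).

Lemma smooth_abs_sqr de u : smooth_abs de u ^+ 2 = u ^+ 2 + de ^+ 2.
Proof. by rewrite sqr_sqrtr// addr_ge0 ?sqr_ge0. Qed.

Lemma smooth_abs_ge0 de u : 0 <= smooth_abs de u. Proof. exact: sqrtr_ge0. Qed.

Lemma smooth_abs_ge_abs de u : `|u| <= smooth_abs de u.
Proof. by rewrite -(@ler_pXn2r _ 2) ?nnegrE ?smooth_abs_ge0// smooth_abs_sqr real_normK ?num_real// lerDl sqr_ge0. Qed.

Lemma smooth_abs_ge_de de u : 0 <= de -> de <= smooth_abs de u.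
Proof. by move=> d0; rewrite -(@ler_pXn2r _ 2) ?nnegrE ?smooth_abs_ge0// smooth_abs_sqr lerDr sqr_ge0. Qed.

Lemma smooth_abs_gt0 de u : 0 < de -> 0 < smooth_abs de u.
Proof. by move=> d0; apply: lt_le_trans (smooth_abs_ge_de u (ltW d0)). Qed.

Lemma smooth_abs_le de u : 0 <= de -> smooth_abs de u <= `|u| + de.
Proof.
move=> d0; rewrite -(@ler_pXn2r _ 2) ?nnegrE ?smooth_abs_ge0 ?addr_ge0// smooth_abs_sqr.
by rewrite sqrrD real_normK ?num_real// addrAC lerDl mulrn_wge0// mulr_ge0.
Qed.

(** With s and s' the two values, the middle term is (s s' - u w - de^2) / s. The lower bound is
    Cauchy-Schwarz for the vectors (u, de) and (w, de); the upper one follows from 2 s s' <= s^2 +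
    s'^2 and s >= de. *)
Lemma smooth_abs_quad de u w : 0 < de ->
  0 <= smooth_abs de w - smooth_abs de u - u / smooth_abs de u * (w - u) <= de^-1 * (w - u) ^+ 2.
Proof.
move=> d0; have su := smooth_abs_gt0 u d0; have sw := smooth_abs_gt0 w d0.
have eu := smooth_abs_sqr de u; have ew := smooth_abs_sqr de w.
have du := smooth_abs_ge_de u (ltW d0).
set s := smooth_abs de u in su eu du *; set s' := smooth_abs de w in sw ew *.
have -> : s' - s - u / s * (w - u) = (s * s' - u * w - de ^+ 2) / s.
  have -> : s * s' - u * w - de ^+ 2 = s * s' - s ^+ 2 - u * (w - u) by rewrite eu; ring.
  by field; rewrite gt_eqF.
have cs : u * w + de ^+ 2 <= s * s'.
  have [neg|pos] := leP (u * w + de ^+ 2) 0; first by apply: le_trans neg _; rewrite mulr_ge0// ltW.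
  rewrite -(@ler_pXn2r _ 2) ?nnegrE ?(ltW pos) ?mulr_ge0 ?(ltW su) ?(ltW sw)//.
  rewrite exprMn eu ew -subr_ge0 (_ : _ - _ = (de * (u - w)) ^+ 2) ?sqr_ge0//; ring.
apply/andP; split; first by apply: divr_ge0; [lra|exact: ltW].
rewrite ler_pdivrMr//.
have am : 2 * (s * s') <= s ^+ 2 + s' ^+ 2 by have := sqr_ge0 (s - s'); rewrite sqrrB; lra.
apply: (@le_trans _ _ ((w - u) ^+ 2)); first by have := sqr_ge0 (w - u); rewrite sqrrB; lra.
rewrite mulrAC ler_peMl ?sqr_ge0// mulrC ler_pdivlMr// mul1r//.
Qed.

Lemma is_derive_smooth_abs de u : 0 < de -> is_derive u 1 (smooth_abs de) (u / smooth_abs de u).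
Proof.
move=> d0; apply: (@quad_is_derive _ _ _ _ de^-1) => h _.
have := smooth_abs_quad u (u + h) d0; rewrite [u + h - u]addrAC subrr add0r => /andP[q1 q2].
by rewrite ger0_norm.
Qed.

Lemma cont_dhb de : 0 < de -> continuous (fun u => u / smooth_abs de u).
Proof.
move=> d0 u; apply: cvgM; first exact: cvg_id.
by apply: cvgV; [rewrite gt_eqF// smooth_abs_gt0|exact: is_derive_continuous (is_derive_smooth_abs u d0)].
Qed.

Section approximate_solution.
Variables (T b : R) (V dV : R -> R) (B L E M d : R) (p px r : R -> R -> R).
Hypotheses (T0 : 0 <= T) (b0 : 0 < b) (mV : meas V) (mdV : meas dV) (lV : loc11 V dV B L)
  (sol : approx_sol T b V B E M d p px r).

Local Notation P := (Pot b V p).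
Local Notation Pd := (dPot b V p).
Local Notation v := (fun t x => V (p t x)).
Local Notation Ev := (L + L * E + L * (3 * E) ^+ 2).
Local Notation D0 := (L * E + 2 * b * L * B + E).
Local Notation E1 := (L * E + L * (D0 + E * T) ^+ 2).
Local Notation Ad := (fun t x => P t x - V (p t x) + dV (p t x) * p t x).
Local Notation r2 := (fun t x => conv (K b) (fun y => dV (p t y) * r t y) x - dV (p t x) * r t x).
(* [Pd] is transported by [P] with source [S], and [Pdx] is its space
   derivative. *)
Local Notation S := (fun t x => - Pd t x ^+ 2 + b * (- conv (K b) (fun y => Ad t y * Pd t y) x + Ad t x * Pd t x) + b * r2 t x).
Local Notation Pdx := (fun t x => b * Pd t x + (- b) * (dV (p t x) * px t x)).

Lemma Pd_c11 t : 0 <= t <= T -> c11 (Pd t) (Pdx t) (`|b| * Ev + `|- b| * Ev).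
Proof.
move=> tT; have := c11_lin b (- b) (P_c11 b0 mV mdV lV sol tT) (v_c11 mV mdV lV sol tT).
by congr c11; apply/funext => x; rewrite /dPot; ring.
Qed.

Lemma dVp_bm t : 0 <= t <= T -> bm (fun x => dV (p t x)) L.
Proof.
move=> tT; have [[mp _] _ _] := sol_c11 sol tT; split; first exact: (measurableT_comp mdV mp).
by move=> x; have [_ V1 _ _ _] := lV; apply: V1; exact: (sol_bound sol).
Qed.

Lemma p_bm t : 0 <= t <= T -> bm (p t) B.
Proof. by move=> tT; have [[mp _] _ _] := sol_c11 sol tT; split=> // x; exact: (sol_bound sol). Qed.

Lemma Ad_bm t : 0 <= t <= T -> bm (Ad t) (2 * L + L * B).
Proof.
move=> tT; have := bmD (bmB (P_bm b0 mV mdV lV sol tT) (v_bm mV mdV lV sol tT)) (bmM (dVp_bm tT) (p_bm tT)).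
by congr bm; ring.
Qed.

Lemma r_bm t : 0 <= t <= T -> bm (r t) E.
Proof. by move=> tT; have [H _] := sol; have [] := H t tT. Qed.

Lemma r2_bm t : 0 <= t <= T -> bm (r2 t) (2 * L * E).
Proof.
move=> tT; have b1 := bmM (dVp_bm tT) (r_bm tT).
have := bmB (bm_conv (nle_K b0) b1) b1; congr bm; ring.
Qed.

Lemma r2_nle t : 0 <= t <= T -> nle (r2 t) (2 * L * d).
Proof.
move=> tT; have [H _] := sol; have [_ _ _ br nr] := H t tT.
have n1 := nleM (dVp_bm tT).1 (dVp_bm tT).2 nr; have b1 := bmM (dVp_bm tT) br.
have := nleB (conv_nle (nle_K b0) b1 n1) n1; congr nle; ring.
Qed.

Lemma S_bm t : 0 <= t <= T -> bm (S t) ((2 * b * L) ^+ 2 + b * (2 * ((2 * L + L * B) * (2 * b * L))) + b * (2 * L * E)).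
Proof.
move=> tT; have bPd := Pd_bm b0 mV mdV lV sol tT; have bA := Ad_bm tT.
have bAP := bmM bA bPd.
have b1 : bm (fun x => - Pd t x ^+ 2) ((2 * b * L) ^+ 2).
  by have := bmN (bmM bPd bPd); rewrite -expr2; congr bm; apply/funext => x; rewrite expr2.
have b2 := bmM (bm_cst b) (bmD (bmN (bm_conv (nle_K b0) bAP)) bAP).
have b3 := bmM (bm_cst b) (r2_bm tT).
have := bmD (bmD b1 b2) b3; rewrite (gtr0_norm b0); congr bm; ring.
Qed.

(** [Pd] is b times average minus identity, applied to V(p). Hence only V(p) needs an Euler step;
    its error is [th], of size E1 h^2, and [Pd] inherits it twice, once averaged and once
    directly. *)
Lemma Pd_step t h x : 0 <= t -> 0 <= h -> t + h <= T ->
  `|Pd (t + h) x - Pd t x - h * (- (P t x * Pdx t x) + S t x)| <= 2 * b * E1 * h ^+ 2.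
Proof.
move=> t0 h0 thT.
have tT : 0 <= t <= T by rewrite t0/= (le_trans _ thT)// lerDl.
have thT' : 0 <= t + h <= T by rewrite thT addr_ge0.
have hT : h <= T by rewrite (le_trans _ thT)// lerDr.
have nK := nle_K b0; have [Hs step] := sol; have [cp pB npx br nr] := Hs t tT.
have bPd := Pd_bm b0 mV mdV lV sol tT; have bP := P_bm b0 mV mdV lV sol tT.
have bv := v_bm mV mdV lV sol tT; have bv1 := v_bm mV mdV lV sol thT'.
have bA := Ad_bm tT; have bdV := dVp_bm tT; have bp := p_bm tT.
have [_ bpx _] := cp; have [_ _ _ _ V4] := lV.
have L0 := L_ge0 T0 lV sol; have B0 := B_ge0 T0 sol; have E0 := c11_ge0 cp.
have D00 : 0 <= D0 by rewrite !addr_ge0// !mulr_ge0// ltW.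
(* The formal time derivative of V(p), without the residual. *)
pose f y := - (P t y * (dV (p t y) * px t y)) - dV (p t y) * p t y * Pd t y.
pose th y := V (p (t + h) y) - V (p t y) - h * (f y + dV (p t y) * r t y).
have bvx := bmM bdV bpx.
have bf := bmB (bmN (bmM bP bvx)) (bmM (bmM bdV bp) bPd).
have bdr := bmM bdV br.
have bth := bmB (bmB bv1 bv) (bmM (bm_cst h) (bmD bf bdr)).
have thE y : `|th y| <= E1 * h ^+ 2.
  pose D := - (P t y * px t y) - Pd t y * p t y + r t y.
  pose ro := p (t + h) y - p t y - h * D.
  have roE : `|ro| <= E * h ^+ 2 by exact: step.
  have -> : th y = (V (p (t + h) y) - V (p t y) - dV (p t y) * (p (t + h) y - p t y)) + dV (p t y) * ro.
    by rewrite /th /f /ro /D; ring.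
  have DB : `|D| <= D0 := (bmD (bmB (bmN (bmM bP bpx)) (bmM bPd bp)) br).2 y.
  have e1 : `|dV (p t y) * ro| <= L * (E * h ^+ 2) by rewrite normrM ler_pM//; exact: bdV.2.
  have e2 : `|p (t + h) y - p t y| <= h * (D0 + E * T).
    have -> : p (t + h) y - p t y = h * D + ro by rewrite /ro; ring.
    apply: le_trans (ler_normD _ _) _; rewrite [h * (_ + E * T)]mulrDr; apply: lerD.
      by rewrite normrM ger0_norm// ler_wpM2l.
    apply: le_trans roE _; rewrite expr2 mulrCA ler_wpM2l// ler_wpM2l//.
  have e3 : (p (t + h) y - p t y) ^+ 2 <= (h * (D0 + E * T)) ^+ 2.
    rewrite -[leLHS]real_normK ?num_real// lerXn2r ?nnegrE//; exact: le_trans e2.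
  have e4 := V4 _ _ (pB y) (sol_bound sol y thT').
  have e5 := ler_wpM2l L0 e3.
  rewrite exprMn in e5.
  apply: le_trans (ler_normD _ _) _; rewrite mulrDl; lra.
(* The identity f = - (g - b^-1 g') - Ad Pd holds pointwise, so the resolvent identity for g removes
   [px] from the average of f. This is how the quantity [Ad] of the structural condition appears. *)
pose g y := P t y * Pd t y; pose dg y := Pd t y * Pd t y + P t y * Pdx t y.
have cg := c11_mul (P_c11 b0 mV mdV lV sol tT) (Pd_c11 tT).
have res := conv_K_resolvent x b0 cg.
have bAP := bmM bA bPd.
have Kf : conv (K b) f x = - (P t x * Pd t x) - conv (K b) (fun y => Ad t y * Pd t y) x.
  have lin (u w : R) : - u - w = -1 * u + -1 * w by ring.
  rewrite -{1}res lin.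
  have [bg bdg _] := cg; have bg' := bmB bg (bmM (bm_cst b^-1) bdg).
  rewrite -(convZ (-1) x nK bg') -(convZ (-1) x nK bAP).
  rewrite -(convD x nK (bmM (bm_cst (-1)) bg') (bmM (bm_cst (-1)) bAP)).
  congr conv; apply/funext => y; rewrite /f /dPot; field; rewrite gt_eqF//.
have KV : conv (K b) (fun y => V (p (t + h) y) - V (p t y)) x =
   h * (conv (K b) f x + conv (K b) (fun y => dV (p t y) * r t y) x) + conv (K b) th x.
  rewrite -(convD x nK bf bdr) -(convZ h x nK (bmD bf bdr)).
  rewrite -(convD x nK (bmM (bm_cst h) (bmD bf bdr)) bth).
  by congr conv; apply/funext => y; rewrite /th; ring.
have PV : P (t + h) x - P t x = conv (K b) (fun y => V (p (t + h) y) - V (p t y)) x.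
  by rewrite (convB x nK bv1 bv).
have -> : Pd (t + h) x - Pd t x - h * (- (P t x * Pdx t x) + S t x) = b * (conv (K b) th x - th x).
  have -> : Pd (t + h) x - Pd t x = b * ((P (t + h) x - P t x) - (V (p (t + h) x) - V (p t x))) by rewrite /dPot; ring.
  rewrite PV KV Kf /th /f /dPot; ring.
have Kth : `|conv (K b) th x| <= E1 * h ^+ 2.
  have := conv_bound x nK (conj bth.1 thE); by rewrite mulr1.
rewrite normrM gtr0_norm//.
have -> : 2 * b * E1 * h ^+ 2 = b * (E1 * h ^+ 2 + E1 * h ^+ 2) by ring.
by rewrite ler_wpM2l ?(ltW b0)//; apply: le_trans (ler_normB _ _) _; exact: lerD.
Qed.

(* [- Pd ^+ 2] cancels against the transport term, and the [Ad] terms are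
   nonpositive up to moving the weight across the kernel, which costs O(a). *)
Lemma tv_decay a de t : 0 < a -> a <= b / 2 -> 0 < de ->
  (forall t x, 0 <= t <= T -> Ad t x <= 0) -> 0 <= t <= T ->
  I (fun x => smooth_abs de (Pd t x) * psi a x) <=
  expR (a * (L + 2 * (2 * L + L * B)) * t) *
  (I (fun x => smooth_abs de (Pd 0 x) * psi a x) +
   ((2 * b * L + b * (2 * L + L * B)) * de * I (psi a) + 2 * b * L * d) * t).
Proof.
set CA := 2 * L + L * B.
move=> a0 ab2 de0 An tT.
have ab : a < b by apply: le_lt_trans ab2 _; move: b0 => ?; rewrite ltr_pdivrMr//; lra.
have L0 := L_ge0 T0 lV sol; have B0 := B_ge0 T0 sol.
have tT0 : 0 <= (0 : R) <= T by rewrite lexx.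
have E0 : 0 <= E := c11_ge0 (sol_c11 sol tT0).
have d0 : 0 <= d by have [H _] := sol; have [_ _ _ _ /nle_ge0] := H 0 tT0.
have LB : 0 <= L * B by rewrite mulr_ge0.
have bL : 0 <= b * L by rewrite mulr_ge0// ltW.
have CA0 : 0 <= CA by rewrite /CA; lra.
have bCA : 0 <= b * CA by rewrite mulr_ge0// ltW.
have D00 : 0 <= D0 by rewrite !addr_ge0// !mulr_ge0// ltW.
have E10 : 0 <= E1 by rewrite addr_ge0// mulr_ge0// sqr_ge0.
have Ip0 : 0 <= I (psi a) by apply: I_ge0 => x; rewrite ltW// psi_gt0.
(* It dominates the smoothed modulus of [Pd], its slope, which is at most 1, and its quadratic
   Taylor constant 1 / de. *)
pose CB := 2 * b * L + de + 1 + de^-1.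
have di0 : 0 < de^-1 by rewrite invr_gt0.
have CB0 : 0 <= CB by rewrite /CB; lra.
pose Cz := `|b| * Ev + `|- b| * Ev.
pose CS := (2 * b * L) ^+ 2 + b * (2 * (CA * (2 * b * L))) + b * (2 * L * E).
pose E2 := 2 * b * E1.
have E20 : 0 <= E2 by rewrite /E2 !mulr_ge0// ltW.
pose C := (CB * E2 + CB * (Ev * Cz + CS + E2 * T) ^+ 2) * I (psi a).
have C0 : 0 <= C by rewrite /C; apply: mulr_ge0 => //; apply: addr_ge0; apply: mulr_ge0 => //; exact: sqr_ge0.
have k0 : 0 <= a * (L + 2 * CA) by rewrite mulr_ge0 ?(ltW a0)//; lra.
apply: (@gronwall _ (fun t => I (fun x => smooth_abs de (Pd t x) * psi a x)) T _ _ C) => //.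
- apply: addr_ge0; last by rewrite !mulr_ge0// ltW.
  by rewrite !mulr_ge0// ?(ltW de0)//; lra.
- by move=> s _; apply: I_ge0 => x; rewrite mulr_ge0 ?smooth_abs_ge0// ltW// psi_gt0.
move=> {t tT} t h t0 h0 thT.
have tT : 0 <= t <= T by rewrite t0/= (le_trans _ thT)// lerDl.
have thT' : 0 <= t + h <= T by rewrite thT addr_ge0.
have hT : 0 <= h <= T by rewrite h0/= (le_trans _ thT)// lerDr.
have bPd := Pd_bm b0 mV mdV lV sol tT; have bPd1 := Pd_bm b0 mV mdV lV sol thT'.
have := @transport_step _ a (P t) (Pd t) (Pd t) (Pdx t) (Pd (t + h)) (S t) (smooth_abs de) (fun u => u / smooth_abs de u) L Ev Cz CS CB E2 h T
  a0 (P_c11 b0 mV mdV lV sol tT) (fun x => (P_bm b0 mV mdV lV sol tT).2 x) (Pd_c11 tT) (S_bm tT) bPd1.1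
  (fun u => is_derive_smooth_abs u de0) (cont_dhb de0) (fun u => smooth_abs_ge0 de u) _ _ _ hT E20 (fun x => Pd_step x t0 h0 thT).
have hbB x : smooth_abs de (Pd t x) <= CB.
  by apply: le_trans (smooth_abs_le _ (ltW de0)) _; have := bPd.2 x; rewrite /CB; lra.
have dhb1 u : `|u / smooth_abs de u| <= 1.
  by rewrite normrM normfV [`|smooth_abs _ _|]gtr0_norm ?smooth_abs_gt0// ler_pdivrMr ?smooth_abs_gt0// mul1r smooth_abs_ge_abs.
have h2 x : `|Pd t x / smooth_abs de (Pd t x)| <= CB by apply: le_trans (dhb1 _) _; rewrite /CB; lra.
have h3 u w : smooth_abs de w <= smooth_abs de u + u / smooth_abs de u * (w - u) + CB * (w - u) ^+ 2.
  have /andP[_ q] := smooth_abs_quad u w de0.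
  have : de^-1 * (w - u) ^+ 2 <= CB * (w - u) ^+ 2 by rewrite ler_wpM2r ?sqr_ge0// /CB; lra.
  lra.
move=> /(_ hbB h2 h3); rewrite -/C.
set N := I (fun x => smooth_abs de (Pd t x) * psi a x).
move=> H; apply: le_trans H _; rewrite lerD2r lerD2l ler_wpM2l//.
rewrite mulrDr mulrDl -addrA lerD2l.
have bA := Ad_bm tT; have nK := nle_K b0.
pose q x := - Ad t x * `|Pd t x|.
have babs : bm (fun x => `|Pd t x|) (2 * b * L).
  split; first by have := bPd.1; rewrite /meas => ?; mtac.
  by move=> x; rewrite normr_id; exact: bPd.2.
have bq : bm q (CA * (2 * b * L)) := bmM (bmN bA) babs.
have q0 x : 0 <= q x by rewrite mulr_ge0// oppr_ge0 An.
have bKq : bm (conv (K b) q) (CA * (2 * b * L)) by have := bm_conv nK bq; rewrite mulr1.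
have br2 := r2_bm tT.
have br2a : bm (fun x => `|r2 t x|) (2 * L * E).
  split; first by have := br2.1; rewrite /meas => ?; mtac.
  by move=> x; rewrite normr_id; exact: br2.2.
have pw x : smooth_abs de (Pd t x) * Pd t x + Pd t x / smooth_abs de (Pd t x) * S t x <=
   (2 * b * L + b * CA) * de + (b * conv (K b) q x - b * q x) + b * `|r2 t x|.
  set y := Pd t x; set s := smooth_abs de y; set A := Ad t x.
  have s0 : 0 < s := smooth_abs_gt0 y de0; have sd : de <= s := smooth_abs_ge_de y (ltW de0).
  have s2 : s ^+ 2 = y ^+ 2 + de ^+ 2 := smooth_abs_sqr de y.
  have A0 : A <= 0 := An t x tT.
  have yB : `|y| <= 2 * b * L := bPd.2 x.
  have CAA : - A <= CA by have := bA.2 x; rewrite -normrN; apply: le_trans; exact: ler_norm.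
  pose G := - conv (K b) (fun y => Ad t y * Pd t y) x.
  (* As [Ad] is nonpositive, |Ad Pd| is exactly [q]; the averaged term is thus controlled by the
     average of the same [q] that appears below with a minus sign. *)
  have GE : `|G| <= conv (K b) q x.
    rewrite normrN; apply: le_trans (le_normr_Rintegral measurableT (conv_integ x nK (bmM bA bPd))) _.
    have iKq := conv_integ x nK bq.
    rewrite le_eqVlt; apply/orP; left; apply/eqP; apply: eqI => z.
    rewrite normrM [`|K _ _|]ger0_norm ?K_ge0// normrM /q.
    by rewrite [`|Ad _ _|]ler0_norm ?An.
  (* Because s^2 = y^2 + de^2, the transport contribution s y and the term - y^3 / s leave only y
     de^2 / s, which is O(de). *)
  have -> : s * y + y / s * S t x = y * de ^+ 2 / s + b * (y / s * G) + b * (A * (y ^+ 2 / s)) + b * (y / s * r2 t x).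
    have -> : s * y = y * (s ^+ 2) / s by field; rewrite gt_eqF.
    rewrite s2 /A /G -/y; field; rewrite gt_eqF//.
  have t1 : y * de ^+ 2 / s <= 2 * b * L * de.
    rewrite -mulrA; apply: le_trans (ler_norm _) _; rewrite normrM; apply: ler_pM => //.
    rewrite ger0_norm; last by rewrite divr_ge0 ?sqr_ge0// ltW.
    by rewrite ler_pdivrMr// expr2 ler_wpM2l// ltW.
  have one u : y / s * u <= `|u|.
    by apply: le_trans (ler_norm _) _; rewrite normrM ler_piMl//; exact: dhb1.
  have t2 : b * (y / s * G) <= b * conv (K b) q x.
    by rewrite ler_wpM2l ?(ltW b0)//; apply: le_trans (one G) _.
  have t4 : b * (y / s * r2 t x) <= b * `|r2 t x| by rewrite ler_wpM2l ?(ltW b0).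
  have t3 : b * (A * (y ^+ 2 / s)) <= - (b * q x) + b * CA * de.
    have yy : `|y| - de <= y ^+ 2 / s.
      rewrite ler_pdivlMr// -[y ^+ 2](real_normK (num_real y)).
      have h1 : `|y| <= s := smooth_abs_ge_abs de y; have := normr_ge0 y; move: s2 de0.
      by rewrite -[y ^+ 2](real_normK (num_real y)) => ? ? ?; nra.
    have : b * (- A * (`|y| - de)) <= b * (- A * (y ^+ 2 / s)).
      by rewrite ler_wpM2l ?(ltW b0)// ler_wpM2l// oppr_ge0.
    have : b * (- A * de) <= b * (CA * de) by rewrite ler_wpM2l ?(ltW b0)// ler_wpM2r// ltW.
    by rewrite /q -/A -/y; lra.
  lra.
have bw : bm (fun x => smooth_abs de (Pd t x) * Pd t x + Pd t x / smooth_abs de (Pd t x) * S t x) (CB * (2 * b * L) + 1 * CS).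
  have mhb : meas (smooth_abs de) by apply: continuous_meas => u; exact: is_derive_continuous (is_derive_smooth_abs u de0).
  have mdhb := continuous_meas (cont_dhb de0).
  apply: bmD; apply: bmM => //; last exact: S_bm.
    by split=> [|x]; [exact: (measurableT_comp mhb bPd.1)|rewrite ger0_norm ?smooth_abs_ge0].
  by split=> [|x]; [exact: (measurableT_comp mdhb bPd.1)|exact: dhb1].
have ip := integ_psi a0; have iq := integ_psiM a0 bq; have iKq := integ_psiM a0 bKq; have ir := integ_psiM a0 br2a.
apply: (@le_trans _ _ (I (fun x => (2 * b * L + b * CA) * de * psi a x + (b * (conv (K b) q x * psi a x) - b * (q x * psi a x))
    + b * (`|r2 t x| * psi a x)))).
  apply: I_le; first exact: integ_psiM a0 bw.
    by apply: integD; [apply: integD; [exact: integZ|apply: integB; exact: integZ]|exact: integZ].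
  move=> x; have := ler_wpM2r (ltW (psi_gt0 a x)) (pw x).
  by move=> /le_trans; apply; rewrite le_eqVlt; apply/orP; left; apply/eqP; ring.
have j1 := integZ ((2 * b * L + b * CA) * de) ip; have j2 := integZ b ir.
have j3 := integZ b iKq; have j4 := integZ b iq; have j34 := integB j3 j4.
rewrite (ID (integD j1 j34) j2) (ID j1 j34) (IB j3 j4) !IZ//.
have adj := convK_adjoint_psi a0 ab bq q0.
have Iq0 : 0 <= I (fun x => q x * psi a x).
  by apply: I_ge0 => x; rewrite mulr_ge0// ltW// psi_gt0.
have bma : 0 < b - a by rewrite subr_gt0.
have ri : I (fun x => `|r2 t x| * psi a x) <= 2 * L * d.
  apply: nle_I; apply: (nle_le _ _ (r2_nle tT)); first exact: integ_meas ir.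
  move=> x; rewrite normrM normr_id ler_piMr// gtr0_norm ?psi_gt0//.
  rewrite invf_le1 ?psi_den_gt0//; have := expR_ge1Dx (a * x); have := expR_ge1Dx (- a * x).
  by lra.
have qN : I (fun x => q x * psi a x) <= CA * N.
  rewrite /N -IZ; last first.
    have mhb : meas (smooth_abs de) by apply: continuous_meas => u; exact: is_derive_continuous (is_derive_smooth_abs u de0).
    apply: (integ_psiM a0 (C := CB)); split=> [|x]; first exact: (measurableT_comp mhb bPd.1).
    by rewrite ger0_norm ?smooth_abs_ge0.
  apply: I_le => //.
    apply: integZ; have mhb : meas (smooth_abs de) by apply: continuous_meas => u; exact: is_derive_continuous (is_derive_smooth_abs u de0).
    apply: (integ_psiM a0 (C := CB)); split=> [|x]; first exact: (measurableT_comp mhb bPd.1).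
    by rewrite ger0_norm ?smooth_abs_ge0.
  move=> x; rewrite mulrA ler_wpM2r ?(ltW (psi_gt0 _ _))// /q; apply: ler_pM => //.
  - by rewrite oppr_ge0 An.
  - by have := bA.2 x; rewrite -normrN; apply: le_trans; exact: ler_norm.
  - exact: smooth_abs_ge_abs.
have key : b * I (fun x => conv (K b) q x * psi a x) - b * I (fun x => q x * psi a x) <= 2 * a * (CA * N).
  apply: (@le_trans _ _ (2 * a * I (fun x => q x * psi a x))); last first.
    by rewrite ler_wpM2l// mulr_ge0// ltW.
  have e1 : b / (b - a) = 1 + a / (b - a) by field; rewrite gt_eqF.
  (* Here a <= b / 2 is used. The excess of b / (b - a) over 1 is the whole cost of carrying the
     weight across the kernel. *)
  have e2 : a / (b - a) <= 2 * a / b.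
    rewrite ler_pdivrMr// mulrAC ler_pdivlMr//.
    have : 0 <= a * (b / 2 - a) by rewrite mulr_ge0 ?subr_ge0// ltW.
    lra.
  have e3 := ler_wpM2r Iq0 e2.
  have e4 : b * I (fun x => conv (K b) q x * psi a x) <= b * (b / (b - a) * I (fun x => q x * psi a x)) by rewrite ler_wpM2l// ltW.
  rewrite e1 in e4.
  have e5 := ler_wpM2l (ltW b0) e3.
  have e6 : b * (2 * a / b * I (fun x => q x * psi a x)) = 2 * a * I (fun x => q x * psi a x) by field; rewrite gt_eqF.
  by rewrite e6 in e5; lra.
have := ler_wpM2l (ltW b0) ri; lra.
Qed.

End approximate_solution.
End approximate_decay.

(** * Mollification of solutions *)

Section commutator.
Variable R : realType.
Implicit Types (f g k : R -> R) (a b x y c e h u w t B C D L E M d T : R).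
Notation I := (@integralR R).
Notation K := (@exponential_pdf R).

Lemma conv_sup k f c D x : meas k -> (forall z, `|k z| <= c) -> nle f D -> `|conv k f x| <= c * D.
Proof.
move=> mk kc nf; apply: nle_normI; apply: nleM => //.
by have := nle_shift x nf; congr (nle _ _); apply/funext => z; rewrite addrC.
Qed.

(** Mean zero of [k] allows f(x) to be subtracted inside; the L^1 bound on increments then leaves
    the first moment of [k]. *)
Lemma conv0_nle k f C B D T : nle k C -> I k = 0 -> nle (fun z => k z * z) D ->
  bm f B -> tvle f T -> nle (conv k f) (T * D).
Proof.
move=> nk k0 nD bf [_ tv]; have mk := nk.1; have mf := bf.1.
have T0 : 0 <= T by have /nle_ge0 := tv 1; rewrite normr1 mulr1.
apply: (@minkowski_nle _ (fun p => k p.2 * (f (p.1 + p.2) - f p.1)) (fun z => T * (k z * z))).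
- apply: measurable_funM; first by apply: (measurableT_comp mk); mtac.
  by apply: measurable_funB; [apply: (measurableT_comp mf)|apply: (measurableT_comp mf)]; mtac.
- exact: meas_conv.
- move=> x.
  have bB := bmB (bm_shift 0 bf) (bm_cst (f x)).
  have ik : integ (fun z => k z * (f (x + z) - f x)).
    by have := conv_integ x nk bB; apply: eq_integrable => // z _ /=; rewrite addr0.
  have -> : conv k f x = I (fun z => k z * (f (x + z) - f x)).
    rewrite -[LHS]subr0 -(mul0r (f x)) -k0 -(conv_cst (f x) x nk).
    by rewrite -(convB _ nk bf (bm_cst (f x))); exact: eqI.
  exact: I_normE.
- move=> z /=; have := nleZ (k z) (tv z) => -[_] /le_trans; apply.
  by rewrite lee_fin !normrM mulrCA ger0_norm.
- by have := nleZ T nD; rewrite ger0_norm.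
Qed.

Lemma derive_bound_lip g dg C D x z : c11 g dg C -> (forall y, `|dg y| <= D) ->
  `|g (x + z) - g x| <= D * `|z|.
Proof.
move=> cg dD; have cgc := c11_cont cg.
have key u w : u <= w -> `|g w - g u| <= D * (w - u).
  move=> uw; have [c _ ->] := MVT_segment uw (fun x _ => c11_derive x cg) (continuous_subspaceT cgc).
  by rewrite normrM [`|w - u|]ger0_norm ?subr_ge0// ler_wpM2r// subr_ge0.
have [z0|z0] := leP 0 z.
  by have := key x (x + z); rewrite lerDl => /(_ z0); rewrite [x + z - x]addrAC subrr add0r (ger0_norm z0).
have := key (x + z) x; rewrite gerDl ltW// => /(_ isT).
by rewrite distrC opprD addrA subrr sub0r (ltr0_norm z0).
Qed.

Lemma cvg_le_eps (A C D : R) : 0 <= D -> (forall e, 0 < e -> A <= C + D * e) -> A <= C.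
Proof.
move=> D0 H; apply/ler_addgt0Pr => u u0.
have D1 : 0 < D + 1 by lra.
apply: le_trans (H (u / (D + 1)) (divr_gt0 u0 D1)) _; rewrite lerD2l.
by rewrite mulrA ler_pdivrMr// mulrC ler_wpM2l ?(ltW u0)//; lra.
Qed.

Lemma cvg_le_near (A C D e1 : R) : 0 <= D -> 0 < e1 ->
  (forall e, 0 < e -> e <= e1 -> A <= C + D * e) -> A <= C.
Proof.
move=> D0 e10 H; apply: (@cvg_le_eps _ _ D) => // e e0.
have [le1|lt1] := leP e e1; first exact: H.
apply: le_trans (H e1 e10 (lexx _)) _.
by rewrite lerD2l ler_wpM2l// ltW.
Qed.

Lemma K_le b z : 0 < b -> `|K b z| <= b.
Proof.
move=> b0; rewrite ger0_norm ?K_ge0//; have [z0|z0] := leP 0 z; last first.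
  by rewrite lt0_exponential_pdf// ltW.
rewrite exponential_pdfE// ler_piMr ?(ltW b0)// -expR0 ler_expR.
by rewrite mulNr oppr_le0 mulr_ge0// ltW.
Qed.

Lemma conv_K_derive b f df B : 0 < b -> c11 f df B ->
  c11 (conv (K b) f) (fun x => b * (conv (K b) f x - f x)) B.
Proof.
move=> b0 cf; have := c11_conv (nle_K b0) cf; rewrite mulr1.
have [bv bvx _] := cf; have nK := nle_K b0.
congr (c11 _ _ _); apply/funext => x.
have := conv_K_resolvent x b0 cf.
rewrite (convB x nK bv (bmM (bm_cst b^-1) bvx)) (convZ b^-1 x nK bvx) => <-.
by field; rewrite gt_eqF.
Qed.

Lemma ler_dist_close (u v u' v' C D : R) : `|u - u'| <= C -> `|v - v'| <= C -> `|v' - u'| <= D ->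
  `|v - u| <= D + 2 * C.
Proof. by rewrite !ler_norml => /andP[? ?] /andP[? ?] /andP[? ?]; apply/andP; split; lra. Qed.

(** For smooth f the derivative b (K f - f) is bounded by 2 b B. In general f is mollified first;
    bounded variation makes the resulting uniform error in K f of order e. *)
Lemma conv_K_lip b f B M x z : 0 < b -> bm f B -> tvle f M ->
  `|conv (K b) f (x + z) - conv (K b) f x| <= 2 * b * B * `|z|.
Proof.
move=> b0 bf tf; have nK := nle_K b0.
have M0 : 0 <= M by have := tf.2 1 => /nle_ge0; rewrite normr1 mulr1.
apply: (@cvg_le_eps _ _ (2 * (b * (M * 18)))) => [|e e0].
  by rewrite !mulr_ge0// ltW.
have [D cD] := c11_moll e0 bf.
have bm' := bm_conv (nle_rho e0) bf; rewrite mulr1 in bm'.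
have cK := conv_K_derive b0 cD.
have close y : `|conv (K b) f y - conv (K b) (conv (rho e) f) y| <= b * (M * (18 * e)).
  rewrite distrC -(convB y nK bm' bf).
  apply: conv_sup => //; first exact: nK.1. by move=> ?; exact: K_le.
  exact: conv_nle_dist (nle_rho e0) (I_rho e0) (nle_rho1 e0) bf tf.
have lip : `|conv (K b) (conv (rho e) f) (x + z) - conv (K b) (conv (rho e) f) x| <= 2 * b * B * `|z|.
  apply: (derive_bound_lip x z cK) => y.
  rewrite normrM gtr0_norm//.
  have := (bmB (bm_conv nK bm') bm').2 y; rewrite mulr1 => h.
  by have := ler_wpM2l (ltW b0) h; lra.
apply: le_trans (ler_dist_close (close x) (close (x + z)) lip) _; lra.
Qed.

Section single_time.
Variables (b : R) (V dV : R -> R) (B L M : R) (f : R -> R).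
Hypotheses (b0 : 0 < b) (mV : meas V) (mdV : meas dV) (lV : loc11 V dV B L)
  (bf : bm f B) (tf : tvle f M).

Local Notation vf := (fun x => V (f x)).
Local Notation W := (conv (K b) (fun x => V (f x))).

Let B0 : 0 <= B. Proof. by apply: le_trans (bf.2 0). Qed.
Let L0 : 0 <= L. Proof. by have [V0 _ _ _ _] := lV; apply: le_trans (V0 0 _); rewrite ?normr0. Qed.
Let M0 : 0 <= M. Proof. by have := tf.2 1 => /nle_ge0; rewrite normr1 mulr1. Qed.
Let nK := nle_K b0.

Lemma vf_bm : bm vf L.
Proof.
split; first exact: (measurableT_comp mV bf.1).
by move=> x; have [V0 _ _ _ _] := lV; apply: V0; exact: bf.2.
Qed.

Lemma nle_V g g' D : bm g B -> bm g' B -> nle (fun x => g x - g' x) D ->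
  nle (fun x => V (g x) - V (g' x)) (L * D).
Proof.
move=> bg bh n; have := nleZ L n; rewrite ger0_norm//; apply: nle_le.
  by apply: measurable_funB; [exact: (measurableT_comp mV bg.1)|exact: (measurableT_comp mV bh.1)].
move=> x; rewrite normrM ger0_norm//; have [_ _ V2 _ _] := lV.
by apply: V2; [exact: bh.2|exact: bg.2].
Qed.

Lemma tvle_vf : tvle vf (L * M).
Proof.
split; first exact: vf_bm.1.
by move=> z; rewrite -mulrA; apply: nle_V => //; [exact: bm_shift|exact: tf.2].
Qed.

Lemma W_bm : bm W L.
Proof. by have := bm_conv nK vf_bm; rewrite mulr1. Qed.

Lemma W_lip x z : `|W (x + z) - W x| <= 2 * b * L * `|z|.
Proof. exact: conv_K_lip vf_bm tvle_vf. Qed.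

Lemma W_tvle : tvle W (L * M).
Proof. by have := tvle_conv nK vf_bm tvle_vf; rewrite mulr1. Qed.

Lemma flux_tvle : tvle (fun x => f x * W x) (B * (L * M) + L * M).
Proof.
split; first exact: (bmM bf W_bm).1.
move=> z.
have -> : (fun x => f (x + z) * W (x + z) - f x * W x) =
  (fun x => f (x + z) * (W (x + z) - W x) + W x * (f (x + z) - f x)).
  by apply/funext => x; ring.
rewrite mulrDl -!mulrA; apply: nleD; apply: nleM.
- exact: (bm_shift z bf).1. - exact: (bm_shift z bf).2.
- by rewrite mulrA; exact: W_tvle.2.
- exact: W_bm.1. - exact: W_bm.2. - exact: tf.2.
Qed.

Section moll.
Variable e : R.
Hypothesis e0 : 0 < e.
Local Notation p := (conv (rho e) f).
Local Notation px := (fun x => - conv (drho e) f x).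
Local Notation P := (conv (K b) (fun y => V (conv (rho e) f y))).
Local Notation Pd := (fun x => b * (P x - V (p x))).

Lemma moll_bm : bm p B.
Proof. by have := bm_conv (nle_rho e0) bf; rewrite mulr1. Qed.

Lemma moll_dist : nle (fun x => p x - f x) (M * (18 * e)).
Proof. exact: conv_nle_dist (nle_rho e0) (I_rho e0) (nle_rho1 e0) bf tf. Qed.

Lemma moll_px : nle px M.
Proof.
have [D cD] := c11_moll e0 bf.
by have := tvle_conv (nle_rho e0) bf tf; rewrite mulr1 => /(nle_deriv cD).
Qed.

Lemma vp_bm : bm (fun x => V (p x)) L.
Proof.
split; first exact: (measurableT_comp mV moll_bm.1).
by move=> x; have [V0 _ _ _ _] := lV; apply: V0; exact: moll_bm.2.
Qed.

(** Uniform, although V(p) - V(f) is small only in L^1: the kernel is bounded by b. *)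
Lemma PW_dist x : `|P x - W x| <= b * (L * (M * (18 * e))).
Proof.
rewrite -(convB x nK vp_bm vf_bm); apply: conv_sup; first exact: nK.1.
  by move=> z; exact: K_le.
exact: nle_V moll_bm bf moll_dist.
Qed.

(** The two correlations commute, so the resolvent identity can be applied to the mollification of
    V(f), which is smooth whereas V(f) is not. *)
Lemma conv_drho_W x : conv (drho e) W x = b * (conv (rho e) vf x - conv (K b) (conv (rho e) vf) x).
Proof.
have nd := nle_drho e0; have bvf := vf_bm.
have [D cD] := c11_moll e0 bvf.
rewrite (conv_comm x nd nK bvf).
have [bg bdg _] := cD; have bdr := bm_conv nd bvf.
have := conv_K_resolvent x b0 cD.
rewrite (convB x nK bg (bmM (bm_cst b^-1) bdg)) (convZ b^-1 x nK bdg).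
have -> : conv (K b) (fun y => - conv (drho e) vf y) x = - conv (K b) (conv (drho e) vf) x.
  by rewrite -mulN1r -(convZ (-1) x nK bdr); congr conv; apply/funext => y; rewrite mulN1r.
by move=> <-; move: (conv _ _ x) (conv _ _ x) => u v; field; rewrite gt_eqF.
Qed.

Lemma V_moll_dist : nle (fun x => V (p x) - conv (rho e) vf x) (2 * (L * M * (18 * e))).
Proof.
have n1 := nle_V moll_bm bf moll_dist.
have n2 := conv_nle_dist (nle_rho e0) (I_rho e0) (nle_rho1 e0) vf_bm tvle_vf.
have := nleB n1 n2; congr nle; last by ring.
by apply/funext => x; ring.
Qed.

(* Products of increments of [f] and [W] are O(e) in L^1 because [f] has bounded
   variation and [W] is Lipschitz. *)
Lemma commutator_nle :
  nle (fun x => conv (drho e) (fun y => f y * W y) x + P x * px x + Pd x * p x)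
    ((2 * b * L * M * 54 + b * (2 * L * M * 18 + B * (2 * (2 * L * M * 18))) + b * L * M * 18 * M) * e).
Proof.
have nd := nle_drho e0; have [mW WL] := W_bm; have [mf fB] := bf.
(* The residual is T1 + T2 + T3. T1 is the commutator proper, a double increment; T2 compares
   [Pd * p] with minus f times the derivative kernel applied to W; T3 replaces P by W in the
   transport term. *)
pose T1 x := I (fun z => drho e z * ((W (x + z) - W x) * (f (x + z) - f x))).
pose v2 := conv (rho e) vf.
pose T2 x := b * ((P x - V (p x)) * (p x - f x) + f x * (conv (K b) (fun y => V (p y) - v2 y) x - (V (p x) - v2 x))).
pose T3 x := (P x - W x) * px x.
have bv2 : bm v2 L by have := bm_conv (nle_rho e0) vf_bm; rewrite mulr1.
have bpb := moll_bm; have bvp := vp_bm; have bvf := vf_bm.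
have bvpv2 := bmB bvp bv2.
have bP : bm P L by have := bm_conv nK bvp; rewrite mulr1.
have nT1 : nle T1 (2 * b * L * M * (54 * e)).
  apply: (@minkowski_nle _ (fun p => drho e p.2 * ((W (p.1 + p.2) - W p.1) * (f (p.1 + p.2) - f p.1)))
     (fun z => 2 * b * L * M * (drho e z * z ^+ 2))).
  - apply: measurable_funM; first by apply: (measurableT_comp (meas_drho e)); mtac.
    by apply: measurable_funM; apply: measurable_funB;
      [apply: (measurableT_comp mW)|apply: (measurableT_comp mW)|apply: (measurableT_comp mf)|apply: (measurableT_comp mf)]; mtac.
  - apply: (meas_param (G := fun p : R * R => drho e p.2 * ((W (p.1 + p.2) - W p.1) * (f (p.1 + p.2) - f p.1)))).
    apply: measurable_funM; first by apply: (measurableT_comp (meas_drho e)); mtac.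
    by apply: measurable_funM; apply: measurable_funB;
      [apply: (measurableT_comp mW)|apply: (measurableT_comp mW)|apply: (measurableT_comp mf)|apply: (measurableT_comp mf)]; mtac.
  - move=> x; apply: I_normE.
    have bd := bmM (bmB (bm_shift 0 W_bm) (bm_cst (W x))) (bmB (bm_shift 0 bf) (bm_cst (f x))).
    by have := conv_integ x nd bd; apply: eq_integrable => // z _ /=; rewrite !addr0.
  - move=> z; have mWd : meas (fun x => W (x + z) - W x) by apply: measurable_funB => //; exact: meas_shift.
    have [_ H] := nleZ (drho e z) (nleM mWd (fun x => W_lip x z) (tf.2 z)).
    apply: le_trans H _; rewrite lee_fin !normrM.
    rewrite (ger0_norm (ltW b0)) (ger0_norm L0) (ger0_norm M0) [`|2|]ger0_norm// ?normr_id; lra.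
  - have := nleZ (2 * b * L * M) (nle_drho2 e0); rewrite ger0_norm//.
    by rewrite !mulr_ge0// ltW.
have nvv : nle (fun x => V (p x) - v2 x) (2 * (L * M * (18 * e))) := V_moll_dist.
have nT2 : nle T2 (b * (2 * L * (M * (18 * e)) + B * (2 * (2 * (L * M * (18 * e)))))).
  have := nleZ b (nleD (nleM (bmB bP bvp).1 (bmB bP bvp).2 moll_dist)
     (nleM mf fB (nleB (conv_nle nK bvpv2 nvv) nvv))).
  by rewrite gtr0_norm//; congr nle; ring.
have nT3 : nle T3 (b * (L * (M * (18 * e))) * M).
  by apply: nleM PW_dist moll_px; exact: (bmB bP W_bm).1.
have := nleD (nleD nT1 nT2) nT3; congr nle; last by ring.
apply/funext => x.
have nd1 : conv (drho e) W x = b * (v2 x - conv (K b) v2 x) := conv_drho_W x.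
have nT1x : T1 x = conv (drho e) (fun y => f y * W y) x - W x * conv (drho e) f x - f x * conv (drho e) W x.
  have i1 := conv_integ x nd (bmM bf W_bm); have i2 := conv_integ x nd bf; have i3 := conv_integ x nd W_bm.
  have i4 := nle_integ nd.
  (* Expanding the product of increments yields one extra term, which vanishes because [drho] has
     mean zero. *)
  have -> : T1 x = conv (drho e) (fun y => f y * W y) x - W x * conv (drho e) f x - f x * conv (drho e) W x + f x * W x * I (drho e).
    have j2 := integZ (W x) i2; have j3 := integZ (f x) i3; have j4 := integZ (f x * W x) i4.
    rewrite /conv -(IZ (W x) i2) -(IZ (f x) i3) -(IZ (f x * W x) i4).
    rewrite -(IB i1 j2) -(IB (integB i1 j2) j3) -(ID (integB (integB i1 j2) j3) j4).
    by apply: eqI => z; ring.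
  by rewrite (I_drho e0) mulr0 addr0.
rewrite nT1x nd1 /T2 /T3 (convB x nK bvp bv2); ring.
Qed.

End moll.
End single_time.
End commutator.

(** * Lipschitz dependence on time in L^1 *)

Section time_regularity.
Variable R : realType.
Implicit Types (f g k : R -> R) (a b x y c e h u w s t B C D L E M d T tau : R).
Notation mu := (@lebesgue_measure R).
Notation I := (@integralR R).
Notation K := (@exponential_pdf R).

Lemma nle_indicM a b C : a <= b -> 0 <= C -> nle (fun x => C * \1_`[a, b]%classic x) (C * (b - a)).
Proof.
move=> ab C0.
have nb : nle (\1_`[a, b]%classic : R -> R) ((b - a) * 1).
  apply: nle_supp => // [|x|x xy]; first exact: meas_indic.
    by rewrite indicE; case: (_ \in _); rewrite ?normr1 ?normr0.
  by rewrite indicE memNset//; apply/negP.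
by have := nleZ C nb; rewrite ger0_norm// mulr1.
Qed.

Section evolution.
Variables (T b : R) (V dV : R -> R) (B L M : R) (q : R -> R -> R).
Hypotheses (T0 : 0 <= T) (b0 : 0 < b) (mV : meas V) (mdV : meas dV) (lV : loc11 V dV B L)
  (mq : measurable_fun setT (fun z : R * R => q z.1 z.2)) (qB : forall t x, `|q t x| <= B)
  (tq : forall t, 0 <= t <= T -> tvle (q t) M)
  (weak : forall e s t x, 0 < e -> 0 <= s -> s <= t -> t <= T ->
    conv (rho e) (q t) x - conv (rho e) (q s) x =
    I (fun tau => conv (drho e) (fun y => q tau y * Pot b V q tau y) x * \1_`[s, t]%classic tau)).

Local Notation W := (Pot b V q).
Local Notation fl := (fun t x => q t x * Pot b V q t x).
Local Notation G := (B * (L * M) + L * M).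
Local Notation G1 := (G * 18).
Local Notation G2 := (B * (L * G1) + L * G1).

Let B0 : 0 <= B. Proof. exact: le_trans (qB 0 0). Qed.
Let L0 : 0 <= L. Proof. by have [V0 _ _ _ _] := lV; apply: le_trans (V0 0 _); rewrite ?normr0. Qed.
Let M0 : 0 <= M. Proof. by have := (tq (t := 0)); rewrite lexx T0 => /(_ isT) [_] /(_ 1)/nle_ge0; rewrite normr1 mulr1. Qed.

Lemma q_bm t : bm (q t) B.
Proof.
split=> //.
have m2 : measurable_fun setT (fun x : R => (t, x)) by apply/measurable_fun_pair; mtac.
exact: (measurableT_comp mq m2).
Qed.

Lemma flux_meas : measurable_fun setT (fun z : R * R => fl z.1 z.2).
Proof.
apply: measurable_funM => //.
apply: (@meas_conv2 _ (K b) (fun z => V (q z.1 z.2))); first exact: (nle_K b0).1.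
exact: (measurableT_comp mV mq).
Qed.

Lemma W_bm' t : bm (W t) L. Proof. exact: (W_bm b0 mV lV (q_bm t)). Qed.

Lemma fl_bm t : bm (fl t) (B * L).
Proof. exact: bmM (q_bm t) (W_bm' t). Qed.

Lemma G_ge0 : 0 <= G. Proof. by rewrite addr_ge0 ?mulr_ge0. Qed.

(** The hypothesis [weak] is the equation tested with a translate of the mollifier and integrated in
    time. The flux has variation at most G, so [conv0_nle] bounds its correlation with [drho] by 18
    G for every e, and Fatou removes the mollification. *)
Lemma time_lip s t : 0 <= s -> s <= t -> t <= T -> nle (fun x => q t x - q s x) (G1 * (t - s)).
Proof.
move=> s0 st tT; have G0 := G_ge0.
have n0 (n : nat) : 0 < n.+1%:R^-1 :> R by rewrite invr_gt0.
have key e : 0 < e -> nle (fun x => conv (rho e) (q t) x - conv (rho e) (q s) x) (G1 * (t - s)).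
  move=> e0; have nd := nle_drho e0.
  pose F (p : R * R) := conv (drho e) (fl p.2) p.1 * \1_`[s, t]%classic p.2.
  have mF : measurable_fun setT F.
    have m1 := @meas_conv2 _ (drho e) (fun z => fl z.1 z.2) (meas_drho e) flux_meas.
    have msw : measurable_fun setT (fun p : R * R => (p.2, p.1)) by apply/measurable_fun_pair; mtac.
    apply: measurable_funM; first exact: (measurableT_comp m1 msw).
    by apply: (measurableT_comp (@meas_indic R `[s, t]%classic (measurable_itv _))); mtac.
  apply: (@minkowski_nle _ F (fun tau => G1 * \1_`[s, t]%classic tau)) => //.
  - apply: measurable_funB.
      exact: (bm_conv (nle_rho e0) (q_bm t)).1.
    exact: (bm_conv (nle_rho e0) (q_bm s)).1.
  - move=> x; rewrite (weak x e0 s0 st tT).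
    apply: (@I_normE _ (fun tau => conv (drho e) (fl tau) x * \1_`[s, t]%classic tau)).
    have := nle_indicM st (C := B * L * (6 * e^-1)).
    have c0 : 0 <= B * L * (6 * e^-1) by rewrite !mulr_ge0// invr_ge0 ltW.
    move=> /(_ c0)/nle_integ; apply: integ_le.
      have m2 : measurable_fun setT (fun tau : R => (x, tau)) by apply/measurable_fun_pair; mtac.
      exact: (measurableT_comp mF m2).
    move=> tau; rewrite [leLHS]normrM [leRHS]normrM ler_wpM2r//.
    exact: le_trans (conv_bound x nd (fl_bm tau)) (ler_norm _).
  - move=> tau; rewrite /F/= indicE.
    have [|nin] := boolP (tau \in `[s, t]%classic); last first.
      under eq_integral do rewrite mulr0 normr0.
      by rewrite integral0 lee_fin.
    rewrite inE/= in_itv/= => /andP[s1 t1].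
    have tT1 : 0 <= tau <= T by rewrite (le_trans s0 s1) (le_trans t1 tT).
    have [_ H] := conv0_nle nd (I_drho e0) (nle_drho1 e0) (fl_bm tau) (flux_tvle b0 mV lV (q_bm tau) (tq tT1)).
    under eq_integral do rewrite mulr1.
    by apply: le_trans H _; rewrite mulr1 lee_fin ler_norm.
  - by apply: nle_indicM => //; rewrite mulr_ge0.
apply: (@fatou_nle _ (fun n x => conv (rho n.+1%:R^-1) (q t) x - conv (rho n.+1%:R^-1) (q s) x)).
- by move=> n; exact: key.
- by apply: measurable_funB; [exact: (q_bm t).1|exact: (q_bm s).1].
- have h1 := ae_moll (q_bm t); have h2 := ae_moll (q_bm s).
  apply: (@filterS2 _ _ (ae_filter_ringOfSetsType mu) _ _ _ _ h1 h2) => x c1 c2.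
  exact: cvgB.
Qed.

(** Lipschitz dependence of the flux on time is what makes the Euler error of the mollified equation
    quadratic in the step. *)
Lemma flux_lip s t : 0 <= s -> s <= t -> t <= T -> nle (fun x => fl t x - fl s x) (G2 * (t - s)).
Proof.
move=> s0 st tT; have nq := time_lip s0 st tT.
have nv := nle_V mV lV (q_bm t) (q_bm t) (q_bm s) nq.
have bt := vf_bm mV lV (q_bm t); have bs := vf_bm mV lV (q_bm s).
have nW : nle (fun x => W t x - W s x) (L * (G1 * (t - s))).
  have := conv_nle (nle_K b0) (bmB bt bs) nv; rewrite mulr1.
  by congr nle; apply/funext => x; rewrite (convB x (nle_K b0) bt bs).
have n1 := nleM (q_bm t).1 (q_bm t).2 nW; have n2 := nleM (W_bm' s).1 (W_bm' s).2 nq.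
have := nleD n1 n2; congr nle; last by ring.
by apply/funext => x; ring.
Qed.

Local Notation Cr := (2 * b * L * M * 54 + b * (2 * L * M * 18 + B * (2 * (2 * L * M * 18))) + b * L * M * 18 * M).

(** The residual is defined so that the equation for p becomes exact; its L^1 bound is the
    commutator estimate. The constant E blows up as e tends to 0, but it enters only the Euler
    error. *)
Lemma moll_approx_sol e : 0 < e -> exists E,
  let p t x := conv (rho e) (q t) x in
  let px t x := - conv (drho e) (q t) x in
  let r t x := conv (drho e) (fl t) x + Pot b V p t x * px t x + dPot b V p t x * p t x in
  approx_sol T b V B E M (Cr * e) p px r.
Proof.
move=> e0; have nd := nle_drho e0; have [D cD] := c11_moll_unif e0 B0.
pose p t x := conv (rho e) (q t) x; pose px t x := - conv (drho e) (q t) x.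
pose r t x := conv (drho e) (fl t) x + Pot b V p t x * px t x + dPot b V p t x * p t x.
pose E1 := B * L * (6 * e^-1) + L * (B * (6 * e^-1)) + 2 * b * L * B.
pose E2 := e^-1 ^+ 2 * G2.
have ei : 0 <= e^-1 by rewrite invr_ge0 ltW.
have D0 : 0 <= D := c11_ge0 (cD _ (q_bm 0)).
have E10 : 0 <= E1 by rewrite /E1 !addr_ge0// !mulr_ge0// ltW.
have G20 : 0 <= G2 by rewrite addr_ge0// !mulr_ge0// G_ge0.
have E20 : 0 <= E2 by rewrite /E2 mulr_ge0// exprn_ge0.
exists (D + E1 + E2).
split.
- move=> t tT; split.
  + by apply: c11_le (cD _ (q_bm t)); lra.
  + by move=> x; have := (moll_bm (q_bm t) e0).2 x.
  + have H := moll_px (q_bm t) (tq tT) e0. exact: H.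
  + have bp := moll_bm (q_bm t) e0; have bvp := vp_bm mV lV (q_bm t) e0.
    have bP : bm (Pot b V p t) L by have := bm_conv (nle_K b0) bvp; rewrite mulr1.
    have bpx := bmN (bm_conv nd (q_bm t)).
    have b1 := bmD (bmD (bm_conv nd (fl_bm t)) (bmM bP bpx)) (bmM (bmM (bm_cst b) (bmB bP bvp)) bp).
    split; first exact: b1.1.
    move=> x; apply: le_trans (b1.2 x) _; rewrite gtr0_norm//.
    have -> : b * (L + L) * B = 2 * b * L * B by ring.
    by rewrite -/E1; lra.
  + have H := commutator_nle b0 mV lV (q_bm t) (tq tT) e0. exact: H.
move=> t h x t0 h0 thT.
have tth : t <= t + h by rewrite lerDl.
(* By the choice of [r] only the mollified flux remains, so the Euler error measures its variation
   over [t, t + h]. *)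
have -> : p (t + h) x - p t x - h * (- (Pot b V p t x * px t x) - dPot b V p t x * p t x + r t x) =
  p (t + h) x - p t x - h * conv (drho e) (fl t) x by rewrite /r; ring.
rewrite /p (weak x e0 t0 tth thT).
have nb : nle (\1_`[t, t + h]%classic : R -> R) h.
  have := nle_indicM tth ler01; rewrite mul1r [t + h - t]addrAC subrr add0r.
  by congr nle; apply/funext => z; rewrite mul1r.
have Ih : I (\1_`[t, t + h]%classic : R -> R) = h.
  have cc : continuous ((fun=> 1) : R -> R) by exact: cst_continuous.
  have dd (y : R) : is_derive y 1 (fun y : R => y) 1 by exact: is_derive_id.
  have /= H := FTCab tth dd cc.
  have e1 : t + h - t = h by ring.
  by rewrite -[RHS]e1 -H; apply: eqI => z; rewrite mul1r.
have mind := @meas_indic R `[t, t + h]%classic (measurable_itv _).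
have mF : meas (fun tau => conv (drho e) (fl tau) x).
  have m1 := @meas_conv2 _ (drho e) (fun z => fl z.1 z.2) (meas_drho e) flux_meas.
  have m2 : measurable_fun setT (fun tau : R => (tau, x)) by apply/measurable_fun_pair; mtac.
  exact: (measurableT_comp m1 m2).
have i1 : integ (fun tau => conv (drho e) (fl tau) x * \1_`[t, t + h]%classic tau).
  by apply: nle_integ (nleM mF (fun tau => conv_bound x nd (fl_bm tau)) nb).
have i2 := integZ (conv (drho e) (fl t) x) (nle_integ nb).
rewrite -{2}Ih mulrC -(IZ _ (nle_integ nb)) -(IB i1 i2).
apply: (@le_trans _ _ (E2 * h * h)); last first.
  by rewrite -mulrA -expr2 ler_wpM2r ?sqr_ge0//; lra.
apply: nle_normI.
have bound tau : `|(conv (drho e) (fl tau) x - conv (drho e) (fl t) x) * \1_`[t, t + h]%classic tau| <= `|E2 * h * \1_`[t, t + h]%classic tau|.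
  rewrite indicE; have [|_] := boolP (tau \in `[t, t + h]%classic); last by rewrite !mulr0.
  rewrite inE/= in_itv/= !mulr1 => /andP[s1 t1].
  rewrite [leRHS]ger0_norm ?mulr_ge0//.
  rewrite -(convB x nd (fl_bm tau) (fl_bm t)).
  have := conv_sup x (meas_drho e) (fun z => drho_le z e0) (flux_lip t0 s1 (le_trans t1 thT)).
  move=> /le_trans; apply; rewrite /E2 -mulrA ler_wpM2l ?exprn_ge0// ler_wpM2l//.
  by rewrite lerBlDl.
have := nleZ (E2 * h) nb; rewrite ger0_norm ?mulr_ge0//; apply: nle_le.
- exact: (measurable_funB (measurable_funM mF mind) (measurable_funM (measurable_cst _) mind)).
- by move=> tau; rewrite -mulrBl; exact: bound.
Qed.

End evolution.
End time_regularity.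

(** * Removing the mollification, the smoothing of the modulus and the weight *)

Section passage_to_the_limit.
Variable R : realType.
Implicit Types (f g k : R -> R) (a b x y c e h u w s t B C D L E M d T tau : R).
Notation mu := (@lebesgue_measure R).
Notation I := (@integralR R).

Lemma nle0_ae f : meas f -> {ae mu, forall x, f x = 0} -> nle f 0.
Proof.
move=> mf f0; split => //.
rewrite (@ge0_ae_eq_integral _ _ R mu setT _ (cst 0%E))//.
- by rewrite integral_cst// mul0e.
- exact: measNE.
- apply: (@filterS _ _ (ae_filter_ringOfSetsType mu) _ _ _ f0) => x -> _.
  by rewrite normr0.
Qed.

Lemma ae_I0 f : meas f -> (forall x, 0 <= f x) -> integ f -> I f <= 0 -> {ae mu, forall x, f x = 0}.
Proof.
move=> mf f0 iF If.
have n0 : (\int[mu]_x `|f x|%:E = 0)%E.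
  apply/eqP; rewrite eq_le; apply/andP; split; last by apply: integral_ge0 => x _; rewrite lee_fin.
  by have [_ H] := ge0_nle f0 iF; apply: le_trans H _; rewrite lee_fin.
have /(_ n0) := (@ae_eq_integral_abs _ _ R mu setT measurableT (EFin \o f) (measE mf)).1.
by apply: (@filterS _ _ (ae_filter_ringOfSetsType mu)) => x /(_ Logic.I)[].
Qed.

(** Averaging upgrades an almost everywhere barrier to a barrier at every point: the excess is null
    in L^1, so its average against a bounded kernel is zero. *)
Lemma conv_pospart_le k f C B sg c x : (forall z, 0 <= k z) -> (forall z, `|k z| <= C) -> nle k 1 -> I k = 1 ->
  bm f B -> nle (fun y => pospart (sg * (f y - c))) 0 -> sg * (conv k f x - c) <= 0.
Proof.
move=> k0 kC nk k1 bf np.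
have bd := bmM (bm_cst sg) (bmB bf (bm_cst c)).
have -> : sg * (conv k f x - c) = conv k (fun y => sg * (f y - c)) x.
  rewrite (convZ sg x nk (bmB bf (bm_cst c))) (convB x nk bf (bm_cst c)).
  by rewrite (conv_cst c x nk) k1 mul1r.
have bp : bm (fun y => pospart (sg * (f y - c))) (`|sg| * (B + `|c|)).
  split; first exact: np.1.
  move=> y; rewrite ger0_norm ?pospart_ge0//; apply: le_trans _ (bd.2 y).
  by have [[? ->]|[? ->]] := ppP (sg * (f y - c)); [exact: ler_norm|].
have le_pospart y : sg * (f y - c) <= pospart (sg * (f y - c)).
  by have [[? ->]|[? ->]] := ppP (sg * (f y - c)).
apply: le_trans (conv_le x k0 nk bd bp le_pospart) _.
have := conv_sup x nk.1 kC np; rewrite mulr0; apply: le_trans; exact: ler_norm.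
Qed.

Lemma psi_le_half a x : psi a x <= 2^-1.
Proof.
rewrite lef_pV2 ?posrE ?psi_den_gt0//.
by have := expR_ge1Dx (a * x); have := expR_ge1Dx (- a * x); lra.
Qed.

Lemma psi_ge a r x : 0 <= a -> `|x| <= r -> (expR (a * r) + expR (- a * r))^-1 <= psi a x.
Proof.
move=> a0 xr; rewrite lef_pV2 ?posrE ?psi_den_gt0//.
have r0 : 0 <= r by apply: le_trans xr.
suff mono u w : 0 <= u -> u <= w -> expR (a * u) + expR (- a * u) <= expR (a * w) + expR (- a * w).
  have -> : expR (a * x) + expR (- a * x) = expR (a * `|x|) + expR (- a * `|x|).
    have [x0|x0] := leP 0 x; first by rewrite ger0_norm.
    by rewrite ltr0_norm// !mulrN mulNr opprK addrC.
  exact: mono.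
move=> u0 uw.
have -> : - a * w = - (a * w) by ring.
have -> : - a * u = - (a * u) by ring.
rewrite !expRN.
set X := expR (a * u); set Y := expR (a * w).
have X1 : 1 <= X by rewrite -expR0 ler_expR mulr_ge0.
have XY : X <= Y by rewrite ler_expR ler_wpM2l.
have X0 : 0 < X by lra. have Y0 : 0 < Y by lra.
rewrite -subr_ge0.
(* Factorised so that monotonicity of u + 1 / u on [1, +oo) is visible. *)
have -> : Y + Y^-1 - (X + X^-1) = (Y - X) * (X * Y - 1) / (X * Y) by field; rewrite ?gt_eqF.
apply: divr_ge0; last by rewrite mulr_ge0// ltW.
by apply: mulr_ge0; [lra|nra].
Qed.

Section evolution.
Variables (T b : R) (V dV : R -> R) (B L M m Mx N0 : R) (q : R -> R -> R).
Hypotheses (T0 : 0 <= T) (b0 : 0 < b) (mV : meas V) (mdV : meas dV) (lV : loc11 V dV B L)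
  (mq : measurable_fun setT (fun z : R * R => q z.1 z.2)) (qB : forall t x, `|q t x| <= B)
  (tq : forall t, 0 <= t <= T -> tvle (q t) M)
  (weak : forall e s t x, 0 < e -> 0 <= s -> s <= t -> t <= T ->
    conv (rho e) (q t) x - conv (rho e) (q s) x =
    I (fun tau => conv (drho e) (fun y => q tau y * Pot b V q tau y) x * \1_`[s, t]%classic tau))
  (m0 : 0 <= m) (mM : m <= Mx) (MB : Mx <= B)
  (Vmono : forall u w, `|u| <= B -> `|w| <= B -> u <= w -> V w <= V u)
  (cond : forall u, m <= u <= Mx -> V m - V u + dV u * u <= 0)
  (q0lo : nle (fun x => pospart (-1 * (q 0 x - m))) 0)
  (q0hi : nle (fun x => pospart (1 * (q 0 x - Mx))) 0)
  (tW0 : tvle (Pot b V q 0) N0).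

Local Notation W := (Pot b V q).
Local Notation Cr := (2 * b * L * M * 54 + b * (2 * L * M * 18 + B * (2 * (2 * L * M * 18))) + b * L * M * 18 * M).

Let B0 : 0 <= B. Proof. exact: le_trans (qB 0 0). Qed.
Let L0 : 0 <= L. Proof. by have [V0 _ _ _ _] := lV; apply: le_trans (V0 0 _); rewrite ?normr0. Qed.
Let M0 : 0 <= M. Proof. by have := (tq (t := 0)); rewrite lexx T0 => /(_ isT) [_] /(_ 1)/nle_ge0; rewrite normr1 mulr1. Qed.
Let qbm t : bm (q t) B. Proof. exact: q_bm mq qB t. Qed.
Let tT0 : 0 <= (0 : R) <= T. Proof. by rewrite lexx. Qed.

(** The mollified solution starts without excess, so [max_principle] bounds its weighted squared
    excess by the residual, which is O(e). Dominated convergence gives zero for q, and positivity of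
    the weight gives the claim. *)
Lemma bound_preserved sg c t : sg = 1 \/ sg = -1 -> 0 <= c <= B -> 0 <= t <= T ->
  nle (fun x => pospart (sg * (q 0 x - c))) 0 -> nle (fun x => pospart (sg * (q t x - c))) 0.
Proof.
move=> sg1 cB tT n0.
have Cr0 : 0 <= Cr.
  have x1 : 0 <= b * L * M by rewrite !mulr_ge0// ltW.
  have x2 := mulr_ge0 x1 B0; have x3 := mulr_ge0 x1 M0; have x4 : 0 <= L * M by rewrite mulr_ge0.
  by lra.
pose a := b / 2; have a0 : 0 < a by rewrite divr_gt0.
have mpp f : meas f -> meas (fun x => pospart (sg * (f x - c))).
  move=> mf; apply: meas_pospart; apply: measurable_funM; first exact: measurable_cst.
  by apply: measurable_funB => //; exact: measurable_cst.
have nsg : `|sg| = 1 by case: sg1 => ->; rewrite ?normrN normr1.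
have ppB f : bm f B -> bm (fun x => pospart (sg * (f x - c)) ^+ 2) ((2 * B) ^+ 2).
  move=> bf; split; first by apply: measurable_funX; apply: mpp; exact: bf.1.
  move=> x; rewrite ger0_norm ?sqr_ge0// lerXn2r ?nnegrE ?pospart_ge0 ?mulr_ge0//.
  have h1 : `|sg * (f x - c)| <= 2 * B.
    rewrite normrM nsg mul1r; apply: le_trans (ler_normB _ _) _.
    by have := bf.2 x; case/andP: cB => c0 c1; rewrite [`|c|]ger0_norm//; lra.
  by have [[? ->]|[? ->]] := ppP (sg * (f x - c)); [exact: le_trans (ler_norm _) h1|rewrite mulr_ge0].
pose k := b / 2 * L + (2 * b * L + 3 * (B * b * L)).
have step e : 0 < e -> I (fun x => pospart (sg * (conv (rho e) (q t) x - c)) ^+ 2 * psi a x) <=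
    expR (k * t) * (4 * B * (Cr * e) * t).
  move=> e0; have [E sol] := moll_approx_sol T0 b0 mV lV mq qB tq weak e0.
  have := max_principle T0 b0 mV mdV lV sol sg1 cB Vmono tT.
  rewrite -/a -/k.
  rewrite (_ : I (fun x => pospart (sg * (conv (rho e) (q 0) x - c)) ^+ 2 * psi a x) = 0) ?add0r//.
  rewrite (_ : (fun _ => _) = (fun=> 0)) /integralR ?Rintegral_cst ?mul0r//.
  apply/funext => x.
  have h := conv_pospart_le x (fun z => rho_ge0 z e0) (fun z => rho_le z e0) (nle_rho e0) (I_rho e0) (qbm 0) n0.
  by rewrite /pospart max_l// expr0n mul0r.
have mqt := (qbm t).1.
have cvg1 : I (fun x => pospart (sg * (conv (rho n.+1%:R^-1) (q t) x - c)) ^+ 2 * psi a x) @[n --> \oo] -->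
    I (fun x => pospart (sg * (q t x - c)) ^+ 2 * psi a x).
  apply: (@I_cvg _ _ _ (fun x => (2 * B) ^+ 2 * psi a x)).
  - move=> n; have n0' : 0 < n.+1%:R^-1 :> R by rewrite invr_gt0.
    exact: integ_meas (integ_psiM a0 (ppB _ (moll_bm (qbm t) n0'))).
  - exact: integ_meas (integ_psiM a0 (ppB _ (qbm t))).
  - apply: (@filterS _ _ (ae_filter_ringOfSetsType mu) _ _ _ (ae_moll (qbm t))) => x h.
    apply: cvgM; last exact: cvg_cst.
    have hpp : pospart (sg * (conv (rho n.+1%:R^-1) (q t) x - c)) @[n --> \oo] --> pospart (sg * (q t x - c)).
      have hin : sg * (conv (rho n.+1%:R^-1) (q t) x - c) @[n --> \oo] --> sg * (q t x - c).
        by apply: cvgM; [exact: cvg_cst|apply: cvgB => //; exact: cvg_cst].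
      exact: (cvg_comp _ _ hin (@pospart_cont R _)).
    by rewrite expr2; under eq_cvg do rewrite expr2; exact: cvgM.
  - exact: integZ (integ_psi a0).
  - move=> n x; have n0' : 0 < n.+1%:R^-1 :> R by rewrite invr_gt0.
    rewrite normrM [`|psi _ _|]gtr0_norm ?psi_gt0// ler_wpM2r ?(ltW (psi_gt0 _ _))//.
    exact: (ppB _ (moll_bm (qbm t) n0')).2.
have If0 : I (fun x => pospart (sg * (q t x - c)) ^+ 2 * psi a x) <= 0.
  have lim2 : expR (k * t) * (4 * B * (Cr * n.+1%:R^-1) * t) @[n --> \oo] --> (0 : R).
    have -> : (0 : R) = expR (k * t) * (4 * B * (Cr * 0) * t) by rewrite !(mulr0, mul0r).
    apply: cvgM; first exact: cvg_cst.
    apply: cvgM; last exact: cvg_cst.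
    apply: cvgM; first exact: cvg_cst.
    by apply: cvgM; [exact: cvg_cst|exact: cvg_harmonic].
  apply: (ler_cvg_to cvg1 lim2); near=> n; apply: step; by rewrite invr_gt0.
have i1 := integ_psiM a0 (ppB _ (qbm t)).
apply: nle0_ae; first exact: mpp.
have f0 x : 0 <= pospart (sg * (q t x - c)) ^+ 2 * psi a x by rewrite mulr_ge0 ?sqr_ge0// ltW// psi_gt0.
apply: (@filterS _ _ (ae_filter_ringOfSetsType mu) _ _ _ (ae_I0 (integ_meas i1) f0 i1 If0)) => x /eqP.
rewrite mulf_eq0 [psi _ _ == 0]gt_eqF ?psi_gt0// orbF sqrf_eq0 => /eqP; exact.
Unshelve. all: by end_near. Qed.

(** Compared with the derivative of the mollified initial W, of L^1 norm at most N0. Replacing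
    mollified V(q) by V(p) costs 36 L M e directly and as much again after averaging, which makes
    72. *)
Lemma Pd0_nle e : 0 < e -> nle (dPot b V (fun t x => conv (rho e) (q t) x) 0) (N0 + 72 * b * L * M * e).
Proof.
move=> e0; have nK := nle_K b0; have tq0 := tq tT0; have q0 := qbm 0.
have bW := W_bm b0 mV lV q0; have bvp := vp_bm mV lV q0 e0; have bvf := vf_bm mV lV q0.
have [D cD] := c11_moll e0 bW.
have t1 := tvle_conv (nle_rho e0) bW tW0; rewrite mulr1 in t1.
have n1 := nle_deriv cD t1.
have nv := V_moll_dist mV lV q0 tq0 e0.
have bv2 : bm (conv (rho e) (fun x => V (q 0 x))) L by have := bm_conv (nle_rho e0) bvf; rewrite mulr1.
have n2 := nleB (conv_nle nK (bmB bvp bv2) nv) nv.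
have := nleD n1 (nleZ b n2); rewrite gtr0_norm//; congr nle; last by ring.
apply/funext => x; rewrite (conv_drho_W b0 mV lV q0 e0) (convB x nK bvp bv2) /dPot /Pot; ring.
Qed.

(** Fix a test function supported in [- r, r]. Replacing W by the smooth P costs O(e); after
    integration by parts the modulus of the test function is dominated by a multiple of psi, and
    [tv_decay] applies. Then e, [de] and a tend to zero in this order. *)
Lemma TV_nonlocal_decay t : 0 <= t <= T -> (TV_seminorm (W t) <= N0%:E)%E.
Proof.
move=> tT; apply: ge_ereal_sup => _ [phi [cphi sphi p1] <-]; rewrite lee_fin -/(I (fun x => W t x * derive1 phi x)).
have [r [D [r0 out bp bd]]] := test_bounds cphi sphi.
have rr : - r <= r by lra.
have cp : continuous phi by move=> x; exact: is_derive_continuous (class_C1_derive x cphi).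
have mp := continuous_meas cp; have md := continuous_meas (class_C1_cont cphi).
have D0 : 0 <= D by apply: le_trans (bd 0).
have nd : nle (derive1 phi) ((r - - r) * D) by apply: nle_supp => // x xr; have [] := out x xr.
have bm_t : 0 <= m <= B by rewrite m0 (le_trans mM MB).
have bM_t : 0 <= Mx <= B by rewrite (le_trans m0 mM).
have nK := nle_K b0.
have N00 : 0 <= N0 by have := tW0.2 1 => /nle_ge0; rewrite normr1 mulr1.
have t0 : 0 <= t by case/andP: tT.
pose kk := L + 2 * (2 * L + L * B).
have LB : 0 <= L * B by rewrite mulr_ge0.
have L0' : 0 <= L := L0. have kk0 : 0 <= kk by rewrite /kk; lra.
have bLM : 0 <= b * L * M by rewrite !mulr_ge0// ltW.
have bL : 0 <= b * L by rewrite mulr_ge0// ltW.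
have bLB : 0 <= b * (2 * L + L * B) by rewrite mulr_ge0 ?(ltW b0)//; lra.
have Cr0 : 0 <= Cr.
  have x2 := mulr_ge0 bLM B0; have x3 := mulr_ge0 bLM M0; have x4 : 0 <= L * M by rewrite mulr_ge0.
  by lra.
have main a de e : 0 < a -> a <= b / 2 -> 0 < de -> 0 < e ->
  I (fun x => W t x * derive1 phi x) <=
  (expR (a * r) + expR (- a * r)) * (expR (a * kk * t) *
    (2^-1 * (N0 + 72 * b * L * M * e) + de * I (psi a) +
     ((2 * b * L + b * (2 * L + L * B)) * de * I (psi a) + 2 * b * L * (Cr * e)) * t))
  + b * (L * (M * (18 * e))) * ((r - - r) * D).
  move=> a0 ab de0 e0.
  have [E sol] := moll_approx_sol T0 b0 mV lV mq qB tq weak e0.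
  set p := fun t x => conv (rho e) (q t) x in sol.
  have pin s x : 0 <= s <= T -> m <= p s x <= Mx.
    move=> sT; have lo := bound_preserved (or_intror erefl) bm_t sT q0lo.
    have hi := bound_preserved (or_introl erefl) bM_t sT q0hi.
    have l1 := conv_pospart_le x (fun z => rho_ge0 z e0) (fun z => rho_le z e0) (nle_rho e0) (I_rho e0) (qbm s) lo.
    have l2 := conv_pospart_le x (fun z => rho_ge0 z e0) (fun z => rho_le z e0) (nle_rho e0) (I_rho e0) (qbm s) hi.
    by rewrite /p; apply/andP; split; lra.
  have An s x : 0 <= s <= T -> Pot b V p s x - V (p s x) + dV (p s x) * p s x <= 0.
    move=> sT; apply: le_trans (cond (pin s x sT)); rewrite lerD2r lerD2r.
    have bv := v_bm mV mdV lV sol sT.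
    rewrite -[leRHS]mul1r -(I_K b0) -(conv_cst (V m) x nK).
    apply: (conv_le x (fun z => K_ge0 z b0) nK bv (bm_cst (V m))) => y.
    have /andP[my yM] := pin s y sT.
    apply: Vmono => //; last exact: (sol_bound sol).
    by rewrite ger0_norm// (le_trans mM MB).
  have dec := tv_decay T0 b0 mV mdV lV sol a0 ab de0 An tT.
  have cP := P_c11 b0 mV mdV lV sol tT.
  have bP := P_bm b0 mV mdV lV sol tT; have bW := W_bm' b0 mV lV mq qB t.
  have bPd := Pd_bm b0 mV mdV lV sol tT.
  have PW x : `|Pot b V p t x - W t x| <= b * (L * (M * (18 * e))).
    exact: (PW_dist b0 mV lV (qbm t) (tq tT) e0).
  have i1 := nle_integ (nleM bP.1 bP.2 nd); have i2 := nle_integ (nleM bW.1 bW.2 nd).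
  have -> : I (fun x => W t x * derive1 phi x) = I (fun x => Pot b V p t x * derive1 phi x)
     - I (fun x => (Pot b V p t x - W t x) * derive1 phi x).
    rewrite [X in _ - X](_ : _ = I (fun x => Pot b V p t x * derive1 phi x - W t x * derive1 phi x)); last by apply: eqI => x; ring.
    by rewrite (IB i1 i2) subKr.
  apply: lerD; last first.
    apply: le_trans (ler_norm _) _; rewrite normrN; apply: nle_normI.
    by apply: nleM => //; exact: (bmB bP bW).1.
  rewrite (I_by_parts_test cP cphi sphi).
  set Sa := expR (a * r) + expR (- a * r).
  have Sa0 : 0 < Sa by exact: psi_den_gt0.
  have ip := integ_psi a0.
  have mhb : meas (smooth_abs de) by apply: continuous_meas => u; exact: is_derive_continuous (is_derive_smooth_abs u de0).
  have ihb s : 0 <= s <= T -> integ (fun x => smooth_abs de (dPot b V p s x) * psi a x).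
    move=> sT; have bPs := Pd_bm b0 mV mdV lV sol sT.
    apply: (integ_psiM a0 (C := 2 * b * L + de)); split; first exact: (measurableT_comp mhb bPs.1).
    move=> x; rewrite ger0_norm ?smooth_abs_ge0//; apply: le_trans (smooth_abs_le _ (ltW de0)) _.
    by rewrite lerD2r; exact: bPs.2.
  (* On the support of the test function psi is at least 1 / Sa, while the test function is at most
     1. *)
  apply: (@le_trans _ _ (Sa * I (fun x => smooth_abs de (dPot b V p t x) * psi a x))).
    rewrite -(IZ Sa (ihb t tT)) -mulN1r.
    have np : nle phi ((r - - r) * 1) by apply: nle_supp => // x xr; have [] := out x xr.
    have id := nle_integ (nleM bPd.1 bPd.2 np).
    rewrite -(IZ _ id); apply: I_le; [exact: integZ|exact: integZ (ihb t tT)|move=> x].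
    apply: le_trans (ler_norm _) _; rewrite normrM normrN1 mul1r normrM.
    rewrite mulrCA; apply: ler_pM => //; first exact: smooth_abs_ge_abs.
    have [xin|xout] := boolP (x \in `[- r, r]); last first.
      by rewrite (out x xout).1 normr0 mulr_ge0// ltW// psi_gt0.
    apply: le_trans (p1 x) _; rewrite mulrC -ler_pdivrMr// div1r.
    by apply: psi_ge; [exact: ltW|move: xin; rewrite in_itv/= -ler_norml].
  rewrite ler_wpM2l ?(ltW Sa0)//; apply: le_trans dec _.
  rewrite -/kk ler_wpM2l ?expR_ge0// lerD2r.
  have n0 := Pd0_nle e0.
  have bPd0 := Pd_bm b0 mV mdV lV sol tT0.
  have babs : bm (fun x => `|dPot b V p 0 x|) (2 * b * L).
    split; first by have := bPd0.1; rewrite /meas => ?; mtac.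
    by move=> x; rewrite normr_id; exact: bPd0.2.
  have iabs : integ (fun x => `|dPot b V p 0 x|) := integ_norm (nle_integ n0).
  (* At time 0 the weight is bounded by its maximum 1/2; this factor compensates Sa, which tends to
     2 with a. *)
  apply: (@le_trans _ _ (I (fun x => 2^-1 * `|dPot b V p 0 x| + de * psi a x))).
    apply: I_le; [exact: ihb|by apply: integD; exact: integZ|move=> x].
    have h1 := ler_wpM2r (ltW (psi_gt0 a x)) (smooth_abs_le (dPot b V p 0 x) (ltW de0)).
    have h2 := ler_wpM2l (normr_ge0 (dPot b V p 0 x)) (psi_le_half a x).
    by apply: le_trans h1 _; rewrite mulrDl; lra.
  rewrite (ID (integZ _ iabs) (integZ _ ip)) !IZ// lerD2r ler_wpM2l//.
  by apply: nle_I; apply: (nle_le _ _ n0) => [|x]; [exact: babs.1|rewrite normr_id].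
set A := I _ in main *.
have Ip0 a : 0 <= I (psi a) by apply: I_ge0 => x; rewrite ltW// psi_gt0.
have lim1 a : 0 < a -> a <= b / 2 ->
    A <= (expR (a * r) + expR (- a * r)) * (expR (a * kk * t) * (2^-1 * N0)).
  move=> a0 ab.
  set Sa := expR (a * r) + expR (- a * r); set Ea := expR (a * kk * t).
  have Sa0 : 0 <= Sa by rewrite ltW// psi_den_gt0.
  have Ea0 : 0 <= Ea by rewrite expR_ge0.
  have SE : 0 <= Sa * Ea by rewrite mulr_ge0.
  pose C1 := Sa * Ea * (I (psi a) + (2 * b * L + b * (2 * L + L * B)) * I (psi a) * t).
  have C10 : 0 <= C1.
    rewrite /C1 mulr_ge0// addr_ge0// !mulr_ge0//; lra.
  apply: (@cvg_le_eps R _ _ C1) => // de de0.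
  pose C2 := Sa * Ea * (2^-1 * (72 * b * L * M) + 2 * b * L * Cr * t) + b * (L * (M * 18)) * ((r - - r) * D).
  have C20 : 0 <= C2.
    have x1 : 0 <= (r - - r) * D by rewrite mulr_ge0//; lra.
    have x2 : 0 <= 2 * b * L * Cr * t by rewrite mulr_ge0// mulr_ge0//; lra.
    have x3 : 0 <= b * (L * (M * 18)) by lra.
    by apply: addr_ge0; apply: mulr_ge0 => //; lra.
  apply: (@cvg_le_eps R _ _ C2) => // e e0.
  apply: le_trans (main a de e a0 ab de0 e0) _.
  by rewrite le_eqVlt; apply/orP; left; apply/eqP; rewrite /C1 /C2 -/Sa -/Ea; ring.
(* The last limit produces the error a (r + kk t) A, from exp(- u) >= 1 - u; its coefficient must be
   nonnegative, so A <= 0 is settled first. *)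
have [Aneg|Apos] := leP A 0; first exact: le_trans Aneg N00.
have ka0 : 0 <= r + kk * t by rewrite addr_ge0 ?mulr_ge0// ltW.
apply: (@cvg_le_near R _ _ ((r + kk * t) * A) (b / 2)); first by rewrite mulr_ge0// ltW.
  by rewrite divr_gt0.
move=> a a0 ab.
have h := lim1 a a0 ab.
have h2 : A <= expR (a * (r + kk * t)) * N0.
  apply: le_trans h _.
  have -> : a * (r + kk * t) = a * r + a * kk * t by ring.
  rewrite expRD.
  have sr : expR (- a * r) <= expR (a * r).
    by rewrite ler_expR mulNr; have := mulr_ge0 (ltW a0) (ltW r0); lra.
  have := ler_wpM2r (mulr_ge0 (expR_ge0 (a * kk * t)) N00) sr; lra.
have h3 : A * expR (- (a * (r + kk * t))) <= N0.
  by rewrite expRN ler_pdivrMr ?expR_gt0// mulrC.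
have h4 := ler_wpM2l (ltW Apos) (expR_ge1Dx (- (a * (r + kk * t)))).
lra.
Qed.

End evolution.
End passage_to_the_limit.

(** * Weak solutions *)

Section almost_everywhere.
Variable R : realType.
Implicit Types (f g k : R -> R) (a b x y c e h u w s t B C D L E M d T tau : R).
Notation mu := (@lebesgue_measure R).
Notation I := (@integralR R).

Lemma aeS (P Q : R -> Prop) : (forall x, P x -> Q x) -> {ae mu, forall x, P x} -> {ae mu, forall x, Q x}.
Proof. by move=> PQ; apply: (@filterS _ _ (ae_filter_ringOfSetsType mu)). Qed.

Lemma aeS2 (P1 P2 Q : R -> Prop) : (forall x, P1 x -> P2 x -> Q x) ->
  {ae mu, forall x, P1 x} -> {ae mu, forall x, P2 x} -> {ae mu, forall x, Q x}.
Proof. by move=> PQ h1 h2; apply: (@filterS2 _ _ (ae_filter_ringOfSetsType mu) _ _ _ _ h1 h2). Qed.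

Lemma mu_setT_gt0 : (0 < mu setT)%E.
Proof.
apply: (@lt_le_trans _ _ (mu `[0, 1]%classic)).
  by rewrite lebesgue_measure_itv /= lte_fin ltr01 oppr0 adde0 lte_fin ltr01.
by apply: le_measure => //; rewrite inE.
Qed.

(** A null set cannot contain an interval. This selects good times near a given one and good points
    near a given point. *)
Lemma ae_dense (P : R -> Prop) a b : a < b -> {ae mu, forall x, P x} -> exists2 x, a < x < b & P x.
Proof.
move=> ab [N [mN N0 sub]]; apply: contrapT => no.
have sub2 : `]a, b[%classic `<=` N.
  move=> x; rewrite /= in_itv/= => xab; apply: sub => /= Px; apply: no; by exists x.
have : (mu `]a, b[%classic <= mu N)%E by apply: le_measure => //; rewrite inE.
by rewrite N0 lebesgue_measure_itv /= lte_fin ab -EFinD lee_fin subr_le0 leNgt ab.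
Qed.

Lemma Linfty_ae f M : (Linfty_norm f <= M%:E)%E -> {ae mu, forall x, `|f x| <= M}.
Proof.
rewrite /Linfty_norm unlock mu_setT_gt0 => /ess_supP.
by apply: aeS => x; rewrite /= lee_fin.
Qed.

Lemma ae_Linfty f M : {ae mu, forall x, `|f x| <= M} -> (Linfty_norm f <= M%:E)%E.
Proof.
move=> h; rewrite /Linfty_norm unlock mu_setT_gt0; apply/ess_supP.
by move: h; apply: aeS => x; rewrite /= lee_fin.
Qed.

Lemma I_ae f g : meas f -> meas g -> {ae mu, forall x, f x = g x} -> I f = I g.
Proof.
move=> mf mg fg; rewrite /integralR /Rintegral; congr fine.
apply: (@ae_eq_integral _ (measurableTypeR R) R mu setT (EFin \o g) (EFin \o f) measurableT (measE mf) (measE mg)).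
by move: fg; apply: aeS => x fgx _ /=; rewrite fgx.
Qed.

Lemma TV_ae f g : meas f -> meas g -> {ae mu, forall x, f x = g x} -> TV_seminorm f = TV_seminorm g.
Proof.
move=> mf mg fg.
have aux f1 f2 : meas f1 -> meas f2 -> {ae mu, forall x, f1 x = f2 x} -> (TV_seminorm f1 <= TV_seminorm f2)%E.
  move=> m1 m2 e12; apply: ge_ereal_sup => _ [phi [cphi sphi p1] <-].
  apply: ereal_sup_ubound; exists phi => //; congr EFin.
  have md := continuous_meas (class_C1_cont cphi).
  apply: (@I_ae (fun x => f2 x * derive1 phi x) (fun x => f1 x * derive1 phi x)).
  - exact: measurable_funM.
  - exact: measurable_funM.
  - by move: e12; apply: aeS => x ->.
apply/eqP; rewrite eq_le aux//= aux//; by move: fg; apply: aeS.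
Qed.

Definition clamp B u : R := Num.max (- B) (Num.min B u).

Lemma clampB B u : 0 <= B -> `|clamp B u| <= B.
Proof. by move=> B0; rewrite ler_norml /clamp le_max lexx /= ge_max ge_min lexx andbT; lra. Qed.

Lemma clamp_id B u : `|u| <= B -> clamp B u = u.
Proof. by rewrite ler_norml => /andP[h1 h2]; rewrite /clamp min_r// max_r. Qed.

Lemma meas_clamp disp (X : measurableType disp) (D : set X) (f : X -> R) B : measurable_fun D f -> measurable_fun D (fun x : X => clamp B (f x)).
Proof.
move=> mf; apply: measurable_maxr; first exact: measurable_cst.
by apply: measurable_minr => //; exact: measurable_cst.
Qed.

Lemma L1loc_cont (T : R) (f : R -> R -> R) (A : set R) t e : continuous_L1loc T f -> compact A -> 0 <= t <= T -> 0 < e ->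
  exists2 d, 0 < d & forall s, 0 <= s <= T -> `|s - t| < d ->
    (\int[mu]_(x in A) `|f s x - f t x|%:E <= e%:E)%E.
Proof.
move=> [_ H] cA tT e0; have tT' : t \in `[0, T] by rewrite in_itv.
have /fine_cvgP[fin cv] := H A cA t tT'.
have N : \forall s \near within `[0, T]%classic (nbhs t),
   (\int[mu]_(x in A) `|f s x - f t x|%:E)%E \is a fin_num /\
   `|0 - fine (\int[mu]_(x in A) `|f s x - f t x|%:E)%E| <= e.
  near=> s; split; first by near: s; exact: fin.
  by near: s; move/cvgrPdist_le : cv; apply.
move: N; rewrite near_withinE => -[d /= d0 Hd].
exists d => // s sT sd.
have := Hd s; rewrite /ball_/= distrC => /(_ sd); rewrite in_itv/= => /(_ sT)[fn].
rewrite sub0r normrN => le; rewrite -(fineK fn) lee_fin.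
by apply: le_trans le; exact: ler_norm.
Unshelve. all: by end_near. Qed.

(** V and its two derivatives are bounded on [- B, B] by compactness. The increments come from the
    mean value theorem, and the Taylor remainder from applying it to V and then to V'. *)
Lemma C2_loc11 (V : R -> R) B : 0 <= B -> of_class_C 2 V -> exists L, loc11 V (derive1 V) B L.
Proof.
move=> B0 [dV cV].
have d0 x : is_derive x 1 V (derive1 V x) by have := dV 0%N isT x => d; split; rewrite ?derive1E.
have d1 x : is_derive x 1 (derive1 V) (derive1 (derive1 V) x).
  by have := dV 1%N isT x => d; split; rewrite ?derive1E.
have c0 : continuous V by move=> x; exact: is_derive_continuous (d0 x).
have c1 : continuous (derive1 V) by move=> x; exact: is_derive_continuous (d1 x).
have bd f : continuous f -> exists2 C, 0 <= C & forall u, `|u| <= B -> `|f u| <= C.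
  move=> cf; have BB : - B <= B by lra.
  have [c _ Hc] := @EVT_max _ (fun x => `|f x|) _ _ BB (continuous_subspaceT (fun x => cvg_norm (cf x))).
  by exists `|f c| => // u; rewrite ler_norml => uB; apply: Hc; rewrite in_itv.
have [C0 C00 H0] := bd _ c0; have [C1 C10 H1] := bd _ c1; have [C2 C20 H2] := bd _ cV.
have lip f df C : 0 <= C -> (forall x, is_derive x 1 f (df x)) -> continuous f ->
    (forall u, `|u| <= B -> `|df u| <= C) ->
    forall u w, `|u| <= B -> `|w| <= B -> exists2 c, `|c| <= B /\ `|c - u| <= `|w - u| & f w - f u = df c * (w - u).
  move=> C_0 fdf cf dC u w uB wB.
  move: uB wB; rewrite !ler_norml => /andP[u1 u2] /andP[w1 w2].
  have [uw|wu] := leP u w.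
    have [c cin ->] := MVT_segment uw (fun x _ => fdf x) (continuous_subspaceT cf).
    move: cin; rewrite in_itv/= => /andP[c1' c2']; exists c => //; split.
      by rewrite ler_norml; apply/andP; split; lra.
    by rewrite !ger0_norm ?subr_ge0//; lra.
  have [c cin E] := MVT_segment (ltW wu) (fun x _ => fdf x) (continuous_subspaceT cf).
  move: cin; rewrite in_itv/= => /andP[c1' c2']; exists c; last by lra.
  split; first by rewrite ler_norml; apply/andP; split; lra.
  by rewrite !ler0_norm ?subr_le0//; [lra|exact: ltW].
exists (C0 + C1 + C2); split.
- by move=> u /H0; lra.
- by move=> u /H1; lra.
- move=> u w uB wB; have [c [cB _] ->] := lip _ _ _ C10 d0 c0 H1 u w uB wB.
  by rewrite normrM ler_wpM2r//; have := H1 c cB; lra.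
- move=> u w uB wB; have [c [cB _] ->] := lip _ _ _ C20 d1 c1 H2 u w uB wB.
  by rewrite normrM ler_wpM2r//; have := H2 c cB; rewrite /=; lra.
- move=> u w uB wB; have [c [cB cu] ->] := lip _ _ _ C10 d0 c0 H1 u w uB wB.
  have [c' [cB' _] E] := lip _ _ _ C20 d1 c1 H2 u c uB cB.
  rewrite -mulrBl E !normrM -[(w - u) ^+ 2]real_normK ?num_real// expr2 mulrA ler_wpM2r//.
  by apply: ler_pM => //; have := H2 c' cB'; rewrite /=; lra.
Qed.

End almost_everywhere.

(** * Bounds valid at every time *)

Section a_priori_bounds.
Variable R : realType.
Implicit Types (f g k : R -> R) (a b x y c e h u w s t B C D L E M d T tau r : R).
Notation mu := (@lebesgue_measure R).
Notation I := (@integralR R).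

Lemma integral_in_nle f (A : set R) e : measurable A -> meas f ->
  (\int[mu]_(x in A) `|f x|%:E <= e%:E)%E -> nle (fun x => f x * \1_A x) e.
Proof.
move=> mA mf; rewrite integral_mkcond => H; split.
  by apply: measurable_funM => //; exact: meas_indic.
apply: le_trans H; rewrite le_eqVlt; apply/orP; left; apply/eqP; apply: eq_integral => x _.
by rewrite patchE indicE; case: (x \in A) => //=; rewrite ?mulr1 ?mulr0 ?normr0.
Qed.

Lemma nle_lim f C : (forall e, 0 < e -> nle f (C + e)) -> nle f C.
Proof.
move=> H; split; first by have [] := H 1 ltr01.
by apply/lee_addgt0Pr => e e0; rewrite -EFinD; have [] := H e e0.
Qed.

Lemma nle0_aeP f : nle f 0 -> {ae mu, forall x, f x = 0}.
Proof.
move=> nf; have n2 := integ_nle (nle_integ nf).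
have i2 : integ (fun x => `|f x|) by have := integrable_norm (nle_integ nf).
have H : I (fun x => `|f x|) <= 0.
  by apply: nle_I; apply: nle_le nf => [|x]; [exact: integ_meas i2|rewrite normr_id].
have := ae_I0 (integ_meas i2) (fun x => normr_ge0 _) i2 H.
by apply: aeS => x /eqP; rewrite normr_eq0 => /eqP.
Qed.

Lemma ae_local (P : R -> Prop) : (forall n : nat, {ae mu, forall x, `[- n%:R, n%:R]%classic x -> P x}) ->
  {ae mu, forall x, P x}.
Proof.
move=> H; have := ae_foralln H.
apply: aeS => x Hx; pose n := Num.Def.truncn `|x|.
apply: (Hx n.+1); rewrite /= in_itv/= -ler_norml.
exact: ltW (truncnS_gt _).
Qed.

Section bounds.
Variables (T : R) (q : R -> R -> R).
Hypotheses (T0 : 0 < T) (cq : continuous_L1loc T q) (bq : bounded_Linfty_TV T q).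

Lemma sol_meas t : 0 <= t <= T -> meas (q t).
Proof. by move=> tT; have [/(_ t)] := cq; rewrite in_itv/= => /(_ tT)[]. Qed.

Lemma sol_cont r t e : 0 <= t <= T -> 0 < e -> exists2 d, 0 < d &
  forall s, 0 <= s <= T -> `|s - t| < d -> nle (fun x => (q s x - q t x) * \1_`[- r, r]%classic x) e.
Proof.
move=> tT e0; have [d d0 Hd] := L1loc_cont cq (@segment_compact _ (- r) r) tT e0.
exists d => // s sT st; apply: integral_in_nle => //; last exact: Hd.
by apply: measurable_funB; exact: sol_meas.
Qed.

(** The definition bounds q only at almost every time. Each t is a limit of good times s in L^1_loc:
    the part of |q(t)| above M is at most |q(s) - q(t)|, and the variation is lower semicontinuous,
    one test function at a time. *)
Lemma weak_solution_bound : exists2 M, 0 <= M & forall t, 0 <= t <= T ->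
  {ae mu, forall x, `|q t x| <= M} /\ (TV_seminorm (q t) <= M%:E)%E.
Proof.
have [M0 HM] := bq; pose M := Num.max 0 M0.
have good t d : 0 <= t <= T -> 0 < d -> exists s, [/\ 0 <= s <= T, `|s - t| < d,
    {ae mu, forall x, `|q s x| <= M} & (TV_seminorm (q s) <= M%:E)%E].
  move=> /andP[t0 tT] d0.
  have lt : Num.max 0 (t - d) < Num.min T (t + d).
    by rewrite gt_max !lt_min T0/=; apply/and3P; split; lra.
  have [s /andP[]] := ae_dense lt HM.
  rewrite gt_max => /andP[s0 s1]; rewrite lt_min => /andP[s2 s3].
  rewrite in_itv/= s0 s2 => /(_ isT)[hL hTV].
  have le : (M0%:E <= M%:E)%E by rewrite lee_fin le_max lexx orbT.
  exists s; split; [by rewrite !ltW|by rewrite ltr_norml; lra| |exact: le_trans le].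
  exact: Linfty_ae (le_trans hL le).
have M_0 : 0 <= M by rewrite le_max lexx.
have bd t : 0 <= t <= T -> {ae mu, forall x, `|q t x| <= M}.
  move=> tT; apply: ae_local => n.
  have mt := sol_meas tT; have mi : measurable (`[- n%:R, n%:R]%classic : set R) by [].
  pose h x := pospart (`|q t x| - M) * \1_`[- n%:R, n%:R]%classic x.
  have mh : meas h by apply: measurable_funM; [apply: meas_pospart; mtac|exact: meas_indic].
  have nh : nle h 0.
    apply: nle_lim => e e0; rewrite add0r.
    have [d d0 Hd] := sol_cont n%:R tT e0; have [s [sT st bs _]] := good t d tT d0.
    apply: nle_aele (Hd s sT st) => //; move: bs; apply: aeS => x bx.
    rewrite !normrM ler_wpM2r// ger0_norm ?pospart_ge0//.
    have [[_ ->]|[_ ->]] := ppP (`|q t x| - M); last by [].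
    have := ler_normB (q s x) (q s x - q t x); rewrite subKr; lra.
  have := nle0_aeP nh; apply: aeS => x; rewrite /h => hx xn.
  move: hx; rewrite indicE mem_set// mulr1.
  by have [[? ->]|[? ->]] := ppP (`|q t x| - M); lra.
exists M => // t tT; split; first exact: bd.
apply: ge_ereal_sup => _ [phi [cphi sphi p1] <-]; rewrite lee_fin.
have [r [D [r0 out bp bdd]]] := test_bounds cphi sphi.
have D0 : 0 <= D by apply: le_trans (bdd 0).
have rr : - r <= r by lra.
have md := continuous_meas (class_C1_cont cphi).
have nq s : 0 <= s <= T -> nle (fun x => q s x * \1_`[- r, r]%classic x) (M * (r - - r)).
  move=> sT; apply: nle_aele (nle_indicM rr M_0).
    by apply: measurable_funM; [exact: sol_meas|exact: meas_indic].
  by move: (bd s sT); apply: aeS => x bx; rewrite !normrM ler_wpM2r// (ger0_norm M_0).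
have E g : (fun x => g x * derive1 phi x) = (fun x => derive1 phi x * (g x * \1_`[- r, r]%classic x)).
  apply/funext => x; rewrite indicE.
  have [xr|xr] := boolP (x \in `[- r, r]); first by rewrite mem_set//=; ring.
  by rewrite (out x xr).2; ring.
apply: (@cvg_le_eps R _ _ D) => // e e0.
have [d d0 Hd] := sol_cont r tT e0; have [s [sT st bs tvs]] := good t d tT d0.
have := TV_seminormP tvs cphi sphi p1; rewrite E.
have n1 := nleM md bdd (nq s sT); have n2 := nleM md bdd (nq t tT).
have nd := nleM md bdd (Hd s sT st).
move=> qs; change (I (fun x => q t x * derive1 phi x) <= M + D * e); move: qs; rewrite !E.
have : I (fun x => derive1 phi x * (q s x * \1_`[- r, r]%classic x)) - I (fun x => derive1 phi x * (q t x * \1_`[- r, r]%classic x)) >= - (D * e).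
  rewrite -IB; [|exact: nle_integ n1|exact: nle_integ n2].
  rewrite (_ : (fun x => _) = (fun x => derive1 phi x * ((q s x - q t x) * \1_`[- r, r]%classic x))); last by apply/funext => x; ring.
  by have := nle_normI nd; rewrite ler_norml => /andP[].
by move=> ? ?; lra.
Qed.

End bounds.

End a_priori_bounds.

Section truncation.
Variable R : realType.
Implicit Types (f g k : R -> R) (a b x y c e h u w s t C D L E d tau r : R).
Notation mu := (@lebesgue_measure R).

Lemma clamp_lip B u w : `|clamp B u - clamp B w| <= `|u - w|.
Proof.
rewrite /clamp !maxEle !minEle.
by do !case: ifP => //; rewrite ?subrr ?normr_ge0 //; move=> *; case: (ler0P (u - w)) => *; case: ler0P => *; lra.
Qed.

Section cutoff.
Variables (T B M : R) (q : R -> R -> R).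
Hypotheses (T0 : 0 < T) (B0 : 0 <= B) (MB : M <= B)
  (cq : continuous_L1loc T q)
  (mq : measurable_fun (`[0, T] `*` setT) (fun z : R * R => q z.1 z.2))
  (qbd : forall t, 0 <= t <= T -> {ae mu, forall x, `|q t x| <= M} /\ (TV_seminorm (q t) <= M%:E)%E).

(* A bounded, jointly measurable representative of the solution, defined for
   all times. *)
Definition cutoff t x := if 0 <= t <= T then clamp B (q t x) else 0.

Local Notation Q := cutoff.

Lemma cutoff_meas : measurable_fun setT (fun z : R * R => Q z.1 z.2).
Proof.
have -> : (fun z : R * R => Q z.1 z.2) = (fun z : R * R => clamp B (q z.1 z.2)) \_ (`[0, T] `*` setT).
  apply/funext => z; rewrite patchE /cutoff; case: ifPn => [h|h]; first by rewrite mem_set//=; split => //; rewrite /= in_itv.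
  by rewrite memNset// => -[/=]; rewrite in_itv/= (negbTE h).
apply/(measurable_restrictT _ _).1; first by apply: measurableX.
exact: meas_clamp.
Qed.

Lemma cutoff_le t x : `|Q t x| <= B.
Proof. by rewrite /cutoff; case: ifP => _; [exact: clampB|rewrite normr0]. Qed.

Lemma cutoff_bm t : bm (Q t) B.
Proof.
split; last exact: cutoff_le.
have m2 : measurable_fun setT (fun x : R => (t, x)) by apply/measurable_fun_pair; mtac.
exact: (measurableT_comp cutoff_meas m2).
Qed.

Lemma cutoff_ae t : 0 <= t <= T -> {ae mu, forall x, q t x = Q t x}.
Proof.
move=> tT; have [h _] := qbd tT; move: h; apply: aeS => x h.
by rewrite /cutoff tT clamp_id//; exact: le_trans MB.
Qed.

Lemma cutoff_tvle t : 0 <= t <= T -> tvle (Q t) M.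
Proof.
move=> tT; apply: TV_tvle (cutoff_bm t) _.
rewrite -(TV_ae (sol_meas cq tT) (cutoff_bm t).1 (cutoff_ae tT)); exact: (qbd tT).2.
Qed.

Lemma cutoff_cont r t e : 0 <= t <= T -> 0 < e -> exists2 d, 0 < d &
  forall s, 0 <= s <= T -> `|s - t| < d -> nle (fun x => (Q s x - Q t x) * \1_`[- r, r]%classic x) e.
Proof.
move=> tT e0; have [d d0 Hd] := sol_cont cq r tT e0; exists d => // s sT st.
apply: nle_le (Hd s sT st).
  apply: measurable_funM; last exact: meas_indic.
  by apply: measurable_funB; [exact: (cutoff_bm s).1|exact: (cutoff_bm t).1].
by move=> x; rewrite !normrM ler_wpM2r// /cutoff sT tT clamp_lip.
Qed.

Lemma nonlocal_cutoff eta (V : R -> R) C t x : 0 < eta -> continuous V -> (forall u, `|u| <= B -> `|V u| <= C) ->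
  0 <= t <= T -> nonlocal eta V q t x = Pot eta^-1 V cutoff t x.
Proof.
move=> eta0 cV VC tT; have mV := continuous_meas cV.
have bV : bm (fun y => V (Q t y)) C.
  by split; [exact: (measurableT_comp mV (cutoff_bm t).1)|move=> y; apply: VC; exact: cutoff_le].
rewrite /Pot -(nonlocalE x eta0 bV) /nonlocal; congr (_ * _).
rewrite /Rintegral; congr fine.
have mE f : meas f -> measurable_fun `[x, +oo[ (EFin \o (fun y => expR ((x - y) / eta) * V (f y))).
  move=> mf; apply/measurable_EFinP; apply: measurable_funTS; apply: measurable_funM.
    by mtac.
  exact: (measurableT_comp mV mf).
apply: (@ae_eq_integral _ (measurableTypeR R) R mu `[x, +oo[%classic _ _ _ (mE _ (sol_meas cq tT)) (mE _ (cutoff_bm t).1)) => //.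
by move: (cutoff_ae tT); apply: aeS => y e _ /=; rewrite e.
Qed.

End cutoff.

End truncation.

(** * Test functions that are products in time and space *)

Section tensor_test_functions.
Variable R : realType.
Implicit Types (f g k chi phi : R -> R) (a b x y c e h u w s t C D L E d tau r : R).
Notation mu := (@lebesgue_measure R).
Notation I := (@integralR R).

Lemma derive_tensor_left chi phi (z : R * R) : of_class_C 1 chi ->
  is_derive z (1, 0) (fun z => chi z.1 * phi z.2) (derive1 chi z.1 * phi z.2).
Proof.
move=> cchi; have [d e] := class_C1_derive z.1 cchi.
have cv : h^-1 *: ((chi \o shift z.1) (h *: 1) - chi z.1) @[h --> 0^'] --> derive1 chi z.1 by rewrite -e; exact: d.
have H : h^-1 *: (((fun z => chi z.1 * phi z.2) \o shift z) (h *: (1, 0)) - chi z.1 * phi z.2) @[h --> 0^'] --> derive1 chi z.1 * phi z.2.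
  apply: cvg_trans (cvgMl cv) => /=.
  apply: near_eq_cvg; apply: nearW => h /=.
  by rewrite /GRing.scale/= mulr0 add0r; ring.
split; first by apply: cvgP H.
exact: cvg_lim H.
Qed.

Lemma derive_tensor_right chi phi (z : R * R) : of_class_C 1 phi ->
  is_derive z (0, 1) (fun z => chi z.1 * phi z.2) (chi z.1 * derive1 phi z.2).
Proof.
move=> cphi; have [d e] := class_C1_derive z.2 cphi.
have cv : h^-1 *: ((phi \o shift z.2) (h *: 1) - phi z.2) @[h --> 0^'] --> derive1 phi z.2 by rewrite -e; exact: d.
have H : h^-1 *: (((fun z => chi z.1 * phi z.2) \o shift z) (h *: (0, 1)) - chi z.1 * phi z.2) @[h --> 0^'] --> chi z.1 * derive1 phi z.2.
  apply: cvg_trans (cvgMr cv) => /=.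
  apply: near_eq_cvg; apply: nearW => h /=.
  by rewrite /GRing.scale/= mulr0 add0r; ring.
split; first by apply: cvgP H.
exact: cvg_lim H.
Qed.

Lemma class_C1_cont0 phi : of_class_C 1 phi -> continuous phi.
Proof. by move=> cphi x; exact: is_derive_continuous (class_C1_derive x cphi). Qed.

Lemma tensor_class_C1 chi phi : of_class_C 1 chi -> of_class_C 1 phi -> of_class_C1_2 (fun z => chi z.1 * phi z.2).
Proof.
move=> cchi cphi.
have cc f g : continuous f -> continuous g -> continuous (fun z : R * R => f z.1 * g z.2).
  move=> cf cg z; apply: cvgM.
    by apply: (continuous_comp _ (cf _)); exact: cvg_fst.
  by apply: (continuous_comp _ (cg _)); exact: cvg_snd.
split.
- by move=> z; have [] := derive_tensor_left phi z cchi.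
- by move=> z; have [] := derive_tensor_right chi z cphi.
- rewrite (_ : (fun z => _) = (fun z => derive1 chi z.1 * phi z.2)); last first.
    by apply/funext => z; have [_ ->] := derive_tensor_left phi z cchi.
  by apply: cc; [exact: class_C1_cont|exact: class_C1_cont0].
- rewrite (_ : (fun z => _) = (fun z => chi z.1 * derive1 phi z.2)); last first.
    by apply/funext => z; have [_ ->] := derive_tensor_right chi z cphi.
  by apply: cc; [exact: class_C1_cont0|exact: class_C1_cont].
Qed.

Lemma tensor_supp chi phi (D : set (R * R)) a b r :
  (forall t, t \notin `[a, b] -> chi t = 0) -> (forall x, x \notin `[- r, r] -> phi x = 0) ->
  `[a, b]%classic `*` `[- r, r]%classic `<=` D ->
  compactly_supported_in D (fun z : R * R => chi z.1 * phi z.2).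
Proof.
move=> Hc Hp sD.
have cb : compact (`[a, b]%classic `*` `[- r, r]%classic : set (R * R)).
  by apply: compact_setX; exact: segment_compact.
have sub : closure [set z : R * R | chi z.1 * phi z.2 != 0] `<=` `[a, b]%classic `*` `[- r, r]%classic.
  have /closure_id -> : closed (`[a, b]%classic `*` `[- r, r]%classic : set (R * R)).
    exact: compact_closed.
  apply: closureS => z /= nz; split => /=; apply: contraNT nz => zn.
    by rewrite (Hc _ zn) mul0r.
  by rewrite (Hp _ zn) mulr0.
split; last exact: subset_trans sD.
by apply: (subclosed_compact _ cb sub); exact: closed_closure.
Qed.

(** Fubini in a form where the section at each time may be replaced almost everywhere, as is needed
    to pass from q to its representative [cutoff]. *)
Lemma I_prod (F : R * R -> R) (G : R -> R -> R) (c : R -> R) C : measurable_fun setT F ->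
  (forall t, {ae mu, forall x, F (t, x) = G t x}) -> (forall t, nle (G t) `|c t|) -> nle c C ->
  \int[(mu \x mu)%E]_z F z = I (fun t => I (G t)).
Proof.
move=> mF FG Gc [mc cC].
have mE : measurable_fun setT (EFin \o F) by apply/measurable_EFinP.
have mGE : measurable_fun setT (fun xz => `|F xz|%:E).
  by apply/measurable_EFinP; mtac.
have mFt t : meas (fun x => F (t, x)).
  have m2 : measurable_fun setT (fun x : R => (t, x)) by apply/measurable_fun_pair; mtac.
  exact: (measurableT_comp mF m2).
have nF t : nle (fun x => F (t, x)) `|c t|.
  apply: nle_aele (Gc t) => //; by move: (FG t); apply: aeS => x ->.
have iF : (mu \x mu)%E.-integrable setT (EFin \o F).
  apply/integrable12ltyP => //=; apply: le_lt_trans (ltry C); apply: le_trans cC.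
  apply: ge0_le_integral => //.
  - by move=> x _; apply: integral_ge0.
  - exact: (measurable_fun_fubini_tonelli_F (m2 := mu) (fun xz => `|F xz|%:E)).
  - exact: measNE.
  - by move=> t _; have [] := nF t.
rewrite /integralR /Rintegral; congr fine.
rewrite -(integral12_prod_meas1 iF); apply: eq_integral => t _; rewrite /fubini_F/=.
rewrite -(@fineK _ (\int[mu]_x (F (t, x))%:E)%E).
  by congr EFin; exact: I_ae (mFt t) (Gc t).1 (FG t).
by have /integrable_fin_num := nle_integ (nF t); apply.
Qed.

End tensor_test_functions.

(** * From a distributional time derivative to an integrated identity *)

Section weak_time_derivative.
Variable R : realType.
Implicit Types (f g k chi phi : R -> R) (x y c e h u w s t C D E d tau r : R).
Notation mu := (@lebesgue_measure R).
Notation I := (@integralR R).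

Lemma indic_itv x y u : \1_`[x, y]%classic u = (if x <= u <= y then 1 else 0) :> R.
Proof.
rewrite indicE; case: ifP => h; first by rewrite mem_set//= in_itv.
by rewrite memNset//= in_itv/= h.
Qed.

Lemma indic_oitv x y u : \1_`]x, y[%classic u = (if x < u < y then 1 else 0) :> R.
Proof.
rewrite indicE; case: ifP => h; first by rewrite mem_set//= in_itv.
by rewrite memNset//= in_itv/= h.
Qed.

(** A crude bound: slope at most 1 / e over a length of at most 6 e. *)
Lemma smooth_step_le e z : 0 < e -> `|smooth_step e z| <= 6.
Proof.
move=> e0; have [z1|z1] := leP z (- (3 * e)); first by rewrite smooth_step_lo// normr0.
have [z2|z2] := leP (3 * e) z; first by rewrite smooth_step_hi// normr1; lra.
have cs : continuous (smooth_step e) by move=> x; exact: is_derive_continuous (is_derive_smooth_step x e0).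
have [c _] := MVT_segment (ltW z1) (fun x _ => is_derive_smooth_step x e0) (continuous_subspaceT cs).
rewrite (smooth_step_lo e0 (lexx _)) subr0 => ->; rewrite normrM.
have := rho_le c e0; have : `|z - - (3 * e)| <= 6 * e by rewrite ger0_norm; lra.
move=> h1 h2; apply: (@le_trans _ _ (e^-1 * (6 * e))); first exact: ler_pM.
by rewrite mulrCA mulVf ?gt_eqF// mulr1.
Qed.

Lemma smooth_step_class_C1 e1 e2 (x1 x2 : R) : 0 < e1 -> 0 < e2 ->
  of_class_C 1 (fun z => smooth_step e1 (z + x1) - smooth_step e2 (z + x2)) /\
  forall z, derive1 (fun z => smooth_step e1 (z + x1) - smooth_step e2 (z + x2)) z = rho e1 (z + x1) - rho e2 (z + x2).
Proof.
move=> e10 e20.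
have D (z : R) : is_derive z 1 (fun z => smooth_step e1 (z + x1) - smooth_step e2 (z + x2)) (rho e1 (z + x1) - rho e2 (z + x2)).
  have ds e x : 0 < e -> is_derive z 1 (fun z => smooth_step e (z + x)) (rho e (z + x)).
    move=> e0; have h1 : is_derive z 1 (fun z => z + x) 1.
      by apply: (@quad_is_derive _ _ _ _ 0) => h _; rewrite (_ : _ - _ = 0) ?normr0 ?mul0r//; ring.
    rewrite -[rho e (z + x)]mulr1.
    exact: (@is_derive1_comp _ (smooth_step e) (fun z => z + x) z _ _ (is_derive_smooth_step _ e0) h1).
  exact: (is_deriveB (ds _ x1 e10) (ds _ x2 e20)).
have D1 z : derive1 (fun z => smooth_step e1 (z + x1) - smooth_step e2 (z + x2)) z = rho e1 (z + x1) - rho e2 (z + x2).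
  by rewrite derive1E; have [_ ->] := D z.
split => //; split => [[|//] _ x|]; first by have [] := D x.
rewrite /= (funext D1) => z.
have cr e x : 0 < e -> {for z, continuous (fun z => rho e (z + x))}.
  move=> e0; have [C cC] := rho_c11 e0.
  apply: (@continuous_comp _ _ _ (fun z => z + x)); last exact: (c11_cont cC).
  by apply: cvgD; [exact: cvg_id|exact: cvg_cst].
by apply: cvgB; exact: cr.
Qed.

Lemma ae_neq c : {ae mu, forall x, x != c}.
Proof.
exists [set c]; split => //; first exact: lebesgue_measure_set1.
by move=> x /= /negP; rewrite negbK => /eqP.
Qed.

Section weak_derivative.
Variables (T A0 Ca Cb : R) (a b : R -> R).
Hypotheses (T0 : 0 < T) (ma : bm a Ca) (mb : bm b Cb)
  (ca : forall t e, 0 <= t <= T -> 0 < e -> exists2 d, 0 < d &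
     forall s, 0 <= s <= T -> `|s - t| < d -> `|a s - a t| <= e)
  (H : forall chi t1, of_class_C 1 chi -> t1 < T -> (forall t, t \notin `[- 2, t1] -> chi t = 0) ->
     I (fun tau => (derive1 chi tau * a tau + chi tau * b tau) * \1_`]0, T[%classic tau) + chi 0 * A0 = 0).

Let Cb0 : 0 <= Cb. Proof. by apply: le_trans (mb.2 0). Qed.

Let nb s t : s <= t -> nle (fun tau => b tau * \1_`[s, t]%classic tau) (Cb * (t - s)).
Proof.
move=> st; have := nleM mb.1 mb.2 (nle_indicM st ler01).
by rewrite mul1r; congr nle; apply/funext => x; rewrite mul1r.
Qed.

(** The three indicators cancel except at s, so [nle_supp] on the degenerate interval [s, s] bounds
    the difference by 0. *)
Lemma I_itvB r s t : r <= s -> s <= t ->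
  I (fun tau => b tau * \1_`[r, t]%classic tau) - I (fun tau => b tau * \1_`[r, s]%classic tau) =
  I (fun tau => b tau * \1_`[s, t]%classic tau).
Proof.
move=> rs st; have rt := le_trans rs st.
have [n1 n2 n3] := And3 (nb rt) (nb rs) (nb st).
apply/eqP; rewrite -subr_eq0 -normr_eq0 eq_le normr_ge0 andbT -IB ?(nle_integ n1) ?(nle_integ n2)//.
rewrite -IB; [|exact: nle_integ (nleB n1 n2)|exact: nle_integ n3].
rewrite -(mul0r Cb) -(subrr s); apply: nle_normI; apply: nle_supp => //.
- exact: (nleB (nleB n1 n2) n3).1.
- move=> x; rewrite -!mulrBr -[leRHS]mulr1 normrM ler_pM// ?mb.2// !indic_itv.
  have := mb.2 x; case: ifP; case: ifP; case: ifP => h1 h2 h3 _; rewrite ler_norml; apply/andP; split; lra.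
- move=> x xs; rewrite -!mulrBr !indic_itv; apply/eqP; rewrite mulf_eq0; apply/orP; right; apply/eqP.
  have [sx|xs'|sx] := ltgtP s x.
  + by rewrite (le_trans rs (ltW sx)) /= subr0 subrr.
  + by rewrite (le_trans (ltW xs') st) !andbT subrr subr0.
  + by move: xs; rewrite sx in_itv/= lexx.
Qed.

(** Test with a function equal to 1 from time 0 up to nearly t and then dropping to 0: its value at
    0 yields A0, its derivative averages a around t, and its pairing with b approximates the
    integral over [0, t]. *)
Lemma weak_derivative_interior t : 0 < t < T -> a t = A0 + I (fun tau => b tau * \1_`[0, t]%classic tau).
Proof.
move=> /andP[t0 tT].
apply/eqP; rewrite -subr_eq0 -normr_eq0 eq_le normr_ge0 andbT; apply/ler_addgt0Pr => e e0; rewrite add0r.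
have tT' : 0 <= t <= T by rewrite !ltW.
have [d d0 Hd] := ca tT' (divr_gt0 e0 (ltr0Sn _ 1)).
(* The drop must stay inside (0, T), where a is within e / 2 of a(t). On its window of length 6 del
   the integrand for b is off by at most 8 Cb, whence 48 = 8 * 6. *)
have [del [del0 [dt dT] [dd dC]]] : exists del, [/\ 0 < del, 3 * del < t /\ t + 3 * del < T & 3 * del < d /\ 48 * Cb * del <= e / 2].
  pose X := e / 2 / (48 * Cb + 1).
  have X0 : 0 < X by rewrite !divr_gt0// ltr_wpDl// mulr_ge0.
  have XC : 48 * Cb * X <= e / 2.
    by rewrite /X mulrA ler_pdivrMr ?ltr_wpDl ?mulr_ge0// mulrC ler_wpM2l//; lra.
  pose m := Num.min (Num.min t (T - t)) (Num.min d X).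
  have m0 : 0 < m by rewrite !lt_min t0 subr_gt0 tT d0 X0.
  have [[m1 m2] [m3 m4]] : (m <= t /\ m <= T - t) /\ (m <= d /\ m <= X) by rewrite !ge_min !lexx !orbT.
  exists (m / 4); split; [by rewrite divr_gt0|by split; lra|split; first by lra].
  by apply: le_trans XC; rewrite ler_wpM2l ?mulr_ge0//; lra.
(* The rise takes place on [- 7/4, - 1/4], before time 0 and within the support bound - 2. *)
pose chi z := smooth_step 4^-1 (z + 1) - smooth_step del (z - t).
have q0 : 0 < 4^-1 :> R by rewrite invr_gt0.
have [cc dc] := smooth_step_class_C1 1 (- t) q0 del0.
have q3 : 3 * 4^-1 = 3 / 4 :> R by [].
have supp z : z \notin `[- 2, t + 3 * del] -> chi z = 0.
  rewrite in_itv/= negb_and -!ltNge => /orP[h|h]; rewrite /chi.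
    by rewrite !smooth_step_lo ?subrr//; lra.
  by rewrite !smooth_step_hi ?subrr//; lra.
have := H (chi := chi) cc dT supp.
have -> : chi 0 = 1 by rewrite /chi (smooth_step_hi q0) ?(smooth_step_lo del0) ?subr0//; lra.
have -> : (fun tau => ((derive1 chi tau * a tau + chi tau * b tau) * \1_`]0, T[%classic tau)) =
   (fun tau => (1 - smooth_step del (tau - t)) * b tau * \1_`]0, T[%classic tau - rho del (tau - t) * a tau).
  apply/funext => z; rewrite dc indic_oitv; case: ifP => [/andP[z0 zT]|zn].
    by rewrite /chi (smooth_step_hi q0) ?(rho_supp q0 _).1; [ring|rewrite in_itv/= negb_and -!ltNge; apply/orP; right; lra|lra].
  rewrite (rho_supp del0 _).1; first by ring.
  by apply: contraFN zn; rewrite in_itv/= => /andP[? ?]; apply/andP; split; lra.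
rewrite mul1r => E.
have nr := nle_shift (- t) (nle_rho del0).
have mr : meas (fun z => rho del (z - t)) by exact: nr.1.
have n0 : nle (fun z => rho del (z - t) * a z) (Ca * 1).
  by have := nleM ma.1 ma.2 nr; congr nle; apply/funext => x; rewrite mulrC.
have n1 : nle (fun z => rho del (z - t) * a z - a t * rho del (z - t)) (e / 2).
  have := nleZ (e / 2) nr; rewrite mulr1 ger0_norm ?divr_ge0 ?(ltW e0)// => nz.
  apply: nle_le nz => [|z]; first by have := ma.1; rewrite /meas in mr * => ?; mtac.
  have eh : 0 <= e / 2 by rewrite divr_ge0// ltW.
  rewrite mulrC -mulrBl normrM [leRHS]normrM (ger0_norm eh).
  have [zi|zo] := boolP (z - t \in `[- (3 * del), 3 * del]); last by rewrite (rho_supp del0 zo).1 normr0 !mulr0.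
  rewrite ler_wpM2r//; move: zi; rewrite in_itv/= => /andP[z1 z2]; apply: Hd.
    by apply/andP; split; lra.
  by rewrite ltr_norml; apply/andP; split; lra.
have ms : meas (fun z => smooth_step del (z - t)).
  apply: continuous_meas => z; have cs : continuous (smooth_step del) by move=> x; exact: is_derive_continuous (is_derive_smooth_step x del0).
  apply: (@continuous_comp _ _ _ (fun z => z - t)); last exact: cs.
  by apply: cvgB; [exact: cvg_id|exact: cvg_cst].
have nbt := nb (ltW t0).
have mb' : meas b := mb.1.
have n2 : nle (fun z => (1 - smooth_step del (z - t)) * b z * \1_`]0, T[%classic z - b z * \1_`[0, t]%classic z) (e / 2).
  have C8 : 0 <= 8 * Cb by rewrite mulr_ge0.
  have tt : t - 3 * del <= t + 3 * del by lra.
  apply: nleC (nle_aele _ _ (nle_indicM tt C8)); first by lra.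
    apply: measurable_funB; last by apply: measurable_funM => //; exact: meas_indic.
    by apply: measurable_funM; [mtac|exact: meas_indic].
  (* The open interval from 0 and the closed one differ at the single point 0. *)
  apply: aeS (ae_neq 0) => z z0.
  rewrite (_ : _ - _ = b z * ((1 - smooth_step del (z - t)) * \1_`]0, T[%classic z - \1_`[0, t]%classic z)); last by ring.
  rewrite !indic_itv indic_oitv.
  have [/[dup] zz /andP[z1 z2]|/negbTE zn] := boolP (t - 3 * del <= z <= t + 3 * del); rewrite ?zz ?zn.
    rewrite mulr1 (ger0_norm C8) normrM mulrC ler_pM// ?mb.2//.
    have h1 := smooth_step_le (z - t) del0.
    have -> : 0 < z < T by apply/andP; split; lra.
    rewrite mulr1; move: h1; rewrite !ler_norml => /andP[h1 h3].
    by case: ifP => _; apply/andP; split; lra.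
  rewrite mulr0 normr0 normr_le0; suff -> : (1 - smooth_step del (z - t)) * (if 0 < z < T then 1 else 0) - (if 0 <= z <= t then 1 else 0) = 0 by rewrite mulr0.
  have [zt|zt] := ltP z (t - 3 * del).
    rewrite (smooth_step_lo del0) ?subr0 ?mul1r; last by lra.
    have -> : (z < T) by lra. have -> : (z <= t) by lra.
    by rewrite !andbT lt_neqAle eq_sym z0 subrr.
  have zt2 : t + 3 * del < z by rewrite ltNge; apply: contraFN zn => h; apply/andP; split.
  rewrite (smooth_step_hi del0) ?subrr ?mul0r ?sub0r; last by lra.
  by case: ifP => [/andP[_ h]|_]; [exfalso; lra|rewrite oppr0].
have i1 : nle (fun z => (1 - smooth_step del (z - t)) * b z * \1_`]0, T[%classic z) (e / 2 + Cb * (t - 0)).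
  by have := nleD n2 nbt; congr nle; apply/funext => x; rewrite subrK.
have E2 := nle_normI n2; rewrite IB in E2; [|exact: nle_integ i1|exact: nle_integ nbt].
have E1 := nle_normI n1; rewrite IB in E1; [|exact: nle_integ n0|exact: nle_integ (nleZ (a t) nr)].
rewrite IZ in E1; last exact: nle_integ nr.
rewrite (I_shift (f := rho del) (- t)) ?I_rho// ?mulr1 in E1; last exact: (nle_rho del0).1.
rewrite IB in E; [|exact: nle_integ i1|exact: nle_integ n0].
move: E1 E2; rewrite !ler_norml => /andP[? ?] /andP[? ?]; apply/andP; split; lra.
Qed.

(** The endpoints 0 and T are reached from interior times, by continuity of a and boundedness of
    b. *)
Lemma weak_derivative_identity s t : 0 <= s -> s <= t -> t <= T ->
  a 0 = A0 /\ a t - a s = I (fun tau => b tau * \1_`[s, t]%classic tau).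
Proof.
have key u : 0 <= u <= T -> a u = A0 + I (fun tau => b tau * \1_`[0, u]%classic tau).
  move=> uT; have /andP[u0 uT'] := uT.
  apply/eqP; rewrite -subr_eq0 -normr_eq0 eq_le normr_ge0 andbT.
  apply: (@cvg_le_eps R _ _ (1 + Cb)) => [|e e0]; first by rewrite addr_ge0.
  have [d d0 Hd] := ca uT e0.
  pose m := Num.min (Num.min d e) T.
  have m0 : 0 < m by rewrite !lt_min d0 e0 T0.
  have [m1 [m2 m3]] : m <= d /\ (m <= e /\ m <= T) by rewrite !ge_min !lexx !orbT.
  have [w [w0 [wd we]]] : exists w, [/\ 0 < w < T & `|w - u| < d /\ `|w - u| <= e].
    have [uh|uh] := leP u (T / 2).
      by exists (u + m / 3); split; [apply/andP; split; lra|rewrite addrAC subrr add0r gtr0_norm; lra].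
    by exists (u - m / 3); split; [apply/andP; split; lra|rewrite addrAC subrr add0r normrN gtr0_norm; lra].
  have aw := weak_derivative_interior w0.
  have w0' : 0 <= w <= T by case/andP: w0 => ? ?; rewrite !ltW.
  have h := Hd w w0' wd.
  have Bw : `|I (fun tau => b tau * \1_`[0, w]%classic tau) - I (fun tau => b tau * \1_`[0, u]%classic tau)| <= Cb * e.
    have le := ler_wpM2l Cb0 we; apply: le_trans le.
    have [uw|wu] := leP u w.
      by rewrite (I_itvB u0 uw) [`|w - u|]ger0_norm ?subr_ge0//; exact: nle_normI (nb uw).
    rewrite distrC (I_itvB _ (ltW wu)); last by case/andP: w0'.
    by rewrite [`|w - u|]distrC [`|u - w|]ger0_norm ?subr_ge0 ?(ltW wu)//; exact: nle_normI (nb (ltW wu)).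
  move: h Bw; rewrite !ler_norml aw => /andP[? ?] /andP[? ?]; apply/andP; split; lra.
move=> s0 st tT; split.
  have -> := key 0; last by rewrite lexx ltW.
  have := nle_normI (nb (lexx 0)); rewrite subrr mulr0 normr_le0 => /eqP ->.
  by rewrite addr0.
rewrite (key t) ?(key s); [|apply/andP; split; lra|apply/andP; split; lra].
by rewrite -(I_itvB s0 st); ring.
Qed.

End weak_derivative.
End weak_time_derivative.

(** * The weak formulation tested with the mollifier *)

Section weak_formulation.
Variable R : realType.
Implicit Types (f df g k chi phi : R -> R) (a b x y c e h u w s t C D E d tau r : R).
Notation mu := (@lebesgue_measure R).
Notation I := (@integralR R).
Notation K := (@exponential_pdf R).

Lemma c11_shift f df C x : c11 f df C -> c11 (fun y => f (y + x)) (fun y => df (y + x)) C.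
Proof.
move=> [bf bdf q]; split; [exact: (bm_shift x bf)|exact: (bm_shift x bdf)|move=> y h].
by rewrite [y + h + x]addrAC; exact: q.
Qed.

Section weak_form.
Variables (T eta B M L B0 : R) (V q0 : R -> R) (q : R -> R -> R).
Hypotheses (T0 : 0 < T) (eta0 : 0 < eta) (B_0 : 0 <= B) (MB : M <= B)
  (cV : continuous V) (VL : forall u, `|u| <= B -> `|V u| <= L)
  (ws : weak_solution T eta V q0 q)
  (qbd : forall t, 0 <= t <= T -> {ae mu, forall x, `|q t x| <= M} /\ (TV_seminorm (q t) <= M%:E)%E)
  (mq0 : meas q0) (q0B : {ae mu, forall x, `|q0 x| <= B0}).

Local Notation Q := (cutoff T B q).
Local Notation W := (Pot eta^-1 V Q).

Let cq : continuous_L1loc T q. Proof. by case: ws. Qed.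
Let mq : measurable_fun (`[0, T] `*` setT) (fun z : R * R => q z.1 z.2). Proof. by case: ws. Qed.
Let L0 : 0 <= L. Proof. by apply: le_trans (VL (u := 0) _); rewrite ?normr0. Qed.
Let ei0 : 0 < eta^-1. Proof. by rewrite invr_gt0. Qed.
Let mV : meas V. Proof. exact: continuous_meas. Qed.
Let mQ : measurable_fun setT (fun z : R * R => Q z.1 z.2). Proof. exact: cutoff_meas. Qed.

Let mW : measurable_fun setT (fun z : R * R => W z.1 z.2).
Proof.
apply: (@meas_conv2 _ (K eta^-1) (fun z => V (Q z.1 z.2))); first exact: (nle_K ei0).1.
exact: (measurableT_comp mV mQ).
Qed.

Lemma pot_bm t : bm (W t) L.
Proof.
have bV : bm (fun x => V (Q t x)) L.
  split=> [|x]; last by apply: VL; exact: cutoff_le.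
  exact: (measurableT_comp mV (cutoff_bm B_0 mq t).1).
by have := bm_conv (nle_K ei0) bV; rewrite mulr1.
Qed.

(** Test with chi(t) phi(x), whose support lies in the admissible strip since - 42 < - 2 and t1 < T;
    Fubini then separates time and space. *)
Lemma weak_tensor chi phi t1 : of_class_C 1 chi -> of_class_C 1 phi -> t1 < T ->
  (forall t, t \notin `[- 2, t1] -> chi t = 0) -> compactly_supported_in setT phi ->
  I (fun tau => (derive1 chi tau * I (fun x => Q tau x * phi x)
     + chi tau * I (fun x => Q tau x * W tau x * derive1 phi x)) * \1_`]0, T[%classic tau)
  + chi 0 * I (fun x => q0 x * phi x) = 0.
Proof.
move=> cchi cphi t1T chi0 sphi.
have [r [D [r0 out pD dD]]] := test_bounds cphi sphi.
have rr : - r <= r by lra.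
have schi : compactly_supported_in setT chi.
  apply: (@compact_supp_itv _ _ (Num.max 2 `|t1|)) => t; apply: contraNeq => ct.
  rewrite in_itv/= -ler_norml.
  have : t \in `[- 2, t1] by apply: contraNT ct => /chi0 ->.
  rewrite in_itv/= => /andP[h1 h2]; rewrite le_max.
  have [t0|t0] := leP 0 t; last by rewrite ltr0_norm//; apply/orP; left; lra.
  by rewrite ger0_norm//; apply/orP; right; apply: le_trans h2 (ler_norm _).
have [_ [C [_ _ cC dC]]] := test_bounds cchi schi.
have C0 : 0 <= C by apply: le_trans (cC 0).
have D0 : 0 <= D by apply: le_trans (pD 0).
have mchi := continuous_meas (class_C1_cont0 cchi); have mphi := continuous_meas (class_C1_cont0 cphi).
have mdchi := continuous_meas (class_C1_cont cchi); have mdphi := continuous_meas (class_C1_cont cphi).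
have [_ _ _ _ H] := ws.
pose Phi (z : R * R) := chi z.1 * phi z.2.
have sPhi : compactly_supported_in (`]-42%:R, T[ `*` setT) Phi.
  apply: (tensor_supp chi0 (fun x xr => (out x xr).1)) => -[t x] /= [+ _].
  by rewrite !in_itv/= => /andP[h1 h2]; split => //; apply/andP; split; lra.
have {H} H := H _ (tensor_class_C1 cchi cphi) sPhi.
have nphi : nle phi ((r - - r) * D).
  by apply: nle_supp => // x xr; exact: (out x xr).1.
have ndphi : nle (derive1 phi) ((r - - r) * D).
  by apply: nle_supp => // x xr; exact: (out x xr).2.
have bQ t := cutoff_bm (T := T) B_0 mq t.
have n1 t : nle (fun x => Q t x * phi x) (B * ((r - - r) * D)) by apply: nleM => //; [exact: (bQ t).1|exact: (bQ t).2].
have bQW t := bmM (bQ t) (pot_bm t).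
have n2 t : nle (fun x => Q t x * W t x * derive1 phi x) (B * L * ((r - - r) * D)).
  by apply: nleM => //; [exact: (bQW t).1|exact: (bQW t).2].
pose J t : R := \1_`]0, T[%classic t.
pose G t x := (derive1 chi t * (Q t x * phi x) + chi t * (Q t x * W t x * derive1 phi x)) * J t.
have e2 : I (fun x => q0 x * (chi 0 * phi x)) = chi 0 * I (fun x => q0 x * phi x).
  rewrite -IZ; first by apply: eqI => x; ring.
  apply: (@nle_integ _ _ (`|B0| * ((r - - r) * D))).
  apply: nle_aele (nleZ B0 nphi); first exact: measurable_funM.
  move: q0B; apply: aeS => x qx; rewrite !normrM ler_wpM2r//.
  by apply: le_trans qx _; exact: ler_norm.
have e1 : \int[(mu \x mu)%E]_(z in `]0, T[ `*` setT)
    (q z.1 z.2 * ('D_(1, 0) Phi z + nonlocal eta V q z.1 z.2 * 'D_(0, 1) Phi z)) =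
    I (fun tau => (derive1 chi tau * I (fun x => Q tau x * phi x)
     + chi tau * I (fun x => Q tau x * W tau x * derive1 phi x)) * J tau).
  have mD : measurable (`]0, T[ `*` setT : set (R * R)) by apply: measurableX.
  have in0T t : `]0, T[%classic t -> 0 <= t <= T by rewrite /= in_itv/= => /andP[h1 h2]; rewrite !ltW.
  have FE z : ((fun z : R * R => q z.1 z.2 * ('D_(1, 0) Phi z + nonlocal eta V q z.1 z.2 * 'D_(0, 1) Phi z)) \_ (`]0, T[ `*` setT)) z =
     ((fun z : R * R => q z.1 z.2 * (derive1 chi z.1 * phi z.2 + W z.1 z.2 * (chi z.1 * derive1 phi z.2))) \_ (`]0, T[ `*` setT)) z.
    rewrite !patchE; case: ifPn => // /set_mem [zT _].
    have [_ ->] := derive_tensor_left phi z cchi; have [_ ->] := derive_tensor_right chi z cphi.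
    by rewrite (nonlocal_cutoff B_0 MB cq mq qbd z.2 eta0 cV VL (in0T _ zT)).
  have m1 f : meas f -> measurable_fun setT (fun z : R * R => f z.1) by move=> mf; apply: (measurableT_comp mf); mtac.
  have m2 f : meas f -> measurable_fun setT (fun z : R * R => f z.2) by move=> mf; apply: (measurableT_comp mf); mtac.
  have k1 := m1 _ mchi; have k2 := m1 _ mdchi; have k3 := m2 _ mphi; have k4 := m2 _ mdphi.
  rewrite Rintegral_mkcond (funext FE).
  pose c t := ((C * (B * ((r - - r) * D)) + C * (B * L * ((r - - r) * D)))) * \1_`[0, T]%classic t.
  have X0 : 0 <= (C * (B * ((r - - r) * D)) + C * (B * L * ((r - - r) * D))).
    by apply: addr_ge0; apply: mulr_ge0 => //; [exact: nle_ge0 (n1 0)|exact: nle_ge0 (n2 0)].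
  rewrite (@I_prod _ _ G c _ _ _ _ (nle_indicM (ltW T0) X0)).
  - apply: eqI => t; rewrite /G.
    have i1 := integZ (derive1 chi t) (nle_integ (n1 t)); have i2 := integZ (chi t) (nle_integ (n2 t)).
    rewrite (eqI (g := fun x => J t * (derive1 chi t * (Q t x * phi x) + chi t * (Q t x * W t x * derive1 phi x)))); last by move=> x; ring.
    rewrite IZ; last exact: integD.
    by rewrite ID// (IZ _ (nle_integ (n1 t))) (IZ _ (nle_integ (n2 t))); ring.
  - apply/(measurable_restrictT _ _).1 => //; apply: measurable_funM.
      apply: measurable_funS mq => //; first exact: measurableX.
      by move=> z [zT _]; split => //; rewrite /= in_itv/=; exact: in0T.
    by apply: measurable_funTS; mtac.
  - move=> t; have [tT|tT] := pselect (`]0, T[%classic t); last first.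
      apply: nearW => x; rewrite patchE /G /J indicE memNset ?memNset ?mulr0//.
      by move=> -[].
    move: (cutoff_ae MB qbd (in0T _ tT)); apply: aeS => x qx.
    rewrite patchE mem_set//= /G /J indicE mem_set//= -qx; ring.
  - move=> t; have nG : nle (G t) ((C * (B * ((r - - r) * D)) + C * (B * L * ((r - - r) * D))) * `|J t|).
      have n3 := nleZ (J t) (nleD (nleZ (derive1 chi t) (n1 t)) (nleZ (chi t) (n2 t))).
      rewrite (_ : G t = fun x => J t * (derive1 chi t * (Q t x * phi x) + chi t * (Q t x * W t x * derive1 phi x))); last by apply/funext => x; rewrite /G; ring.
      apply: nleC n3; rewrite mulrC ler_wpM2r// lerD// ler_wpM2r//; [exact: nle_ge0 (n1 0)|exact: nle_ge0 (n2 0)].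
    apply: nleC nG; rewrite /c normrM ger0_norm// ler_wpM2l//.
    rewrite /J !indicE; have [tT|tT] := pselect (`]0, T[%classic t).
      have tT' : `[0, T]%classic t by rewrite /= in_itv/=; exact: in0T.
      by rewrite (mem_set tT) (mem_set tT') normr1.
    by rewrite memNset// normr0.
by rewrite -e2 -/(J _) -e1; exact: H.
Qed.

(** [weak_derivative_identity] for the pairing of Q with [phi]; L^1_loc continuity on the support of
    [phi] makes this pairing continuous in time. *)
Lemma weak_test phi s t : of_class_C 1 phi -> compactly_supported_in setT phi ->
  0 <= s -> s <= t -> t <= T ->
  I (fun x => Q 0 x * phi x) = I (fun x => q0 x * phi x) /\
  I (fun x => Q t x * phi x) - I (fun x => Q s x * phi x) =
    I (fun tau => I (fun x => Q tau x * W tau x * derive1 phi x) * \1_`[s, t]%classic tau).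
Proof.
move=> cphi sphi s0 st tT.
have [r [D [r0 out pD dD]]] := test_bounds cphi sphi.
have rr : - r <= r by lra.
have D0 : 0 <= D by apply: le_trans (pD 0).
have mphi := continuous_meas (class_C1_cont0 cphi); have mdphi := continuous_meas (class_C1_cont cphi).
have nphi : nle phi ((r - - r) * D).
  by apply: nle_supp => // x xr; exact: (out x xr).1.
have ndphi : nle (derive1 phi) ((r - - r) * D).
  by apply: nle_supp => // x xr; exact: (out x xr).2.
have bQ t' := cutoff_bm (T := T) B_0 mq t'.
have n1 t' : nle (fun x => Q t' x * phi x) (B * ((r - - r) * D)) by apply: nleM => //; [exact: (bQ t').1|exact: (bQ t').2].
have bQW t' := bmM (bQ t') (pot_bm t').
have n2 t' : nle (fun x => Q t' x * W t' x * derive1 phi x) (B * L * ((r - - r) * D)).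
  by apply: nleM => //; [exact: (bQW t').1|exact: (bQW t').2].
have m2 f : meas f -> measurable_fun setT (fun z : R * R => f z.2) by move=> mf; apply: (measurableT_comp mf); mtac.
have k3 := m2 _ mphi; have k4 := m2 _ mdphi.
apply: (@weak_derivative_identity _ T _ (B * ((r - - r) * D)) (B * L * ((r - - r) * D))
  (fun t => I (fun x => Q t x * phi x)) (fun t => I (fun x => Q t x * W t x * derive1 phi x))) => //.
- split; last by move=> t'; exact: nle_normI (n1 t').
  by apply: (meas_param (G := fun z : R * R => Q z.1 z.2 * phi z.2)); mtac.
- split; last by move=> t'; exact: nle_normI (n2 t').
  by apply: (meas_param (G := fun z : R * R => Q z.1 z.2 * W z.1 z.2 * derive1 phi z.2)); mtac.
- move=> u e uT e0; have D1 : 0 < D + 1 by lra.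
  have [d d0 Hd] := cutoff_cont B_0 cq mq r uT (divr_gt0 e0 D1).
  exists d => // w wT wu; rewrite -IB; [|exact: nle_integ (n1 w)|exact: nle_integ (n1 u)].
  apply: nle_normI; apply: (@nleC _ _ (D * (e / (D + 1)))).
    by rewrite mulrA ler_pdivrMr// mulrC ler_wpM2l//; lra.
  have := nleM mphi pD (Hd w wT wu); congr nle; apply/funext => x.
  rewrite indic_itv; have [xr|xr] := boolP (x \in `[- r, r]); last by rewrite (out x xr).1; ring.
  by move: xr; rewrite in_itv/= => ->; ring.
- move=> chi t1 cchi t1T chi0; exact: (weak_tensor cchi cphi t1T chi0 sphi).
Qed.

Lemma weak_moll e s t x : 0 < e -> 0 <= s -> s <= t -> t <= T ->
  conv (rho e) (Q 0) x = conv (rho e) q0 x /\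
  conv (rho e) (Q t) x - conv (rho e) (Q s) x =
    I (fun tau => conv (drho e) (fun y => Q tau y * W tau y) x * \1_`[s, t]%classic tau).
Proof.
move=> e0 s0 st tT; have [C cC] := rho_c11 e0; have cS := c11_shift (- x) cC.
have cphi := c11_class cS.
have sphi : compactly_supported_in setT (fun y => rho e (y - x)).
  apply: (@compact_supp_itv _ _ (`|x| + 3 * e)) => y yo.
  apply: (rho_supp e0 _).1; apply: contra yo; rewrite !in_itv/= -!ler_norml => h.
  by rewrite -[y](subrK x) addrC (le_trans (ler_normD _ _))// lerD.
have E k f : meas k -> meas f -> I (fun y => f y * k (y - x)) = conv k f x.
  move=> mk mf; rewrite /conv -[RHS](I_shift (- x)).
    by apply: eqI => y; rewrite mulrC addrCA subrr addr0.
  by apply: measurable_funM => //; exact: meas_shiftl.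
have mr := meas_rho e; have md := meas_drho e.
have bQ t' := (cutoff_bm (T := T) B_0 mq t').1.
have bW t' := pot_bm t'.
have [h1 h2] := weak_test cphi sphi s0 st tT.
split; first by rewrite -[LHS](E _ _ mr (bQ 0)) -[RHS](E _ _ mr mq0).
rewrite -[X in X - _](E _ _ mr (bQ t)) -[X in _ - X](E _ _ mr (bQ s)) h2.
apply: eqI => tau; congr (_ * _).
rewrite -E//; last by apply: measurable_funM; [exact: bQ|exact: (bW tau).1].
by apply: eqI => y; rewrite (c11_derive1 _ cS).
Qed.

End weak_form.
End weak_formulation.

(** * The initial datum and the final assembly *)

Section initial_data.
Variable R : realType.
Implicit Types (f g k : R -> R) (a b x y c e h u w s t B C D E L M m N d tau r T eta : R).
Notation mu := (@lebesgue_measure R).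
Notation K := (@exponential_pdf R).

Lemma TV_fin f B : bm f B -> (TV_seminorm f < +oo)%E ->
  TV_seminorm f = (fine (TV_seminorm f))%:E /\ tvle f (fine (TV_seminorm f)).
Proof.
move=> bf tv.
have fin : TV_seminorm f \is a fin_num.
  (* The value -oo is excluded because it would bound an L^1 norm by - 1. *)
  rewrite fin_real// tv andbT ltNge leeNy_eq.
  apply/negP => /eqP tvN.
  have [_ /(_ 1)/nle_ge0] : tvle f (-1) by apply: TV_tvle bf _; rewrite tvN leNye.
  by rewrite normr1 mulr1; lra.
by split; [|apply: TV_tvle bf _]; rewrite fineK.
Qed.

Lemma le_ae_itv f a b C : continuous f -> {ae mu, forall x, a < x < b -> f x <= C} ->
  forall x, a < x < b -> f x <= C.
Proof.
move=> cf aef x /andP[ax xb]; apply/ler_addgt0Pr => e e0.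
have /cvgrPdist_lt/(_ e e0) [d /= d0 Hd] := cf x.
have lt : Num.max a (x - d) < Num.min b (x + d).
  by rewrite gt_max !lt_min; apply/andP; split; apply/andP; split; lra.
have [y /andP[]] := ae_dense lt aef.
rewrite gt_max => /andP[ay xy]; rewrite lt_min => /andP[yb yx]; rewrite ay yb => /(_ isT) fy.
have /Hd : `|x - y| < d by rewrite ltr_norml; apply/andP; split; lra.
by rewrite ltr_norml => /andP[_ ?]; lra.
Qed.

Lemma le_itv_closure f a b C : continuous f -> a < b -> (forall x, a < x < b -> f x <= C) -> f b <= C.
Proof.
move=> cf ab Hf; apply/ler_addgt0Pr => e e0.
have /cvgrPdist_lt/(_ e e0) [d /= d0 Hd] := cf b.
pose m := Num.min d (b - a).
have m0 : 0 < m by rewrite lt_min d0 subr_gt0.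
have [m1 m2] : m <= d /\ m <= b - a by rewrite !ge_min !lexx orbT.
have /Hd : `|b - (b - m / 2)| < d by rewrite opprB addrC subrK gtr0_norm; lra.
have /Hf : a < b - m / 2 < b by apply/andP; split; lra.
by rewrite ltr_norml => ? /andP[_ ?]; lra.
Qed.

Lemma Linfty_ge0 f : (0 <= Linfty_norm f)%E. Proof. exact: Lnorm_ge0. Qed.

Lemma ae_shift (P : R -> Prop) z : {ae mu, forall x, P x} -> {ae mu, forall x, P (x + z)}.
Proof.
move=> [N [mN N0 sub]]; exists ((fun x => x + z) @^-1` N); split.
- by rewrite -[X in measurable X]setTI; exact: measurable_add_fun.
- by rewrite lebesgue_measure_shift.
- by move=> x /= Px; apply: sub.
Qed.

Section MVT.
Variable V : R -> R.
Hypothesis dV : forall x, is_derive x 1 V (derive1 V x).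

Lemma MVT_derive1 u w : u < w -> exists2 c, u < c < w & V w - V u = derive1 V c * (w - u).
Proof.
move=> uw; have cV : continuous V by move=> x; exact: is_derive_continuous (dV x).
have [c cin E] := MVT uw (fun x _ => dV x) (continuous_subspaceT cV).
by exists c => //; move: cin; rewrite in_itv.
Qed.

Lemma derive1_le0_nonincr : (forall x, derive1 V x <= 0) -> forall u w, u <= w -> V w <= V u.
Proof.
move=> dV0 u w; rewrite le_eqVlt => /predU1P[->//|uw].
have [c _ E] := MVT_derive1 uw; rewrite -subr_le0 E mulr_le0_ge0// subr_ge0 ltW//.
Qed.

Lemma derive1_lip b C : (forall x, 0 < x < b -> `|derive1 V x| <= C) ->
  forall u w, 0 <= u <= b -> 0 <= w <= b -> `|V w - V u| <= C * `|w - u|.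
Proof.
move=> H.
have key u w : 0 <= u <= b -> 0 <= w <= b -> u < w -> `|V w - V u| <= C * `|w - u|.
  move=> /andP[u0 ub] /andP[w0 wb] uw; have [c /andP[c1 c2] ->] := MVT_derive1 uw.
  by rewrite normrM ler_wpM2r// H//; apply/andP; split; lra.
move=> u w uI wI; have [uw|wu|->] := ltgtP u w; [exact: key| |by rewrite !subrr normr0 mulr0].
by rewrite distrC [`|w - u|]distrC; exact: key.
Qed.
End MVT.

Section assembly.
Variables (T eta Mx : R) (V q0 : R -> R) (q : R -> R -> R).
Hypotheses (T0 : 0 < T) (eta0 : 0 < eta) (mq0 : meas q0)
  (EMx : Linfty_norm q0 = Mx%:E)
  (q0_ge0 : {ae mu, forall x, 0 <= q0 x}) (tv0 : (TV_seminorm q0 < +oo)%E)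
  (CV : of_class_C 2 V) (dV0 : forall x, derive1 V x <= 0)
  (ws : weak_solution T eta V q0 q).

Local Notation W := (nonlocal eta V q).

Let ei0 : 0 < eta^-1. Proof. by rewrite invr_gt0. Qed.
Let dV x : is_derive x 1 V (derive1 V x).
Proof. by have [/(_ 0%N isT x) d _] := CV; split; rewrite ?derive1E. Qed.
Let cV : continuous V. Proof. by move=> x; exact: is_derive_continuous (dV x). Qed.
Let cdV : continuous (derive1 V).
Proof.
move=> x; have [/(_ 1%N isT x) d _] := CV.
by apply: differentiable_continuous; apply/derivable1_diffP.
Qed.
Let mV : meas V. Proof. exact: continuous_meas. Qed.
Let mdV : meas (derive1 V). Proof. exact: continuous_meas. Qed.
Let Mx0 : 0 <= Mx. Proof. by rewrite -lee_fin -EMx Linfty_ge0. Qed.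
Let q0B : {ae mu, forall x, `|q0 x| <= Mx}. Proof. by apply: Linfty_ae; rewrite EMx. Qed.

Lemma solution_cutoff : exists B M : R, [/\ 0 <= B, Mx <= B, M <= B &
  forall t, 0 <= t <= T -> {ae mu, forall x, `|q t x| <= M} /\ (TV_seminorm (q t) <= M%:E)%E].
Proof.
have [_ cq bq _ _] := ws.
have [M M0 H] := weak_solution_bound T0 cq bq.
have M0x := Mx0; by exists (M + Mx), M; split => //; lra.
Qed.

Section cut.
Variables (B M : R).
Hypotheses (B0 : 0 <= B) (MxB : Mx <= B) (MB : M <= B)
 (qbd : forall t, 0 <= t <= T -> {ae mu, forall x, `|q t x| <= M} /\ (TV_seminorm (q t) <= M%:E)%E).

Local Notation Q := (cutoff T B q).

Let cq : continuous_L1loc T q. Proof. by case: ws. Qed.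
Let mq : measurable_fun (`[0, T] `*` setT) (fun z : R * R => q z.1 z.2). Proof. by case: ws. Qed.

Lemma VL_ex : exists2 L, loc11 V (derive1 V) B L & forall u, `|u| <= B -> `|V u| <= L.
Proof. by have [L lV] := C2_loc11 B0 CV; exists L => //; case: lV. Qed.

(** The weak formulation identifies all mollifications of Q(0) and q0, and these converge almost
    everywhere. The datum is clamped first because [ae_moll] needs a bound at every point. *)
Lemma initial_ae : {ae mu, forall x, Q 0 x = q0 x}.
Proof.
have [L _ VL] := VL_ex.
pose p x := clamp B (q0 x).
have bp : bm p B by split; [exact: meas_clamp|move=> x; exact: clampB].
have pq : {ae mu, forall x, q0 x = p x}.
  by move: q0B; apply: aeS => x qx; rewrite /p clamp_id//; exact: le_trans MxB.
have E n : conv (rho n.+1%:R^-1) (Q 0) = conv (rho n.+1%:R^-1) p.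
  have n0 : 0 < n.+1%:R^-1 :> R by rewrite invr_gt0.
  apply/funext => x.
  have [-> _] := weak_moll T0 eta0 B0 MB cV VL ws qbd mq0 q0B x n0 (lexx 0) (lexx 0) (ltW T0).
  have mr := @meas_rho R n.+1%:R^-1.
  apply: I_ae; [exact: (measurable_funM mr (meas_shiftl x mq0))|exact: (measurable_funM mr (meas_shiftl x bp.1))|].
  by apply: aeS (ae_shift x pq) => z; rewrite addrC => ->.
have h1 := ae_moll (cutoff_bm (T := T) B0 mq 0); have h2 := ae_moll bp.
have h12 := aeS2 (fun x => @conj _ _) h1 h2.
apply: aeS2 h12 pq => x [c1 c2] ->.
apply: cvg_uniq c1 _; apply: cvg_trans c2; apply: near_eq_cvg; apply: nearW => n.
by rewrite E.
Qed.

(** A representative of q0 with all its values in [0, Mx], the interval on which the Lipschitz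
    constant of V is known. *)
Let q0s x := Num.max 0 (Num.min Mx (q0 x)).

Let q0s_itv x : 0 <= q0s x <= Mx.
Proof. by rewrite /q0s le_max lexx /= ge_max ge_min lexx Mx0. Qed.

Let bq0s : bm q0s Mx.
Proof.
split=> [|x]; last by have /andP[h1 h2] := q0s_itv x; rewrite ger0_norm.
by apply: measurable_maxr; [exact: measurable_cst|apply: measurable_minr => //; exact: measurable_cst].
Qed.

Let q0s_ae : {ae mu, forall x, q0 x = q0s x}.
Proof.
apply: aeS2 q0_ge0 q0B => x h1; rewrite ger0_norm// => h2.
by rewrite /q0s min_r// max_r.
Qed.

Lemma nonlocal_cutoff_fun t : 0 <= t <= T -> W t = Pot eta^-1 V Q t.
Proof.
by have [L _ VL] := VL_ex; move=> tT; apply/funext => x; exact: (nonlocal_cutoff B0 MB cq mq qbd x eta0 cV VL tT).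
Qed.

Lemma TV_nonlocal_initial C : {ae mu, forall x, 0 < x < Mx -> `|derive1 V x| <= C} -> 0 <= C ->
  (TV_seminorm (W 0) <= C%:E * TV_seminorm q0)%E.
Proof.
move=> dVC C0; have [L _ VL] := VL_ex.
have T00 : 0 <= (0 : R) <= T by rewrite lexx ltW.
have bV : bm (fun x => V (q0s x)) L.
  split=> [|x]; first exact: (measurableT_comp mV bq0s.1).
  by apply: VL; exact: le_trans (bq0s.2 x) MxB.
have -> : W 0 = conv (K eta^-1) (fun x => V (q0s x)).
  rewrite (nonlocal_cutoff_fun T00); apply/funext => x.
  have mK := (nle_K ei0).1.
  apply: I_ae.
  - exact: (measurable_funM mK (measurableT_comp mV (meas_shiftl x (cutoff_bm (T := T) B0 mq 0).1))).
  - exact: (measurable_funM mK (meas_shiftl x bV.1)).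
  have h1 := ae_shift x initial_ae; have h2 := ae_shift x q0s_ae.
  by apply: aeS2 h1 h2 => z; rewrite addrC => -> ->.
have tv1 := tv0; rewrite (TV_ae mq0 bq0s.1 q0s_ae) in tv1 *.
have [E tv] := TV_fin bq0s tv1.
rewrite E -EFinM.
have cn : continuous (fun x => `|derive1 V x|) by move=> x; apply: cvg_norm; exact: cdV.
(* By continuity the almost everywhere bound on V' holds throughout (0, Mx), so V has Lipschitz
   constant C on the closed interval. *)
have lipV := derive1_lip dV (le_ae_itv cn dVC).
have tV : tvle (fun x => V (q0s x)) (C * fine (TV_seminorm q0s)).
  split=> [|z]; first exact: bV.1.
  have := nleZ C (tv.2 z); rewrite ger0_norm// mulrA => nz; apply: nle_le nz => [|x].
    by apply: measurable_funB; [exact: meas_shift bV.1|exact: bV.1].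
  by rewrite [leRHS]normrM (ger0_norm C0); exact: lipV.
have := tvle_conv (nle_K ei0) bV tV; rewrite mulr1.
exact: tvle_TV (bm_conv (nle_K ei0) bV).
Qed.

Lemma TV_nonlocal_decreasing m t : 0 <= m -> {ae mu, forall x, m <= q0 x} -> m <= Mx ->
  (forall u, m <= u <= Mx -> derive1 V u * u - V u + V m <= 0) ->
  (TV_seminorm (W 0) < +oo)%E -> 0 <= t <= T ->
  (TV_seminorm (W t) <= TV_seminorm (W 0))%E.
Proof.
move=> m0 mq_ mM cond tvW tT; have [L lV VL] := VL_ex.
have T00 : 0 <= (0 : R) <= T by rewrite lexx ltW.
have T_0 := ltW T0.
have mQ := cutoff_meas B mq.
have bW := pot_bm eta0 B0 cV VL ws 0.
rewrite (nonlocal_cutoff_fun T00) in tvW *; rewrite (nonlocal_cutoff_fun tT).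
have [E tv] := TV_fin bW tvW; rewrite E.
have mQ0 := (cutoff_bm (T := T) B0 mq 0).1.
have npp sg c : {ae mu, forall x, sg * (Q 0 x - c) <= 0} -> nle (fun x => pospart (sg * (Q 0 x - c))) 0.
  move=> h; apply: nle0_ae.
    by apply: meas_pospart; rewrite /meas in mQ0; mtac.
  by move: h; apply: aeS => x h; have [[? ->]|[? ->]] := ppP (sg * (Q 0 x - c)) => //; lra.
apply: (@TV_nonlocal_decay _ T eta^-1 V (derive1 V) B L M m Mx (fine (TV_seminorm (Pot eta^-1 V Q 0))) Q) => //.
- by move=> t' x; exact: cutoff_le.
- by move=> t' t'T; exact: cutoff_tvle qbd t' t'T.
- move=> e s t' x e0 s0 st t'T.
  by have [] := weak_moll T0 eta0 B0 MB cV VL ws qbd mq0 q0B x e0 s0 st t'T.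
- by move=> u w _ _; exact: (derive1_le0_nonincr dV dV0).
- by move=> u uI; have := cond u uI; lra.
- by apply: npp; apply: aeS2 initial_ae mq_ => x ->; lra.
- apply: npp; apply: aeS2 initial_ae q0B => x -> h.
  by have := le_trans (ler_norm _) h; lra.
Qed.

End cut.
End assembly.
End initial_data.

Theorem proposition4p3 (R : realType) (T eta : R) (q0 V : R -> R)
    (q : R -> R -> R) :
  let q0_inf : \bar R := ess_inf lebesgue_measure (EFin \o q0) in
  let q0_norm : \bar R := Linfty_norm q0 in
  let dV_norm : \bar R := Linfty_norm_on `]0, fine q0_norm[ (derive1 V) in
  let W := nonlocal eta V q in
  0 < T -> 0 < eta ->
  measurable_fun setT q0 ->
  (q0_norm < +oo)%E ->
  {ae lebesgue_measure, forall x, 0 <= q0 x} ->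
  (TV_seminorm q0 < +oo)%E ->
  of_class_C 2 V ->
  (forall x, derive1 V x <= 0) ->
  weak_solution T eta V q0 q ->
  (forall x : R, (q0_inf < x%:E)%E -> (x%:E < q0_norm)%E ->
    derive1 V x * x - V x + V (fine q0_inf) <= 0) ->
  forall t : R, t \in `[0, T] ->
    (TV_seminorm (W t) <= TV_seminorm (W 0%R))%E /\
    (TV_seminorm (W 0%R) <= dV_norm * TV_seminorm q0)%E.
Proof.
move=> q0_inf q0_norm dV_norm W T0 eta0 mq0 norm_fin q0_ge0 tv0 CV dV0 ws cond t.
rewrite in_itv/= => tT; pose Mx := fine q0_norm.
have EMx : q0_norm = Mx%:E by rewrite fineK// ge0_fin_numE// Linfty_ge0.
have Mx0 : 0 <= Mx by rewrite -lee_fin -EMx Linfty_ge0.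
have q0B : {ae lebesgue_measure, forall x, `|q0 x| <= Mx} by apply: Linfty_ae; rewrite -EMx.
have inf_le : {ae lebesgue_measure, forall x, (q0_inf <= (q0 x)%:E)%E} by exact: ess_inf_le.
have inf_ge0 : (0 <= q0_inf)%E by apply/ess_infP; move: q0_ge0; apply: aeS => x; rewrite /= lee_fin.
have infMx : (q0_inf <= Mx%:E)%E.
  (* Any point at which both almost everywhere bounds hold orders the two constants. *)
  have h := aeS2 (fun x => @conj _ _) inf_le q0B.
  have [x _ [h1 h2]] := ae_dense (@ltr01 R) h.
  by apply: le_trans h1 _; rewrite lee_fin (le_trans (ler_norm _) h2).
pose m := fine q0_inf.
have Em : q0_inf = m%:E by rewrite fineK// ge0_fin_numE// (le_lt_trans infMx (ltry _)).
have m0 : 0 <= m by rewrite -lee_fin -Em.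
have mM : m <= Mx by rewrite -lee_fin -Em.
have mq : {ae lebesgue_measure, forall x, m <= q0 x}.
  by move: inf_le; apply: aeS => x; rewrite Em lee_fin.
have [B [M [B0 MxB MB qbd]]] := solution_cutoff T0 EMx ws.
have [L [_ dVL _ _ _]] := C2_loc11 B0 CV.
have L0 : 0 <= L by apply: le_trans (dVL 0 _); rewrite ?normr0.
(* Finiteness of the norm of V', without which [fine] would return the default 0. *)
have norm_le : (dV_norm <= L%:E)%E.
  apply: ae_Linfty; apply: nearW => x; rewrite patchE; case: ifPn => [|_]; last by rewrite normr0.
  rewrite inE/= in_itv/= => /andP[x0 xM]; apply: dVL.
  by rewrite ger0_norm ?ltW// (lt_le_trans xM).
have dV_ge0 : (0 <= dV_norm)%E by exact: Linfty_ge0.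
pose C := fine dV_norm.
have EC : dV_norm = C%:E by rewrite fineK// ge0_fin_numE// (le_lt_trans norm_le (ltry _)).
have C0 : 0 <= C by rewrite -lee_fin -EC.
have dVC : {ae lebesgue_measure, forall x, 0 < x < Mx -> `|derive1 V x| <= C}.
  have : (dV_norm <= C%:E)%E by rewrite EC.
  move=> /Linfty_ae; apply: aeS => x + xI; have xD : `]0, Mx[%classic x by rewrite /= in_itv.
  by rewrite patchE (mem_set xD).
(* Proved first, because the decay estimate needs the initial variation of W to be finite. *)
have part2 : (TV_seminorm (W 0%R) <= dV_norm * TV_seminorm q0)%E.
  rewrite EC; exact: (TV_nonlocal_initial T0 eta0 mq0 EMx q0_ge0 tv0 CV ws B0 MxB MB qbd).
split; last exact: part2.
apply: (TV_nonlocal_decreasing T0 eta0 mq0 EMx CV dV0 ws B0 MxB MB qbd m0 mq mM) => //.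
- have cdV : continuous (derive1 V).
    move=> x; have [/(_ 1%N isT x) d _] := CV.
    by apply: differentiable_continuous; apply/derivable1_diffP.
  have cV : continuous V.
    move=> x; have [/(_ 0%N isT x) d _] := CV.
    by apply: differentiable_continuous; apply/derivable1_diffP.
  (* The condition is given on the open interval only. At m it reduces to V'(m) m <= 0, which holds
     by sign; at Mx, when m < Mx, it follows by continuity from the left. *)
  have cond' u : m < u < Mx -> derive1 V u * u - V u + V m <= 0.
    by move=> /andP[mu uM]; apply: cond; rewrite ?Em ?EMx lte_fin.
  move=> u /andP[]; rewrite le_eqVlt => /predU1P[<- _|mu].
    by rewrite subrK mulr_le0_ge0.
  rewrite le_eqVlt => /predU1P[uE|uM]; last by apply: cond'; rewrite mu.
  rewrite uE in mu *.
  apply: (@le_itv_closure _ (fun u => derive1 V u * u - V u + V m) m) => //.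
  move=> x; apply: cvgD; last exact: cvg_cst.
  by apply: cvgB; [apply: cvgM; [exact: cdV|exact: cvg_id]|exact: cV].
- by apply: le_lt_trans part2 _; rewrite EC lte_mul_pinfty.
Qed.
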